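(* Let $0\le k\le n$ be integers and let $\Gamma$ be a proper circular arc graph on $n$ vertices that is obtained from a natural unit interval graph $G$ on $[n+k]=\{1,\dots,n+k\}$, whose first $k$ vertices $1,\dots,k$ form a clique and whose last $k$ vertices $n+1,\dots,n+k$ form a clique, by identifying the vertex $n+r$ with the vertex $r$ for each $1\le r\le k$. Let $N\ge n$ be an integer. Then \[ X_\Gamma(\bm x)=\sum_{j}\ \sum_{\substack{T\supseteq T_j\\ T\setminus T_j=\{k+1,\dots,n+k\}\\ (c_T(n+1),\dots,c_T(n+k))=j}}\ \prod_{v=k+1}^{n+k} A\bigl(c_T(v)\mid c_T(N(v))\bigr)\,\frac{e_{c_T(v)}}{e_{c_T(v)-1}}, \] where $j=(j_1,\dots,j_k)$ ranges over $k$-tuples of distinct elements of $[N]=\{1,\dots,N\}$ and $T$ ranges over tableaux with at most $N$ columns.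
   Context: Graphs are finite; when vertices are identified, parallel edges are suppressed, and $\Gamma$ has no loops. $X_\Gamma(\bm x)=\sum_\kappa\prod_{v\in V(\Gamma)}x_{\kappa(v)}$ is the chromatic symmetric function in commuting variables $\bm x=(x_1,x_2,\dots)$, the sum being over proper colorings $\kappa:V(\Gamma)\to\{1,2,\dots\}$ (adjacent vertices receive different colors). $e_i$ is the $i$-th elementary symmetric function in $\bm x$, with $e_0=1$; the right-hand side is computed in the field $\mathbb{Q}(e_1,e_2,\dots)$. A graph on $[m]$ is a natural unit interval graph if whenever $\{p,q\}$ is an edge with $p<q$, then $\{p,r\}$ and $\{r,q\}$ are edges for all $p<r<q$. A proper circular arc graph is the intersection graph of finitely many arcs of a circle, none of which contains another. For a sequence $\sigma=(\sigma_1,\dots,\sigma_\ell)$ of distinct positive integers and a positive integer $y$, set \[ A(1\mid\sigma)=\prod_r\frac{\sigma_r-1}{\sigma_r},\qquad A(\sigma_r+1\mid\sigma)=\frac{\sigma_r+1}{\sigma_r}\prod_{r'\ne r}\frac{\sigma_r-\sigma_{r'}+1}{\sigma_r-\sigma_{r'}}, \] and $A(y\mid\sigma)=0$ if $y\ne1$ and $y-1\notin\{\sigma_1,\dots,\sigma_\ell\}$. (Empty products are $1$.) Tableaux are fillings of Young diagrams by distinct integers, drawn with rows increasing to the right and columns increasing upward (French convention: row lengths weakly decrease going upward, columns are numbered $1,2,\dots$ from the left). $c_T(v)$ is the column of the entry $v$ in $T$. $N(v)$ is the sequence, in increasing order, of the neighbors of $v$ in $G$ that are smaller than $v$, and $c_T(N(v))$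 is the sequence of their columns. For $j=(j_1,\dots,j_k)$, $T_j$ is a fixed tableau with rows of lengths $j_1,\dots,j_k$ (arranged in decreasing order of length from the bottom), in which $r$ is the last entry of the row of length $j_r$ for $1\le r\le k$, and all other entries are distinct nonpositive integers (the choice does not matter). For $k=0$ there is a single empty tuple $j$ and $T_j$ is empty. $T\supseteq T_j$ means that $T$ contains $T_j$ as a subtableau, and $T\setminus T_j$ is the set of the remaining entries of $T$. Convention: if the entries of $c_T(N(v))$ are not distinct for some $v$, the smallest such $v$ is preceded by a smaller vertex whose factor $A$ is $0$, and the summand is taken to be $0$. *)

(* Defs.v *)
From HB Require Import structures.
From mathcomp Require Import all_boot all_order all_algebra.
From mathcomp Require Import finmap multiset.
From mathcomp Require Import boolp classical_sets cardinality fsbigop reals.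

Set Implicit Arguments.
Unset Strict Implicit.
Unset Printing Implicit Defensive.

Import Order.TTheory GRing.Theory Num.Theory.
Local Open Scope ring_scope.

(* A monomial in x_0, x_1, ... is a finite multiset of indices; divisibility is
   inclusion, and multiplication is the sum of multisets.  Variables and colours
   are indexed by nat, so x_i here is x_{i+1} in 1-based notation. *)
Notation monomial := (multiset nat).

Definition mdivisors (m : monomial) : seq monomial :=
  undup [seq seq_mset (mask b m) | b : (size m).-tuple bool].

Lemma mem_mdivisors (m a : monomial) : (a \in mdivisors m) = (a `<=` m)%mset.
Proof.
rewrite mem_undup; apply/mapP/msubsetP => [[b _ ->] x|le_am].
  rewrite mset_seqE -[leqRHS]count_mem_mset.
  exact/leq_count_subseq/mask_subseq.
have /count_subseqP[s /subseqP[b sz_b ->] eq_s] :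
    forall x, (count_mem x a <= count_mem x m)%N.
  by move=> x; rewrite !count_mem_mset.
have sz_b' : size b == size m by apply/eqP.
exists (Tuple sz_b'); first by rewrite mem_enum.
by apply/msetP => x; rewrite mset_seqE -(permP eq_s) count_mem_mset.
Qed.

Lemma mdivisors_uniq m : uniq (mdivisors m).
Proof. exact: undup_uniq. Qed.

Lemma mdivisors0 : mdivisors mset0 = [:: mset0].
Proof.
apply: perm_small_eq => //; apply: uniq_perm => // [|a].
  exact: mdivisors_uniq.
by rewrite mem_mdivisors msubset0 inE.
Qed.

Record powser := PowSer { coef_ps :> monomial -> rat }.

HB.instance Definition _ := gen_eqMixin powser.
HB.instance Definition _ := gen_choiceMixin powser.

Lemma powserP (f g : powser) : (f : monomial -> rat) =1 g -> f = g.
Proof. by case: f g => f [g] /= /funext ->. Qed.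

Definition ps0 := PowSer (fun=> 0).
Definition ps_opp (f : powser) := PowSer (fun m => - f m).
Definition ps_add (f g : powser) := PowSer (fun m => f m + g m).
Definition ps1 := PowSer (fun m => (m == mset0)%:R).
Definition ps_mul (f g : powser) :=
  PowSer (fun m => \sum_(a <- mdivisors m) f a * g (m `\` a)%mset).

Fact ps_addA : associative ps_add.
Proof. by move=> f g h; apply: powserP => m /=; rewrite addrA. Qed.
Fact ps_addC : commutative ps_add.
Proof. by move=> f g; apply: powserP => m /=; rewrite addrC. Qed.
Fact ps_add0 : left_id ps0 ps_add.
Proof. by move=> f; apply: powserP => m /=; rewrite add0r. Qed.
Fact ps_addN : left_inverse ps0 ps_opp ps_add.
Proof. by move=> f; apply: powserP => m /=; rewrite addNr. Qed.

HB.instance Definition _ :=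
  GRing.isZmodule.Build powser ps_addA ps_addC ps_add0 ps_addN.

Lemma msubBK (m a : monomial) : (a `<=` m)%mset -> (a `+` (m `\` a))%mset = m.
Proof.
by move/msubsetP=> le_am; apply/msetP=> x; rewrite !msetE2 subnKC.
Qed.

Fact ps_mulC : commutative ps_mul.
Proof.
move=> f g; apply: powserP => m /=.
have invB : {in mdivisors m, involutive (fun a : monomial => m `\` a)%mset}.
  move=> a; rewrite mem_mdivisors => /msubsetP le_am; apply/msetP=> x.
  by rewrite !msetE2 subKn.
have subB a : (m `\` a `<=` m)%mset.
  by apply/msubsetP=> x; rewrite msetE2 leq_subr.
rewrite (perm_big [seq (m `\` a)%mset | a <- mdivisors m]) /=.
  rewrite big_map big_seq [RHS]big_seq; apply: eq_bigr => a a_m.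
  by rewrite (invB a a_m) mulrC.
apply: uniq_perm; first exact: mdivisors_uniq.
  rewrite map_inj_in_uniq ?mdivisors_uniq // => a b a_m b_m eq_ab.
  by rewrite -(invB a a_m) eq_ab invB.
move=> a; apply/idP/mapP => [a_m|[b _ ->]]; last by rewrite mem_mdivisors subB.
by exists (m `\` a)%mset; rewrite ?invB // mem_mdivisors subB.
Qed.

Fact ps_mulA : associative ps_mul.
Proof.
move=> f g h; apply: powserP => m /=; symmetry.
pose H a b := f b * g (a `\` b)%mset * h (m `\` a)%mset.
transitivity (\sum_(a <- mdivisors m) \sum_(b <- mdivisors m | (b `<=` a)%mset)
                H a b).
  rewrite big_seq [RHS]big_seq; apply: eq_bigr => a.
  rewrite mem_mdivisors => le_am; rewrite big_distrl -[RHS]big_filter.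
  apply: perm_big; apply: uniq_perm; rewrite ?filter_uniq ?mdivisors_uniq //.
  move=> b; rewrite mem_filter !mem_mdivisors andb_idr // => le_ba.
  exact: msubset_trans le_ba le_am.
rewrite (exchange_big_dep xpredT) //= big_seq [RHS]big_seq.
apply: eq_bigr => b; rewrite mem_mdivisors => le_bm.
rewrite big_distrr -big_filter /=.
rewrite (perm_big [seq (b `+` c)%mset | c <- mdivisors (m `\` b)%mset]) /=.
  rewrite big_map; apply: eq_bigr => c _.
  by rewrite /H mulrA msetDKB msetBDA.
apply: uniq_perm; rewrite ?filter_uniq ?mdivisors_uniq //.
  rewrite map_inj_uniq ?mdivisors_uniq //; exact: can_inj (msetDKB b).
move=> a; rewrite mem_filter mem_mdivisors; apply/andP/mapP => [[le_ba le_am]|].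
  exists (a `\` b)%mset; last by rewrite msubBK.
  rewrite mem_mdivisors; apply/msubsetP => x; rewrite !msetE2.
  by move/msubsetP: le_am => /(_ x) /leq_sub2r; apply.
case=> c; rewrite mem_mdivisors => /msubsetP le_c ->.
split; apply/msubsetP=> x; rewrite msetE2 ?leq_addr //.
have := le_c x; rewrite msetE2; move/msubsetP: le_bm => /(_ x) le_x.
by rewrite leq_subRL.
Qed.

Fact ps_mul1 : left_id ps1 ps_mul.
Proof.
move=> f; apply: powserP => m /=.
have m0 : mset0 \in mdivisors m by rewrite mem_mdivisors msub0set.
rewrite (bigD1_seq mset0) ?mdivisors_uniq //= eqxx mul1r big1 => [|a /negPf ->].
  by rewrite addr0; congr (f _); apply/msetP => x; rewrite msetE2 fsfunE subn0.
by rewrite mul0r.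
Qed.

Fact ps_mulDl : left_distributive ps_mul ps_add.
Proof.
move=> f g h; apply: powserP => m /=; rewrite -big_split /=.
by apply: eq_bigr => a _; rewrite mulrDl.
Qed.

Fact ps_oner_neq0 : ps1 != ps0.
Proof.
apply/eqP => /(congr1 (fun f : powser => f mset0)) /=; rewrite eqxx.
exact/eqP/oner_neq0.
Qed.

HB.instance Definition _ := GRing.Zmodule_isComNzRing.Build powser
  ps_mulA ps_mulC ps_mul1 ps_mulDl ps_oner_neq0.

Definition ps_unit : {pred powser} := fun f => `[< exists g, g * f = 1 >].
Definition ps_inv (f : powser) : powser :=
  if pselect (exists g, g * f = 1) is left e then projT1 (cid e) else f.

Fact ps_mulV : {in ps_unit, left_inverse 1 ps_inv *%R}.
Proof.
move=> f /asboolP ex_g; rewrite /ps_inv.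
by case: pselect => [e|//]; case: cid.
Qed.
Fact ps_unitP (f g : powser) : g * f = 1 -> ps_unit f.
Proof. by move=> gf1; apply/asboolP; exists g. Qed.
Fact ps_inv_out : {in [predC ps_unit], ps_inv =1 id}.
Proof.
move=> f /asboolPn no_g; rewrite /ps_inv; by case: pselect.
Qed.

HB.instance Definition _ := GRing.ComNzRing_hasMulInverse.Build powser
  ps_mulV ps_unitP ps_inv_out.

(* There are no zero divisors: send x_i to the i-th prime and compare the
   coefficients at the nonzero monomials of smallest image. *)
Section Integral.

Fixpoint nth_prime (i : nat) : nat :=
  if i is j.+1 then s2val (prime_above (nth_prime j)) else 2.

Let code (m : monomial) : nat := (\prod_(i <- m) nth_prime i)%N.

Fact nth_prime_prime i : prime (nth_prime i).
Proof. by case: i => //= i; case: prime_above. Qed.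

Fact nth_prime_inj : injective nth_prime.
Proof.
have mono_p : {homo nth_prime : i j / (i < j)%N}.
  by apply: homo_ltn => [|i /=]; [exact: ltn_trans | case: prime_above].
by apply: incn_inj; apply: leq_mono.
Qed.

Fact code_gt0 m : (0 < code m)%N.
Proof. by apply: prodn_gt0 => i; apply/prime_gt0/nth_prime_prime. Qed.

Fact logn_code m i : logn (nth_prime i) (code m) = m i.
Proof.
rewrite -[m i]count_mem_mset /code; elim: (enum_mset m) => [|j s IHs].
  by rewrite big_nil logn1.
rewrite big_cons lognM ?IHs /= ?logn_prime ?(inj_eq nth_prime_inj) //.
- by rewrite eq_sym.
- exact: nth_prime_prime.
- exact/prime_gt0/nth_prime_prime.
by apply: prodn_gt0 => l; apply/prime_gt0/nth_prime_prime.
Qed.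

Fact code_inj : injective code.
Proof. by move=> m m' eq_c; apply/msetP => i; rewrite -!logn_code eq_c. Qed.

Fact codeD a b : code (a `+` b)%mset = (code a * code b)%N.
Proof.
rewrite /code -big_cat; apply: perm_big; apply/allP => x _ /=.
by rewrite count_cat !count_mem_mset msetE2.
Qed.

Fact ps_minimal (f : powser) : f != 0 ->
  exists2 a, f a != 0 & forall b, f b != 0 -> (code a <= code b)%N.
Proof.
move=> f_neq0.
have ex_n : exists n, `[< exists2 a, f a != 0 & code a = n >].
  have [a fa] : exists a, f a != 0.
    apply: contrapT => f0; move/eqP: f_neq0; apply; apply: powserP => a /=.
    by apply/eqP; apply: contrapT => /negP fa; apply: f0; exists a.
  by exists (code a); apply/asboolP; exists a.
case: (ex_minnP ex_n) => n /asboolP[a fa <-] min_a; exists a => // b fb.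
by apply: min_a; apply/asboolP; exists b.
Qed.

Fact ps_integral (f g : powser) : f * g = 0 -> (f == 0) || (g == 0).
Proof.
move=> fg0; apply/norP => -[/ps_minimal[a fa min_a] /ps_minimal[b gb min_b]].
have /eqP := congr1 (fun h : powser => h (a `+` b)%mset) fg0; apply/negP => /=.
have a_ab : a \in mdivisors (a `+` b)%mset.
  by rewrite mem_mdivisors; apply/msubsetP=> x; rewrite msetE2 leq_addr.
rewrite (bigD1_seq a) ?mdivisors_uniq //= msetDKB big_seq_cond big1 ?addr0.
  by rewrite mulf_neq0.
move=> c /andP[]; rewrite mem_mdivisors => /msubBK eq_ab neq_ca.
apply/eqP; rewrite mulf_eq0; apply: contraTT (neq_ca) => /norP[fc gd].
set d := ((a `+` b) `\` c)%mset in eq_ab gd; rewrite negbK.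
have le_ac := min_a c fc; have le_bd := min_b d gd.
have eq_code : (code c * code d = code a * code b)%N by rewrite -!codeD eq_ab.
rewrite -(inj_eq code_inj) eqn_leq le_ac andbT leqNgt; apply/negP => lt_ac.
suff : (code a * code b < code c * code d)%N by rewrite eq_code ltnn.
apply: leq_trans (_ : code c * code b <= _)%N; last by rewrite leq_mul2l le_bd orbT.
by rewrite ltn_pmul2r ?code_gt0.
Qed.

End Integral.

HB.instance Definition _ :=
  GRing.ComUnitRing_isIntegral.Build powser ps_integral.

Definition ps_const (c : rat) := PowSer (fun m => if m == mset0 then c else 0).
Definition ps_var (i : nat) := PowSer (fun m => (m == msetn 1 i)%:R).

(* Sum of a possibly infinite family of power series, coefficient by
   coefficient; it is meaningful when every monomial occurs in only finitely
   many members of the family, as in both uses below. *)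
Definition ps_sum (T : choiceType) (D : set T) (F : T -> powser) :=
  PowSer (fun m => \sum_(t \in D) F t m).

Definition elementary (i : nat) : powser :=
  ps_sum [set S : {fset nat} | #|` S| = i]
    (fun S => \prod_(c <- S) ps_var c).

(* Computations in Q(e_1, e_2, ...) take place in this field, which contains it
   as the subfield generated by the elementary symmetric functions. *)
Notation psfield := {fraction powser}.
Notation "f %:F" := (@FracField.tofrac powser f) : ring_scope.

Definition simple_graph (V : finType) (G : rel V) :=
  symmetric G /\ irreflexive G.

Definition proper_coloring (V : finType) (G : rel V) : set {ffun V -> nat} :=
  [set kappa | forall u v, G u v -> kappa u != kappa v].

Definition chromatic (V : finType) (G : rel V) : powser :=
  ps_sum (proper_coloring G) (fun kappa => \prod_(v : V) ps_var (kappa v)).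

(* In graphs on 'I_m, the ordinal i stands for the vertex i + 1 of [m]. *)
Definition natural_unit_interval (m : nat) (G : rel 'I_m) :=
  simple_graph G /\
  forall p q r : 'I_m, (p < r < q)%N -> G p q -> G p r /\ G r q.

Definition clique_on (V : finType) (G : rel V) (K : {set V}) :=
  forall u v, u \in K -> v \in K -> u != v -> G u v.

(* The vertices of G merged into the vertex u of the quotient, when vertex
   n + r of [n + k] is identified with vertex r for every r in [k]. *)
Definition merged (n k : nat) (u : 'I_n) : {set 'I_(n + k)} :=
  [set x : 'I_(n + k) | (x == u :> nat) || (x == n + u :> nat)%N].

Definition identify_ends (n k : nat) (G : rel 'I_(n + k)) : rel 'I_n :=
  fun u v => [exists x in merged k u, exists y in merged k v, G x y].

(* The circle is R / Z and its subsets are given as 1-periodic subsets of R;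
   this is the closed arc running from a to b, for a < b < a + 1. *)
Definition circle_arc (R : realType) (a b : R) : set R :=
  [set x | exists z : int, a <= x + z%:~R <= b].

Definition proper_circular_arc (R : realType) (V : finType) (G : rel V) :=
  exists a b : V -> R,
  [/\ forall v, a v < b v < a v + 1,
      forall u v, u != v ->
        ~ (circle_arc (a u) (b u) `<=` circle_arc (a v) (b v))%classic
    & forall u v, u != v ->
        (G u v <->
         (circle_arc (a u) (b u) `&` circle_arc (a v) (b v) !=set0)%classic)].

(* The list of rows, from bottom to top, each read from left to right. *)
Definition tableau := seq (seq int).

Definition is_tableau (T : tableau) : bool :=
  [&& [::] \notin T, sorted geq [seq size s | s <- T],
      all (sorted <%R) T,
      sorted (fun s t => all (fun p => p.1 < p.2) (zip s t)) T
    & uniq (flatten T)].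

Definition subtableau (S T : tableau) : bool :=
  (size S <= size T)%N && all (fun p => prefix p.1 p.2) (zip S T).

Definition column (T : tableau) (x : int) : nat :=
  (index x (nth [::] T (find (fun s => x \in s) T))).+1.

(* The condition defining T_j; the 0-based index r : 'I_k stands for r + 1. *)
Definition is_start (k : nat) (j : 'I_k -> nat) (S : tableau) :=
  [/\ is_tableau S,
      perm_eq [seq size s | s <- S] [seq j r | r <- enum 'I_k]
    & forall r : 'I_k, exists s : seq int,
        [/\ (size s).+1 = j r, all (fun x => x <= 0) s
          & rcons s (r.+1)%:Z \in S]].

Definition Aweight (y : nat) (sigma : seq nat) : rat :=
  if y == 1%N then \prod_(s <- sigma) ((s%:R - 1) / s%:R)
  else if y.-1 \in sigma then
    (y.-1%:R + 1) / y.-1%:R *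
    \prod_(s <- sigma | s != y.-1)
      ((y.-1%:R - s%:R + 1) / (y.-1%:R - s%:R))
  else 0.

Section Weights.
Variables (n k : nat) (G : rel 'I_(n + k)) (T : tableau).

Definition label (v : 'I_(n + k)) : int := (v.+1)%:Z.

Definition smaller_neighbors (v : 'I_(n + k)) : seq 'I_(n + k) :=
  [seq u : 'I_(n + k) <- enum 'I_(n + k) | (u < v)%N && G u v].

Definition vcolumn (v : 'I_(n + k)) : nat := column T (label v).

Definition neighbor_columns (v : 'I_(n + k)) : seq nat :=
  [seq vcolumn u | u <- smaller_neighbors v].

Definition vertex_weight (v : 'I_(n + k)) : psfield :=
  (ps_const (Aweight (vcolumn v) (neighbor_columns v)))%:F *
  ((elementary (vcolumn v))%:F / (elementary (vcolumn v).-1)%:F).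

(* The summand is 0 by convention when the columns of N(v) are not distinct for
   some v. *)
Definition tableau_weight : psfield :=
  if [forall v : 'I_(n + k), (k <= v)%N ==> uniq (neighbor_columns v)]
  then \prod_(v : 'I_(n + k) | (k <= v)%N) vertex_weight v
  else 0.

End Weights.

(* The range of the inner sum; jj is the tuple j and S is T_j. *)
Definition tableaux_over (n k N : nat) (jj : 'I_k -> nat) (S : tableau) :
    set tableau :=
  [set T | [/\ is_tableau T,
               all (fun s => size s <= N)%N T,
               subtableau S T,
               forall x : int,
                 ((x \in flatten T) && (x \notin flatten S)) =
                 (k%:Z < x <= (n + k)%:Z)
             & forall r : 'I_k, vcolumn T (rshift n r) = jj r]].

(* Main.v *)
(* Take finitely many variables x_1, ..., x_M.  A proper colouring of Gamma is a
   closed walk of the transfer matrix which adds one vertex at a time and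
   remembers the colours of the last few vertices; the right-hand side is the
   trace of a similar matrix which remembers their columns.  The two matrices
   are conjugate.  Indeed, on functions of a bijective sequence of M colours the
   operators
     Z_i = sum_(k < i) (i k) - sum_(k != i) x_k / (x_i - x_k) (1 - (i k))
   (Cherednik operators at parameter 0) have joint eigenvectors indexed by the
   bijective sequences of columns, the column of position i being the eigenvalue
   of Z_i.  On these eigenvectors, normalised to have sum 1, adjacent
   transpositions act by the seminormal form, and cyclic rotation multiplies by
   an explicit ratio involving e_(y+1) / e_y.  Summing out the oldest colours
   gives eigenvectors for shorter windows, and the two rules combine into the
   step which adds a vertex v in column y with weight
   A(y | columns of N(v)) e_y / e_(y-1).
   Column sequences of nonzero weight are the same as tableaux, they only use
   columns <= n, and a coefficient of a power series involves finitely many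
   variables only, so the identity for all large M suffices. *)
From HB Require Import structures.
Require Import Defs.
From mathcomp Require Import all_boot all_order all_algebra all_fingroup.
From mathcomp Require Import finmap multiset.
From mathcomp Require Import boolp classical_sets cardinality fsbigop reals.
From mathcomp Require Import ring zify.

Set Implicit Arguments.
Unset Strict Implicit.
Unset Printing Implicit Defensive.

Import Order.TTheory GRing.Theory Num.Theory.
Local Open Scope ring_scope.

(** * Joint eigenvectors *)

(** Normalising to sum 1 is the delicate point. From an eigenfunction F of sum 1 with columns j, the
    combination of its exchange at neighbouring positions a, b with -1 / d times F, where d = j b -
    j a, has the exchanged columns and sum 1 - 1 / d. This is 0 exactly when d = 1, so exchanges do
    not by themselves give what is needed. Rotations supply the rest: the sum of a rotated
    eigenfunction is the first moment of F, that is the sum of [x (kappa ord0) * F kappa]. It can be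
    computed because no position precedes position 0, so Z_0 acts on the marginal of the first
    colour alone, with e_r of the other variables as eigenvectors. The resulting ratio (r + 1)
    e_(r+1) / ((n - r) e_r) is the source of both factors of the theorem: (r + 1) / (n - r) is A
    when all other columns are present, and an exchange identity for A carries it down to shorter
    neighbour lists. At the end, setting variables to 0 is not injective and so does not act on the
    fraction field; denominators are cleared before truncating. *)

Section JointEigenvectors.
Variables (L : fieldType) (T I : finType).
Variable Theta : I -> (T -> L) -> T -> L.
Hypothesis Theta_lin : forall r (w : T -> L) (f : T -> T -> L) a,
  Theta r (fun b => \sum_i w i * f i b) a = \sum_i w i * Theta r (f i) a.
Variables (f : T -> T -> L) (lam : I -> T -> L).
Hypothesis eig_f : forall r i a, Theta r (f i) a = lam r i * f i a.
Hypothesis f_neq0 : forall i, exists a, f i a != 0.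
Hypothesis lam_inj : forall i l, i != l -> exists r, lam r i != lam r l.

(** Applying [Theta r - lam r l0] to a vanishing combination kills the term l0 and rescales the
    others; r is chosen so that the term i survives. *)
Lemma joint_eigenvectors_free (u : T -> L) :
  (forall a, \sum_i u i * f i a = 0) -> forall i, u i = 0.
Proof.
move=> uf0 i.
have [w [wi0 w0 wf0]] : exists w : T -> L,
    [/\ w i != 0, forall l, l \in enum T -> l != i -> w l = 0
      & forall a, \sum_l (w l * u l) * f l a = 0].
  elim: (enum T) => [|l0 s [w [wi0 w0 wf0]]].
    exists (fun=> 1); split=> // [|a]; first exact: oner_neq0.
    by rewrite -[RHS](uf0 a); apply: eq_bigr => l _; rewrite mul1r.
  have [->|l0i] := eqVneq l0 i.
    exists w; split=> // l.
    by rewrite inE => /predU1P[->|/w0//]; rewrite eqxx.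
  move: l0i; rewrite eq_sym => /lam_inj[r r_neq].
  exists (fun l => (lam r l - lam r l0) * w l); split=> [|l|a].
  - by rewrite mulf_neq0 // subr_eq0.
  - by rewrite inE => /predU1P[-> _|/w0 wl0 /wl0 ->]; rewrite ?subrr ?mul0r ?mulr0.
  (* [Theta_lin] is the only access to [Theta], so the zero function is written as a combination
     with zero coefficients. *)
  have E : Theta r (fun b => \sum_l (w l * u l) * f l b) a = 0.
    have -> : (fun b => \sum_l (w l * u l) * f l b)
            = (fun b => \sum_l 0 * f l b).
      by apply: funext => b; rewrite wf0 big1 // => l _; rewrite mul0r.
    by rewrite Theta_lin big1 // => l _; rewrite mul0r.
  rewrite Theta_lin in E.
  transitivity (\sum_l w l * u l * Theta r (f l) a
                - lam r l0 * \sum_l w l * u l * f l a).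
    rewrite mulr_sumr -sumrB; apply: eq_bigr => l _; rewrite eig_f; ring.
  by rewrite E wf0 mulr0 subr0.
have [a fia] := f_neq0 i; have := wf0 a.
rewrite (bigD1 i) //= big1 => [|l li]; last by rewrite w0 ?mem_enum // !mul0r.
move=> /eqP; rewrite addr0 !mulf_eq0 (negPf wi0) (negPf fia) orbF.
by move=> /eqP.
Qed.

(** There are as many eigenvectors as points of [T], so the matrix of their values is square and
    independence makes it invertible. *)
Lemma joint_eigenvectors_span (g : T -> L) :
  exists q, forall a, g a = \sum_i q i * f i a.
Proof.
pose E := \matrix_(i < #|T|, j < #|T|) f (enum_val i) (enum_val j).
have E_unit : E \in unitmx.
  rewrite -row_free_unit; apply: inj_row_free => v vE0.
  apply/rowP => i; rewrite mxE -(enum_valK i).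
  apply: (joint_eigenvectors_free (u := fun l => v 0 (enum_rank l))) => a.
  have /rowP/(_ (enum_rank a)) := vE0; rewrite !mxE => E0; rewrite -[RHS]E0.
  rewrite [LHS](reindex (@enum_val T T)) /=; last exact/onW_bij/enum_val_bij.
  by apply: eq_bigr => l _; rewrite mxE enum_rankK enum_valK.
have [q qE] : exists q, q *m E = \row_j g (enum_val j).
  by exists ((\row_j g (enum_val j)) *m invmx E); rewrite mulmxKV.
exists (fun i => q 0 (enum_rank i)) => a.
have /rowP/(_ (enum_rank a)) := qE; rewrite !mxE enum_rankK => <-.
rewrite [RHS](reindex (@enum_val T T)) /=; last exact/onW_bij/enum_val_bij.
by apply: eq_bigr => l _; rewrite mxE enum_rankK enum_valK.
Qed.

Lemma joint_eigenvector_unique (g : T -> L) i :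
  (forall r a, Theta r g a = lam r i * g a) ->
  exists t, forall a, g a = t * f i a.
Proof.
move=> eig_g; have [q gE] := joint_eigenvectors_span g; exists (q i) => a.
rewrite gE (bigD1 i) //= big1 ?addr0 // => l li.
have [r r_neq] := lam_inj li.
have : q l * (lam r l - lam r i) = 0.
  apply: (joint_eigenvectors_free (u := fun l => q l * (lam r l - lam r i))) => b.
  have := eig_g r b; rewrite (funext gE) Theta_lin mulr_sumr => /eqP.
  rewrite -subr_eq0 -sumrB => /eqP E; rewrite -[RHS]E.
  by apply: eq_bigr => l' _; rewrite eig_f; ring.
by move=> /eqP; rewrite mulf_eq0 subr_eq0 (negPf r_neq) orbF => /eqP ->; rewrite mul0r.
Qed.
End JointEigenvectors.

(** * Elementary symmetric polynomials *)

Section ElementaryPolynomial.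
Variables (L : comNzRingType) (T : finType) (x : T -> L).

(** The coefficient of degree r is e_r of the variables indexed by S; the identities below are read
    off this product and its derivative. *)
Definition elem_poly (S : {set T}) : {poly L} := \prod_(b in S) (1 + x b *: 'X).

Lemma elem_polyD1 (S : {set T}) b :
  b \in S -> elem_poly S = (1 + x b *: 'X) * elem_poly (S :\ b).
Proof. by move=> bS; rewrite /elem_poly (big_setD1 b). Qed.

Lemma elem_poly_coefD1 (S : {set T}) b r : b \in S ->
  (elem_poly S)`_r.+1 = (elem_poly (S :\ b))`_r.+1 + x b * (elem_poly (S :\ b))`_r.
Proof.
by move/elem_polyD1->; rewrite mulrDl mul1r -scalerAl coefD coefZ coefXM.
Qed.

Lemma elem_poly_coef0 (S : {set T}) : (elem_poly S)`_0 = 1.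
Proof.
rewrite -horner_coef0 /elem_poly horner_prod big1 // => b _.
by rewrite hornerD hornerZ hornerX hornerC mulr0 addr0.
Qed.


Lemma elem_poly_deriv (S : {set T}) :
  (elem_poly S)^`() = \sum_(b in S) x b *: elem_poly (S :\ b).
Proof.
move: {2}#|S| (leqnn #|S|) => N; elim: N S => [|N IHN] S leSN.
  move: leSN; rewrite leqn0 cards_eq0 => /eqP ->.
  by rewrite /elem_poly !big_set0 derivC.
case: (set_0Vmem S) => [->|[b bS]].
  by rewrite /elem_poly !big_set0 derivC.
rewrite (elem_polyD1 bS) derivM derivD derivZ derivX derivC add0r alg_polyC.
rewrite IHN; last by rewrite -ltnS (leq_trans _ leSN) // [X in (_ < X)%N](cardsD1 b) bS.
rewrite [RHS](big_setD1 b) //= mul_polyC; congr (_ + _).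
rewrite mulr_sumr; apply: eq_bigr => c /setD1P[cb cS].
rewrite [in RHS](elem_polyD1 (b := b)); last by rewrite !inE eq_sym cb.
by rewrite -scalerAr finset.setDDl finset.setUC -finset.setDDl.
Qed.

Lemma sum_elem_polyM (S : {set T}) r :
  \sum_(b in S) x b * (elem_poly (S :\ b))`_r = r.+1%:R * (elem_poly S)`_r.+1.
Proof.
rewrite mulr_natl -coef_deriv elem_poly_deriv coef_sum.
by apply: eq_bigr => b _; rewrite coefZ.
Qed.

Lemma sum_elem_poly (S : {set T}) r :
  \sum_(b in S) (elem_poly (S :\ b))`_r = (#|S|%:R - r%:R) * (elem_poly S)`_r.
Proof.
have E b : b \in S ->
    (elem_poly (S :\ b))`_r = (elem_poly S)`_r - ('X * (x b *: elem_poly (S :\ b)))`_r.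
  move=> bS; rewrite [in RHS](elem_polyD1 bS) mulrDl mul1r coefD -scalerAl.
  by rewrite scalerAr addrK.
rewrite (eq_bigr _ E) sumrB sumr_const -[_ *+ #|S|]mulr_natl mulrBl; congr (_ - _).
rewrite (_ : \sum_(b in S) _ = ('X * (elem_poly S)^`())`_r); last first.
  by rewrite elem_poly_deriv mulr_sumr coef_sum.
rewrite coefXM; case: r {E} => [|r]; first by rewrite mul0r.
by rewrite coef_deriv mulr_natl.
Qed.

Lemma elem_poly_swap (S : {set T}) a b r : a \in S -> b \in S -> a != b ->
  (elem_poly (S :\ a))`_r.+1 - (elem_poly (S :\ b))`_r.+1
  = (x b - x a) * (elem_poly (S :\ a :\ b))`_r.
Proof.
move=> aS bS ab.
rewrite (elem_poly_coefD1 (S := S :\ a) (b := b)) ?(elem_poly_coefD1 (S := S :\ b) (b := a)).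
- by rewrite [S :\ b :\ a]finset.setDDl finset.setUC -finset.setDDl; ring.
- by rewrite !inE ab.
- by rewrite !inE eq_sym ab.
Qed.
End ElementaryPolynomial.

(** * Cherednik operators on colour sequences *)

Section Operators.
Variables (L : fieldType) (m : nat).
Local Notation n := m.+1.
Variable x : 'I_n -> L.
Hypothesis x_inj : injective x.
Implicit Types (F : 'S_n -> L) (kappa j : 'S_n) (i k a b : 'I_n).

(* A colour sequence is a permutation kappa; position i carries kappa i, and
   (tperm i k * kappa) exchanges the colours at positions i and k. *)
Definition cherednik (i : 'I_n) (F : 'S_n -> L) (kappa : 'S_n) : L :=
  \sum_(k | k != i)
    ((k < i)%N%:R * F (tperm i k * kappa)%g
     - x (kappa k) / (x (kappa i) - x (kappa k))
       * (F kappa - F (tperm i k * kappa)%g)).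

Lemma cherednik_lin i (w : 'S_n -> L) (f : 'S_n -> 'S_n -> L) kappa :
  cherednik i (fun kap => \sum_l w l * f l kap) kappa
  = \sum_l w l * cherednik i (f l) kappa.
Proof.
rewrite /cherednik; under [RHS]eq_bigr do rewrite mulr_sumr.
rewrite exchange_big /=; apply: eq_bigr => k _.
rewrite mulr_sumr -sumrB mulr_sumr -sumrB.
by apply: eq_bigr => l _; ring.
Qed.

(** Relabelling positions by s leaves the colour part of the operator unchanged; only the comparison
    of positions feels s. The exchange and rotation rules below are instances. *)
Lemma cherednik_conj (s : 'S_n) i F kappa :
  cherednik ((s^-1)%g i) F (s * kappa)%g
  = \sum_(k | k != i)
    (((s^-1)%g k < (s^-1)%g i)%N%:R * F (s * (tperm i k * kappa))%g
     - x (kappa k) / (x (kappa i) - x (kappa k))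
       * (F (s * kappa)%g - F (s * (tperm i k * kappa))%g)).
Proof.
rewrite /cherednik (reindex_inj (@perm_inj _ (s^-1)%g)) /=.
apply: eq_big => [k|k _]; first by rewrite (inj_eq perm_inj).
rewrite !permM !permKV.
suff -> : (tperm ((s^-1)%g i) ((s^-1)%g k) * (s * kappa)
          = s * (tperm i k * kappa))%g by [].
rewrite !mulgA; congr (_ * _)%g.
by rewrite -tpermJ conjgE invgK !mulgA mulgKV.
Qed.

(** The cross relation of a degenerate affine Hecke algebra: exchanging neighbouring positions
    affects only their mutual order, whence the correction [F kappa]. *)
Lemma cherednik_swap F a b kappa : b = a.+1 :> nat ->
  cherednik a (fun kap => F (tperm a b * kap)%g) kappa
  = cherednik b F (tperm a b * kappa)%g - F kappa.
Proof.
move=> ab; have neq_ab : b != a by rewrite -val_eqE /= ab; lia.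
have := cherednik_conj (tperm a b) a F kappa; rewrite tpermV tpermL => ->.
rewrite /cherednik (bigD1 b) //= [in RHS](bigD1 b) //=.
have ltab : (a < b)%N by rewrite ab.
rewrite !tpermR ltab ltnNge ltnW //= mulgA tperm2 mul1g.
rewrite mul0r mul1r sub0r [RHS]addrAC; congr (_ + _); first by ring.
apply: eq_bigr => k /andP[ka kb]; rewrite tpermD 1?eq_sym //.
suff -> : (k < a)%N = (k < b)%N by [].
by move: ka; rewrite -val_eqE /=; lia.
Qed.

Lemma cherednik_swap' F a b kappa : b = a.+1 :> nat ->
  cherednik b (fun kap => F (tperm a b * kap)%g) kappa
  = cherednik a F (tperm a b * kappa)%g + F kappa.
Proof.
move=> ab.
have := cherednik_swap (fun kap => F (tperm a b * kap)%g) (tperm a b * kappa)%g ab.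
rewrite !mulgA tperm2 mul1g.
have -> : (fun kap => F (tperm a b * (tperm a b * kap))%g) = F.
  by apply: funext => kap; rewrite mulgA tperm2 mul1g.
by move=> ->; rewrite subrK.
Qed.

Lemma cherednik_swap_fix F a b i kappa : b = a.+1 :> nat -> i != a -> i != b ->
  cherednik i (fun kap => F (tperm a b * kap)%g) kappa
  = cherednik i F (tperm a b * kappa)%g.
Proof.
move=> ab ia ib.
have := cherednik_conj (tperm a b) i F kappa; rewrite tpermV tpermD 1?eq_sym // => ->.
rewrite /cherednik; apply: eq_bigr => k ki.
suff -> : (k < i)%N = (tperm a b k < i)%N by [].
move: ia ib; case: tpermP => [->|->|//]; rewrite -!val_eqE /=; lia.
Qed.

(** Acting on colour sequences it brings the last colour to the front: [(rot_perm * kappa) ord0] is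
    [kappa ord_max]. *)
Definition rot_perm : 'S_n := perm (@ord_pred_inj n).

Lemma rot_permV i : (rot_perm^-1)%g i = ordS i.
Proof. by apply: (@perm_inj _ rot_perm); rewrite permKV permE ordSK. Qed.

(** Rotation alters the comparison of positions only for pairs containing [ord_max], and the factor
    [x (kap ord_max)] fails to commute with just those transpositions; the two defects cancel. *)
Lemma cherednik_rot F i kappa :
  cherednik i (fun kap => x (kap ord_max) * F (rot_perm * kap)%g) kappa
  = x (kappa ord_max) * cherednik (ordS i) F (rot_perm * kappa)%g.
Proof.
have := cherednik_conj rot_perm i F kappa; rewrite rot_permV => ->.
rewrite /cherednik mulr_sumr; apply: eq_bigr => k ki; rewrite rot_permV !permM.
have x_neq : x (kappa i) - x (kappa k) != 0.
  by rewrite subr_eq0 (inj_eq x_inj) (inj_eq perm_inj) eq_sym.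
have ltS (l : 'I_n) : l != ord_max -> (l < m)%N /\ ordS l = l.+1 :> nat.
  move=> lm; have lm' : (l < m)%N.
    by have := ltn_ord l; move: lm; rewrite ltnS leq_eqVlt -!val_eqE /= => /negPf ->.
  by rewrite /= modn_small.
have max0 : ordS (ord_max : 'I_n) = 0 :> nat by rewrite /= modnn.
have [i_max|im] := eqVneq i ord_max.
  have [km _] : (k < m)%N /\ ordS k = k.+1 :> nat by apply: ltS; rewrite -i_max.
  move: x_neq; rewrite i_max tpermL max0 ltn0 km => x_neq.
  by rewrite mul1r mul0r; field.
have [im' ->] := ltS i im.
have [k_max|km] := eqVneq k ord_max.
  move: x_neq; rewrite k_max tpermR max0 ltnS leq0n [(_ < i)%N]ltnNge -ltnS ltn_ord.
  by move=> x_neq; rewrite mul1r mul0r; field.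
by have [km' ->] := ltS k km; rewrite tpermD // ltnS; ring.
Qed.
End Operators.

(** * Construction of eigenfunctions with nonzero sum *)

Section Eigen.
Variables (L : fieldType) (m : nat).
Local Notation n := m.+1.
Variable x : 'I_n -> L.
Hypothesis x_inj : injective x.
Hypothesis natL_neq0 : forall r, r.+1%:R != 0 :> L.
Local Notation esy r := ((elem_poly x [set: 'I_n])`_r).
Hypothesis esym_neq0 : forall r, (r <= n)%N -> esy r != 0.
Implicit Types (F : 'S_n -> L) (kappa j : 'S_n) (i k a b : 'I_n).

Lemma natL_inj (r s : nat) : r%:R = s%:R :> L -> r = s.
Proof.
wlog le_sr : r s / (s <= r)%N => [hw|].
  by case/orP: (leq_total s r) => [/hw//|/hw h /esym/h].
move/eqP; rewrite -subr_eq0 -natrB //.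
case E : (r - s)%N => [|d]; last by rewrite (negPf (natL_neq0 d)).
by move=> _; apply/eqP; rewrite eqn_leq le_sr andbT -subn_eq0 E.
Qed.

Definition eigenfunction j F :=
  forall i kappa, cherednik x i F kappa = (j i)%:R * F kappa.

Section FirstMarginal.
Variables (j : 'S_n) (F : 'S_n -> L).
Hypothesis eig_F : eigenfunction j F.

Let p a := \sum_(kappa : 'S_n | kappa ord0 == a) F kappa.

(** The [unit] argument turns one operator into a family, as the lemmas on joint eigenvectors
    expect. *)
Let colour_op (_ : unit) (q : 'I_n -> L) a :=
  \sum_(b | b != a) x b / (x b - x a) * (q a - q b).

(** No position precedes [ord0], so the order terms vanish, and exchanging the colours at positions
    0 and k amounts to exchanging the values a and b = kappa k. *)
Lemma first_marginal_eigen a : colour_op tt p a = (j ord0)%:R * p a.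
Proof.
rewrite /p mulr_sumr.
transitivity (\sum_(kappa : 'S_n | kappa ord0 == a) \sum_(b | b != a)
    x b / (x b - x a) * (F kappa - F (kappa * tperm a b)%g)).
  rewrite exchange_big; apply: eq_bigr => b ba.
  rewrite -mulr_sumr sumrB; congr (_ * (_ - _)).
  rewrite [LHS](reindex_inj (mulIg (tperm a b))) /=; apply: eq_big => [kappa|//].
  by rewrite permM (can2_eq (tpermK a b) (tpermK a b)) tpermR.
apply: eq_bigr => kappa /eqP kappa0; rewrite -eig_F /cherednik.
rewrite [RHS](reindex_inj (@perm_inj _ (kappa^-1)%g)) /=.
apply: eq_big => [b|b ba].
  by rewrite (can2_eq (permKV kappa) (permK kappa)) kappa0.
  rewrite permKV kappa0 mul0r sub0r -mulNr -mulrN -invrN opprB.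
by rewrite [(tperm _ _ * kappa)%g]conjgC tpermJ permKV kappa0.
Qed.

Let colour_op_lin r (w : 'I_n -> L) (f : 'I_n -> 'I_n -> L) a :
  colour_op r (fun b => \sum_i w i * f i b) a = \sum_i w i * colour_op r (f i) a.
Proof.
rewrite /colour_op; under [RHS]eq_bigr do rewrite mulr_sumr.
rewrite exchange_big /=; apply: eq_bigr => k _.
by rewrite -sumrB mulr_sumr; apply: eq_bigr => l _; ring.
Qed.

(** By [elem_poly_swap] the functions sending a to e_r of the variables other than x_a, for r < n,
    are eigenvectors of [colour_op] with distinct eigenvalues r. *)
Lemma first_marginal : exists t, forall a, p a = t * (elem_poly x ([set: 'I_n] :\ a))`_(j ord0).
Proof.
have := @joint_eigenvector_unique L 'I_n unit colour_op colour_op_lin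
  (fun i a => (elem_poly x ([set: 'I_n] :\ a))`_i) (fun _ i => i%:R).
move/(_ _ _ _ p (j ord0)) => H; apply: H.
- move=> u [r rn] a; rewrite /colour_op /=.
  case: r rn => [|r] rn.
    by rewrite mul0r big1 // => b _; rewrite !elem_poly_coef0 subrr mulr0.
  rewrite -sum_elem_polyM; apply: eq_big => [b|b ba]; first by rewrite !inE andbT.
  rewrite elem_poly_swap ?inE // 1?eq_sym // mulrA divfK //.
  by rewrite subr_eq0 (inj_eq x_inj).
(* The values of this eigenvector add up to (n - i) e_i, which is nonzero because i < n. *)
- move=> i; apply: contrapT => none.
  have : \sum_a (elem_poly x ([set: 'I_n] :\ a))`_i = 0.
    by apply: big1 => a _; apply/eqP; apply: contrapT => /negP ?; apply: none; exists a.
  have := sum_elem_poly x [set: 'I_n] i; rewrite (eq_bigl _ _ (fun a => finset.in_setT a)) => ->.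
  move/eqP; rewrite mulf_eq0 (negPf (esym_neq0 _)) ?orbF; last exact/ltnW/ltn_ord.
  rewrite cardsT card_ord -natrB; last exact/ltnW/ltn_ord.
  have := ltn_ord i; rewrite -subn_gt0; case: (n - i)%N => // d _.
  by rewrite (negPf (natL_neq0 d)).
- move=> i l il; exists tt; apply: contra il => /eqP/natL_inj/val_inj ->.
  exact: eqxx.
- by move=> [] a; rewrite first_marginal_eigen.
Qed.

(** The marginal is known up to a factor t; the total 1 fixes t, and the sum weighted by x_a then
    produces e_(r+1). *)
Lemma first_moment : \sum_kappa F kappa = 1 ->
  (n%:R - (j ord0)%:R) * esy (j ord0) * \sum_(kappa : 'S_n) x (kappa ord0) * F kappa
  = (j ord0).+1%:R * esy (j ord0).+1.
Proof.
move=> sumF; have [t pE] := first_marginal.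
have sum_p (w : 'I_n -> L) : \sum_(kappa : 'S_n) w (kappa ord0) * F kappa = \sum_a w a * p a.
  rewrite (partition_big (fun kappa : 'S_n => kappa ord0) xpredT) //=.
  apply: eq_bigr => a _; rewrite mulr_sumr.
  by apply: eq_bigr => kappa /eqP ->.
have t1 : (n%:R - (j ord0)%:R) * esy (j ord0) * t = 1.
  rewrite -[RHS]sumF; under [RHS]eq_bigr do rewrite -[F _]mul1r.
  rewrite (sum_p (fun=> 1)); under [RHS]eq_bigr do rewrite mul1r pE.
  rewrite -mulr_sumr [LHS]mulrC; congr (_ * _).
  have := sum_elem_poly x [set: 'I_n] (j ord0); rewrite cardsT card_ord => H.
  apply: etrans (esym H) _.
  by apply: eq_bigl => a; rewrite inE.
rewrite sum_p -sum_elem_polyM; under eq_bigr do rewrite pE mulrCA.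
rewrite -mulr_sumr mulrA t1 mul1r; apply: eq_bigl => a; by rewrite inE.
Qed.
End FirstMarginal.

Definition normalized_eigen j F := eigenfunction j F /\ \sum_kappa F kappa = 1.

Lemma normalize j F : eigenfunction j F -> \sum_kappa F kappa != 0 ->
  exists G, normalized_eigen j G.
Proof.
move=> eigF sum0; exists (fun kappa => (\sum_kappa F kappa)^-1 * F kappa); split.
  move=> i kappa; rewrite mulrCA -eigF /cherednik mulr_sumr.
  by apply: eq_bigr => k _; ring.
by rewrite -mulr_sumr mulVf.
Qed.

(** On a constant function the difference terms vanish and Z_i counts the positions before i. *)
Lemma eigenfunction1 : exists F, normalized_eigen 1%g F.
Proof.
apply: (normalize (F := fun=> 1)).
  move=> i kappa; rewrite perm1 mulr1 /cherednik.
  transitivity (\sum_(k < n | k != i) (k < i)%N%:R : L).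
    by apply: eq_bigr => k _; rewrite subrr mulr0 subr0 mulr1.
  rewrite -natr_sum; congr _%:R.
  rewrite (bigID (fun k : 'I_n => k < i)%N) /= [X in (_ + X)%N]big1 ?addn0; last first.
    by move=> k /andP[_ /negPf ->].
  rewrite (eq_bigr (fun=> 1%N)); last by move=> k /andP[_ ->].
  rewrite (eq_bigl (fun k : 'I_n => k < i)%N); last first.
    by move=> k; case: ltngtP => // [lt|gt|e]; rewrite ?andbF ?andbT // -val_eqE /=; lia.
  rewrite (big_ord_narrow (ltnW (ltn_ord i))) /= sum_nat_const.
  by rewrite card_ord muln1.
(* The sum is n!, which is nonzero in L. *)
rewrite sumr_const; case E : #|_| => [|d]; last exact: natL_neq0.
by have := fact_gt0 n; rewrite -card_Sn (_ : #|_| = 0%N) // -[RHS]E; apply: eq_card.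
Qed.

Lemma eigenfunction_rot j F : normalized_eigen j F ->
  exists G, normalized_eigen ((rot_perm m)^-1 * j)%g G.
Proof.
move=> [eigF sumF].
apply: (normalize (F := fun kappa => x (kappa ord_max) * F (rot_perm m * kappa)%g)).
  move=> i kappa; rewrite cherednik_rot // eigF permM rot_permV; ring.
rewrite (reindex_inj (mulgI (rot_perm m)^-1%g)) /=.
under eq_bigr do rewrite mulKVg permM rot_permV.
have -> : ordS ord_max = ord0 :> 'I_n by apply: val_inj; rewrite /= modnn.
apply/negP => /eqP sum0; have := first_moment eigF sumF.
rewrite sum0 mulr0 => /esym/eqP; apply/negP.
by rewrite mulf_neq0 ?natL_neq0 ?esym_neq0 ?ltn_ord.
Qed.

Lemma natL_ord_neq j a b : a != b -> (j b)%:R - (j a)%:R != 0 :> L.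
Proof.
apply: contra; rewrite subr_eq0 => /eqP/natL_inj/val_inj/perm_inj ->; exact: eqxx.
Qed.

(** The coefficient 1 / (j b - j a) is forced: it must absorb the correction term of
    [cherednik_swap]. *)
Lemma eigenfunction_swap_lin j F a b : b = a.+1 :> nat -> eigenfunction j F ->
  eigenfunction (tperm a b * j)%g
    (fun kappa => F (tperm a b * kappa)%g - ((j b)%:R - (j a)%:R)^-1 * F kappa).
Proof.
move=> ab eigF i kappa.
have neq_ab : a != b by rewrite -val_eqE /= ab; lia.
have d_neq0 := natL_ord_neq j neq_ab.
have lin (c : L) : cherednik x i (fun kap => F (tperm a b * kap)%g - c * F kap) kappa
   = cherednik x i (fun kap => F (tperm a b * kap)%g) kappa - c * cherednik x i F kappa.
  rewrite /cherednik mulr_sumr -sumrB; apply: eq_bigr => k _; ring.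
rewrite lin permM.
have [->|ia] := eqVneq i a.
  by rewrite cherednik_swap // tpermL !eigF; field.
have [->|ib] := eqVneq i b.
  by rewrite cherednik_swap' // tpermR !eigF; field.
by rewrite cherednik_swap_fix // tpermD 1?eq_sym // !eigF; ring.
Qed.

Lemma sum_swap F a b :
  \sum_kappa F (tperm a b * kappa)%g = \sum_kappa F kappa.
Proof. by rewrite [RHS](reindex_inj (mulgI (tperm a b))). Qed.

Lemma eigenfunction_swap j F a b : b = a.+1 :> nat -> j b != (j a).+1 :> nat ->
  normalized_eigen j F -> exists G, normalized_eigen (tperm a b * j)%g G.
Proof.
move=> ab jab [eigF sumF]; apply: (normalize (eigenfunction_swap_lin ab eigF)).
have neq_ab : a != b by rewrite -val_eqE /= ab; lia.
have d_neq0 := natL_ord_neq j neq_ab.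
rewrite sumrB -mulr_sumr sum_swap sumF mulr1 subr_eq0.
rewrite -(inj_eq invr_inj) invrK invr1 eq_sym subr_eq addrC natr1.
by apply: contra jab => /eqP/natL_inj ->.
Qed.
End Eigen.

(** * Words up to rotation and exchange of non-consecutive letters *)

Section CyclicWords.
Local Open Scope nat_scope.

Section RotationClosed.
Variable Q : seq nat -> Prop.
Hypothesis Q_rot : forall a s, Q (a :: s) -> Q (rcons s a).

Lemma rot_closed u v : Q (u ++ v) -> Q (v ++ u).
Proof.
elim: u v => [|a u IHu] v; first by rewrite cats0.
by move=> /Q_rot; rewrite rcons_cat => /IHu; rewrite cat_rcons.
Qed.

Hypothesis Q_swap : forall a b s, a != b -> a != b.+1 -> b != a.+1 ->
  Q [:: a, b & s] -> Q [:: b, a & s].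

Lemma swap_closed u a b v : a != b -> a != b.+1 -> b != a.+1 ->
  Q (u ++ [:: a, b & v]) -> Q (u ++ [:: b, a & v]).
Proof.
move=> ab ab1 ba1 /rot_closed/(Q_swap ab ab1 ba1) Qba.
by apply: (@rot_closed [:: b, a & v]).
Qed.

Lemma move_right m w u v : all (fun a => a.+1 < m) u ->
  Q (w ++ m :: u ++ v) -> Q (w ++ u ++ m :: v).
Proof.
elim: u w => //= a u IHu w /andP[am u_lt] /swap_closed Qa.
have := IHu (rcons w a) u_lt; rewrite !cat_rcons; apply; apply: Qa; lia.
Qed.
End RotationClosed.

(* The only forbidden exchanges are those of consecutive values, and these form
   a path: the largest value conflicts with one other value only, so it can
   always be moved out of the way, if necessary the other way round. *)
Lemma rot_swap_ind m (Q : seq nat -> Prop) :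
    (forall a s, Q (a :: s) -> Q (rcons s a)) ->
    (forall a b s, a != b -> a != b.+1 -> b != a.+1 ->
       Q [:: a, b & s] -> Q [:: b, a & s]) ->
  Q (iota 0 m) -> forall s, perm_eq s (iota 0 m) -> Q s.
Proof.
elim: m Q => [|m IHm] Q Q_rot Q_swap Q_iota s; first by move/perm_nilP->.
rewrite -addn1 iotaD add0n /= => s_perm.
have m_s : m \in s by rewrite (perm_mem s_perm) mem_cat inE eqxx orbT.
case/splitPr: m_s s_perm => u v; rewrite perm_catC /= perm_sym perm_catC /=.
rewrite perm_cons perm_sym perm_catC => uv_perm.
(* [Q' t] lets the largest letter m be inserted at any place of t, so the induction hypothesis
   applies to words without m. *)
pose Q' t := all (fun a => a < m) t /\ forall u v, t = u ++ v -> Q (u ++ m :: v).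
suff [_] : Q' (u ++ v) by apply.
apply: (IHm) uv_perm => [a t|a b t ab ab1 ba1|].
- move=> [/= /andP[am t_lt] Qt]; split; first by rewrite all_rcons am.
  move=> {}u {}v; case: (lastP v) => [|v' y].
    rewrite cats0 => <-; have /Q_rot := Qt [:: a] t erefl.
    by rewrite rcons_cons => /Q_rot; rewrite -!cats1 -catA.
  rewrite -rcons_cat => /rcons_inj[tE <-].
  by have /Q_rot := Qt (a :: u) v' (congr1 _ tE); rewrite rcons_cat rcons_cons.
- move=> [/= /and3P[am bm t_lt] Qt]; split; first by rewrite /= am bm.
  move=> [|c [|d u']] v' /=.
  + move=> <-; apply: (swap_closed Q_rot Q_swap (u := [:: m])) => //.
    exact: (Qt [::] [:: a, b & t]).
  (* Here m stands between b and a. As a != b, at most one of them is m - 1, so m can be moved past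
     the other one before a and b are exchanged. *)
  + move=> [<- <-]; have [b_m|b_m] := eqVneq b.+1 m.
      apply: (swap_closed Q_rot Q_swap (u := [:: b])); try lia.
      apply: (Q_swap) => //; exact: (Qt [:: a; b] t).
    apply: (Q_swap); try lia.
    apply: (swap_closed Q_rot Q_swap (u := [:: m])) => //.
    exact: (Qt [::] [:: a, b & t]).
  + by move=> [<- <- t_eq]; apply: (Q_swap) => //; apply: (Qt [:: a, b & u']); rewrite t_eq.
split=> [|{}u {}v uvE]; first by apply/allP => a; rewrite mem_iota.
move: Q_iota; rewrite -addn1 iotaD add0n uvE => Q_iota.
case: v uvE Q_iota => [|y v] uvE Q_iota; first by rewrite cats0 in Q_iota.
(* Rotated to the front, m can pass all of u: the letter y still follows u, so the letters of u are
   at most m - 2. *)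
apply: (move_right Q_rot Q_swap (w := [::])) => /=; last exact: (rot_closed Q_rot) Q_iota.
have u_iota : u = iota 0 (size u).
  have /(congr1 (take (size u))) := uvE.
  have : size u + (size v).+1 = m by have /(congr1 size) := uvE; rewrite size_iota size_cat.
  by move=> <-; rewrite iotaD !take_size_cat ?size_iota.
have lt_um : size u < m.
  have /(congr1 size) := uvE; rewrite size_iota size_cat /=; lia.
by apply/allP => a; rewrite u_iota mem_iota; lia.
Qed.

End CyclicWords.

(** * Words as permutations and the basis of normalised eigenvectors *)

Section WordPerm.
Variable m : nat.
Local Notation n := m.+1.
Implicit Types (s t : seq 'I_n) (j : 'S_n).

Definition word_perm s : 'S_n := insubd (1%g : 'S_n) [ffun i : 'I_n => nth ord0 s i].

Lemma word_permE s i : uniq s -> size s = n -> word_perm s i = nth ord0 s i.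
Proof.
move=> s_uniq s_size; rewrite -pvalE val_insubd.
suff -> : injectiveb [ffun i : 'I_n => nth ord0 s i] by rewrite ffunE.
apply/injectiveP => a b; rewrite !ffunE => /eqP.
by rewrite nth_uniq ?s_size // => /eqP/val_inj.
Qed.

Definition perm_word j : seq 'I_n := codom j.

Lemma nth_perm_word j (i : 'I_n) : nth ord0 (perm_word j) i = j i.
Proof.
by rewrite /perm_word /codom /image_mem (nth_map i) ?size_enum_ord // nth_ord_enum.
Qed.

Lemma perm_word_uniq j : uniq (perm_word j).
Proof. by rewrite map_inj_uniq ?enum_uniq //; apply: perm_inj. Qed.

Lemma size_perm_word j : size (perm_word j) = n.
Proof. by rewrite size_codom card_ord. Qed.

Lemma perm_wordK : cancel perm_word word_perm.
Proof.
move=> j; apply/permP => i.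
by rewrite word_permE ?perm_word_uniq ?size_perm_word // nth_perm_word.
Qed.

Lemma word_permK s : uniq s -> size s = n -> perm_word (word_perm s) = s.
Proof.
move=> s_uniq s_size; apply: (@eq_from_nth _ ord0); rewrite size_perm_word //.
move=> i lt_in; have := nth_perm_word (word_perm s) (Ordinal lt_in).
by rewrite /= => ->; rewrite word_permE.
Qed.

Lemma word_perm_rot a s : uniq (a :: s) -> size s = m ->
  word_perm (rcons s a) = ((rot_perm m)^-1 * word_perm (a :: s))%g.
Proof.
move=> as_uniq s_size; apply/permP => i.
have sa_uniq : uniq (rcons s a) by rewrite rcons_uniq.
rewrite permM !word_permE ?size_rcons /= ?s_size // rot_permV nth_rcons s_size.
have := ltn_ord i; rewrite ltnS leq_eqVlt => /orP[/eqP i_m|lt_im].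
  by rewrite /= i_m ltnn eqxx modnn.
by rewrite lt_im /= modn_small.
Qed.

Lemma word_perm_swap s a b t (p q : 'I_n) :
  uniq (s ++ [:: a, b & t]) -> size (s ++ [:: a, b & t]) = n ->
  p = size s :> nat -> q = p.+1 :> nat ->
  word_perm (s ++ [:: b, a & t]) = (tperm p q * word_perm (s ++ [:: a, b & t]))%g.
Proof.
move=> u1 sz ps qp; apply/permP => i.
have u2 : uniq (s ++ [:: b, a & t]).
  rewrite (perm_uniq (s2 := s ++ [:: a, b & t])) // perm_cat2l.
  by rewrite (perm_catCA [:: b] [:: a]) perm_refl.
have sz2 : size (s ++ [:: b, a & t]) = n by move: sz; rewrite !size_cat.
rewrite permM !word_permE //.
have E r : r = p :> nat \/ r = q :> nat \/ r != p :> nat /\ r != q :> nat by lia.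
have sub1 : (q - size s = 1)%N by lia.
have sub0 : (p - size s = 0)%N by lia.
have nq : (q < size s)%N = false by lia.
have np : (p < size s)%N = false by lia.
case: tpermP => [->|->|/eqP ip /eqP iq]; rewrite !nth_cat ?nq ?np ?sub0 ?sub1 //.
case: ltnP => // le_si.
move: ip iq; rewrite -!val_eqE /= => ip iq.
have -> : (i - size s = (i - size s).-2.+2)%N by lia.
by [].
Qed.
End WordPerm.

Section EigenBasis.
Variables (L : fieldType) (m : nat).
Local Notation n := m.+1.
Variable x : 'I_n -> L.
Hypothesis x_inj : injective x.
Hypothesis natL_neq0 : forall r, r.+1%:R != 0 :> L.
Local Notation esy r := ((elem_poly x [set: 'I_n])`_r).
Hypothesis esym_neq0 : forall r, (r <= n)%N -> esy r != 0.

Lemma eigenfunction_exists (j : 'S_n) : exists F, normalized_eigen x j F.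
Proof.
pose Q (s : seq nat) := forall j : 'S_n, map val (perm_word j) = s ->
  exists F, normalized_eigen x j F.
suff /(_ (map val (perm_word j))) : forall s, perm_eq s (iota 0 n) -> Q s.
  apply=> //; apply: uniq_perm; rewrite ?iota_uniq //.
    by rewrite map_inj_uniq ?perm_word_uniq //; apply: val_inj.
  move=> r; rewrite mem_iota /= add0n; apply/mapP/idP => [[i _ ->]|rn]; first exact: ltn_ord.
  exists (Ordinal rn) => //; apply/codomP; exists ((j^-1)%g (Ordinal rn)).
  by rewrite permKV.
have size_word (j0 : 'S_n) s : map val (perm_word j0) = s -> size s = n.
  by move=> <-; rewrite size_map size_perm_word.
apply: rot_swap_ind => [a s Qs j1 j1E|a b s ab ab1 ba1 Qs j1 j1E|j1 j1E].
- have := perm_wordK j1; have := perm_word_uniq j1; have := size_perm_word j1.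
  case: (lastP (perm_word j1)) j1E => [|t a']; first by case: s Qs.
  rewrite map_rcons => /rcons_inj[sE aE]; subst s a.
  rewrite size_rcons rcons_uniq => -[t_size] t_uniq <-.
  rewrite word_perm_rot //; have [|F normF] := Qs (word_perm (a' :: t)).
    by rewrite word_permK /= ?t_size.
  exact: (eigenfunction_rot x_inj natL_neq0 esym_neq0 normF).
- have := perm_wordK j1; have := perm_word_uniq j1; have := size_perm_word j1.
  case: (perm_word j1) j1E => [|b' [|a' t]] //= [b'E a'E tE] t_size t_uniq <-.
  have m_gt0 : (0 < m)%N by move: t_size; lia.
  pose q : 'I_n := Ordinal (m_gt0 : (1 < n)%N).
  have t_uniq' : uniq [:: a', b' & t].
    by move: t_uniq; rewrite /= !inE !negb_or eq_sym => /and3P[/andP[-> ->] -> ->].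
  rewrite (word_perm_swap (s := [::]) (p := ord0) (q := q)) //=.
  have [|F normF] := Qs (word_perm [:: a', b' & t]).
    by rewrite word_permK //= a'E b'E tE.
  apply: (eigenfunction_swap natL_neq0 _ _ normF) => //.
  by rewrite !word_permE //= a'E b'E.
- have -> : j1 = 1%g.
    apply/permP => i; apply: val_inj; rewrite perm1 /=.
    by rewrite -nth_perm_word -(nth_map _ 0%N) ?size_perm_word // j1E nth_iota.
  exact: eigenfunction1.
Qed.

Definition eigenvec (j : 'S_n) : 'S_n -> L := projT1 (cid (eigenfunction_exists j)).

Lemma eigenvecP j : normalized_eigen x j (eigenvec j).
Proof. by rewrite /eigenvec; case: cid. Qed.

Lemma eigenvec_neq0 j : exists kappa, eigenvec j kappa != 0.
Proof.
apply: contrapT => none; have [_ /eqP] := eigenvecP j; apply/negP.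
rewrite big1 1?eq_sym ?oner_neq0 // => kappa _; apply/eqP; apply: contrapT => /negP ?.
by apply: none; exists kappa.
Qed.

Lemma eigenvalue_inj (j j' : 'S_n) : j != j' -> exists i, (j i)%:R != (j' i)%:R :> L.
Proof.
move=> jj'; apply: contrapT => none; move/eqP: jj'; apply; apply/permP => i.
apply: val_inj; apply: (natL_inj natL_neq0); apply/eqP; apply: contrapT => /negP ?.
by apply: none; exists i.
Qed.

Lemma eigenvec_span (g : 'S_n -> L) :
  exists q, forall kappa, g kappa = \sum_j q j * eigenvec j kappa.
Proof.
apply: (joint_eigenvectors_span (cherednik_lin x) (lam := fun i j => (j i)%:R)).
- by move=> i j kappa; have [] := eigenvecP j.
- exact: eigenvec_neq0.
- exact: eigenvalue_inj.
Qed.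

(** The factor is found by summing, since [eigenvec j] has sum 1. The exchange and rotation rules
    below thus only require the sum of one eigenfunction each. *)
Lemma eigenvec_unique j F : eigenfunction x j F ->
  forall kappa, F kappa = (\sum_k F k) * eigenvec j kappa.
Proof.
move=> eigF.
have [|||t Ft] := @joint_eigenvector_unique _ _ _ _ (cherednik_lin x)
    eigenvec (fun i j => (j i)%:R) _ _ _ F j eigF.
- by move=> i k kappa; have [] := eigenvecP k.
- exact: eigenvec_neq0.
- exact: eigenvalue_inj.
move=> kappa; rewrite [in LHS]Ft; congr (_ * _).
under eq_bigr do rewrite Ft; rewrite -mulr_sumr.
by have [_ ->] := eigenvecP j; rewrite mulr1.
Qed.

(** No exception for j b = j a + 1: the eigenfunction of [eigenfunction_swap_lin] then has sum 0 and
    hence vanishes, in accordance with the coefficient 0. *)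
Lemma eigenvec_swap (j : 'S_n) (a b : 'I_n) kappa : b = a.+1 :> nat ->
  eigenvec j (tperm a b * kappa)%g
  = ((j b)%:R - (j a)%:R)^-1 * eigenvec j kappa
    + (1 - ((j b)%:R - (j a)%:R)^-1) * eigenvec (tperm a b * j)%g kappa.
Proof.
move=> ab; have [eig_j sum_j] := eigenvecP j.
have := eigenvec_unique (eigenfunction_swap_lin natL_neq0 ab eig_j) kappa.
rewrite sumrB sum_swap sum_j -mulr_sumr sum_j mulr1 => <-; ring.
Qed.

Lemma eigenvec_rot (j kappa : 'S_n) :
  x (kappa ord_max) * eigenvec j (rot_perm m * kappa)%g
  = (j ord0).+1%:R * esy (j ord0).+1 / ((n%:R - (j ord0)%:R) * esy (j ord0))
    * eigenvec ((rot_perm m)^-1 * j)%g kappa.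
Proof.
have [eig_j sum_j] := eigenvecP j.
pose G (kap : 'S_n) := x (kap ord_max) * eigenvec j (rot_perm m * kap)%g.
have eigG : eigenfunction x ((rot_perm m)^-1 * j)%g G.
  by move=> i kap; rewrite cherednik_rot // eig_j permM rot_permV /G; ring.
have := eigenvec_unique eigG kappa; rewrite {1}/G => ->; congr (_ * _).
rewrite -(first_moment x_inj natL_neq0 esym_neq0 eig_j sum_j).
rewrite mulrC mulKf; last first.
  apply: mulf_neq0; last by apply: esym_neq0; apply: ltnW.
  have lt_jn := ltn_ord (j ord0); rewrite -natrB; last exact: ltnW.
  by move: lt_jn; rewrite -subn_gt0; case: (n - j ord0)%N.
rewrite /G (reindex_inj (mulgI (rot_perm m)^-1%g)) /=.
apply: eq_bigr => kap _; rewrite mulKVg permM rot_permV.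
by congr (x (kap _) * _); apply: val_inj; rewrite /= modnn.
Qed.
End EigenBasis.

(** * The transition rule for windows *)

Section ColumnWeight.
Variable L : fieldType.
Hypothesis natL_neq0 : forall r, r.+1%:R != 0 :> L.
Implicit Types (y i s : nat) (sigma : seq nat).

(* Columns are 0-based here: y and s stand for the columns y + 1 and s + 1.  The
   weight A is the residue at z = y of (z + 1) / z * prod_s (z - s) / (z - s - 1),
   in which the factor with the pole contributes 1. *)
Definition col_ratio y s : L :=
  if y == s.+1 then 1 else (y%:R - s%:R) / (y%:R - s.+1%:R).

Definition col_weight y sigma : L :=
  if (y == 0%N) || (y.-1 \in sigma)
  then y.+1%:R / (maxn y 1)%:R * \prod_(s <- sigma) col_ratio y s else 0.

Lemma natL_sub_neq0 i s : i != s -> i%:R - s%:R != 0 :> L.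
Proof. by apply: contra; rewrite subr_eq0 => /eqP/(natL_inj natL_neq0)->. Qed.

Lemma col_weight_mem y sigma : y \in sigma -> col_weight y sigma = 0.
Proof.
move=> y_sigma; rewrite /col_weight; case: ifP => // _.
rewrite (perm_big _ (perm_to_rem y_sigma)) big_cons {1}/col_ratio.
by rewrite ltn_eqF // subrr /= !mul0r mulr0.
Qed.

Lemma perm_col_weight y sigma tau : perm_eq sigma tau ->
  col_weight y sigma = col_weight y tau.
Proof. by move=> p; rewrite /col_weight (perm_mem p) (perm_big _ p). Qed.

(** With r, r' the ratios of i, i' and t = 1 / d, this is a common factor times 1 - r = t r (1 - r')
    + (1 - t) r' (1 - r), a partial fraction identity in y; at y = i + 1 and y = i' + 1 its residue
    is meant. It makes the induction in [window_rot] close. *)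
Lemma col_weight_exchange y i i' sigma :
  i != i' -> i \notin sigma -> i' \notin sigma ->
  let d := i%:R - i'%:R : L in
  col_weight y sigma - col_weight y (i :: sigma)
  = d^-1 * (col_weight y (i :: sigma) - col_weight y [:: i', i & sigma])
    + (1 - d^-1) * (col_weight y (i' :: sigma) - col_weight y [:: i, i' & sigma]).
Proof.
move=> ii' i_sigma i'_sigma d; have d_neq0 : d != 0 by apply: natL_sub_neq0.
rewrite /col_weight !big_cons !inE.
set act := (y == 0%N); set C := y.+1%:R / _; set pr := \prod_(_ <- _) _.
have eqS k : k \notin sigma -> y = k.+1 -> act || (y.-1 \in sigma) = false.
  by rewrite /act => /negPf kN ->; rewrite /= kN.
have pred_eq k : ~~ act -> (y.-1 == k) = (y == k.+1).
  by rewrite /act; case: (y) => // y' _; rewrite /= eqSS.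
(* Here all the weights are given by the product formula, and neither i nor i' brings a pole. *)
case E : (act || (y.-1 \in sigma)).
  have -> : [|| act, y.-1 == i | y.-1 \in sigma] by case/orP: E => ->; rewrite ?orbT ?orbT ?orbT.
  have -> : [|| act, y.-1 == i' | y.-1 \in sigma] by case/orP: E => ->; rewrite ?orbT ?orbT ?orbT.
  have -> : [|| act, y.-1 == i', y.-1 == i | y.-1 \in sigma].
    by case/orP: E => ->; rewrite ?orbT ?orbT ?orbT.
  have -> : [|| act, y.-1 == i, y.-1 == i' | y.-1 \in sigma].
    by case/orP: E => ->; rewrite ?orbT ?orbT ?orbT.
  have yi : y != i.+1 by apply/eqP => /(eqS _ i_sigma); rewrite E.
  have yi' : y != i'.+1 by apply/eqP => /(eqS _ i'_sigma); rewrite E.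
  rewrite /col_ratio (negPf yi) (negPf yi').
  have := natL_sub_neq0 yi; have := natL_sub_neq0 yi'; rewrite -!natr1 /d in d_neq0 *.
  by move=> h1 h2; field; rewrite h1 h2.
(* Here only a pole contributed by i or i' can make a weight nonzero. *)
have /norP[Nact /negPf Nsigma] : ~~ (act || (y.-1 \in sigma)) by rewrite E.
rewrite !pred_eq // (negPf Nact) Nsigma /=.
rewrite !orbF /col_ratio.
have sub1D (a b : L) : a + 1 - (b + 1) = a - b by ring.
have [yi|yi] := eqVneq y i.+1.
  have yi' : (y == i'.+1) = false by rewrite yi eqSS (negPf ii').
  rewrite yi' /= yi /d -!natr1 in d_neq0 *; field.
  by rewrite sub1D.
have [yi'|yi'] := eqVneq y i'.+1; last by rewrite /=; ring.
have d'_neq0 : i'%:R - i%:R != 0 :> L by apply: natL_sub_neq0; rewrite eq_sym.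
rewrite /= yi' /d -!natr1 in d_neq0 *; field.
by rewrite sub1D d'_neq0.
Qed.

Lemma prod_col_ratio_lt y t : (t <= y)%N ->
  \prod_(i < t) col_ratio y (y - i.+1) = (maxn t 1)%:R.
Proof.
elim: t => [|t IHt] ty; first by rewrite big_ord0.
rewrite big_ord_recr /= IHt ?(ltnW ty) // /col_ratio subnSK //.
case: t {IHt} ty => [|t] ty; first by rewrite subn0 eqxx mulr1.
have -> : (y == y - t.+1)%N = false by apply/negbTE; rewrite neq_ltn; lia.
have E r : (r <= y)%N -> y%:R - (y - r)%:R = r%:R :> L by move=> ?; rewrite natrB //; ring.
by rewrite !E ?(ltnW ty) // !(maxn_idPl _) // mulrC divfK ?natL_neq0.
Qed.

Lemma prod_col_ratio_gt y t :
  \prod_(i < t) col_ratio y (y.+1 + i) = t.+1%:R^-1.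
Proof.
elim: t => [|t IHt]; first by rewrite big_ord0 invr1.
rewrite big_ord_recr /= IHt /col_ratio.
have -> : (y == (y.+1 + t).+1)%N = false by apply/negbTE; rewrite neq_ltn; lia.
have E r : y%:R - (y.+1 + r)%:R = - r.+1%:R :> L by rewrite addSnnS natrD; ring.
by rewrite -addnS !E invrN mulrNN mulKf ?natL_neq0.
Qed.

(** The ratios telescope: columns below y give max(y, 1) and columns above y give 1 / (n - y). The
    result is the rational constant of [eigenvec_rot]. *)
Lemma col_weight_full (n y : nat) sigma : perm_eq (y :: sigma) (iota 0 n) ->
  col_weight y sigma = y.+1%:R / (n%:R - y%:R).
Proof.
move=> p; have lt_yn : (y < n)%N by have := perm_mem p y; rewrite inE eqxx mem_iota.
have act : (y == 0%N) || (y.-1 \in sigma).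
  case: y p lt_yn => // y p lt_yn; rewrite -[_ || _]/(y \in sigma).
  have := perm_mem p y; rewrite inE mem_iota /= add0n (ltnW lt_yn).
  by rewrite ltn_eqF.
have sigma_perm : perm_eq sigma ([seq (y - i.+1)%N | i <- iota 0 y]
    ++ [seq (y.+1 + i)%N | i <- iota 0 (n - y.+1)]).
  have : uniq (y :: sigma) by rewrite (perm_uniq p) iota_uniq.
  move=> /andP[y_sigma sigma_uniq]; apply: uniq_perm => //.
    rewrite cat_uniq !map_inj_in_uniq ?iota_uniq /= ?andbT.
    - apply/hasPn => s /mapP[i _ ->]; apply/mapP => -[i']; rewrite mem_iota; lia.
    - by move=> i i' _ _; lia.
    - by move=> i i'; rewrite !mem_iota; lia.
  move=> s; have := perm_mem p s; rewrite inE mem_iota mem_cat /= add0n.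
  have [->|sy] := eqVneq s y => /= [_|->].
    rewrite (negPf y_sigma); apply/esym/negbTE; rewrite negb_or.
    by apply/andP; split; apply/mapP => -[i]; rewrite mem_iota; lia.
  apply/idP/orP => [sn|[]/mapP[i]]; rewrite ?mem_iota; try lia.
  have [lt_sy|le_ys] := ltnP s y.
    by left; apply/mapP; exists (y - s.+1)%N; rewrite ?mem_iota; lia.
  by right; apply/mapP; exists (s - y.+1)%N; rewrite ?mem_iota; lia.
rewrite /col_weight act (perm_big _ sigma_perm) big_cat !big_map /=.
rewrite -(val_enum_ord y) -(val_enum_ord (n - y.+1)) !big_map.
rewrite prod_col_ratio_lt // prod_col_ratio_gt -subSn // subSS natrB 1?ltnW //.
by rewrite mulrA divfK //; case: (y) => [|y']; rewrite ?maxnE ?natL_neq0 ?oner_neq0.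
Qed.
End ColumnWeight.

Section Windows.
Variables (L : fieldType) (m : nat).
Local Notation n := m.+1.
Variable x : 'I_n -> L.
Hypothesis x_inj : injective x.
Hypothesis natL_neq0 : forall r, r.+1%:R != 0 :> L.
Local Notation esy r := ((elem_poly x [set: 'I_n])`_r).
Hypothesis esym_neq0 : forall r, (r <= n)%N -> esy r != 0.
Implicit Types (js ks us vs : seq 'I_n) (i y a b c e : 'I_n).

Definition missing js : 'I_n := odflt ord0 [pick i | i \notin js].

Lemma uniq_ord_size js : uniq js -> (size js <= n)%N.
Proof. by move/card_uniqP => <-; rewrite -[X in (_ <= X)%N]card_ord max_card. Qed.

Lemma missingP js : (size js < n)%N -> missing js \notin js.
Proof.
move=> lt_js; rewrite /missing; case: pickP => //= none; move: lt_js.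
have : (#|'I_n| <= size js)%N.
  apply: leq_trans (card_size js); apply/subset_leq_card/fintype.subsetP => i _.
  by have /negbFE := none i.
by rewrite card_ord leqNgt => /negPf ->.
Qed.

Lemma eq_missing js js' : js =i js' -> missing js = missing js'.
Proof. by move=> E; rewrite /missing; congr odflt; apply: eq_pick => i; rewrite E. Qed.

(* The eigenvector with the d oldest colours summed out; by [window_forget] the
   choice of the forgotten columns does not matter. *)
Fixpoint window (d : nat) js ks : L :=
  if d is d'.+1 then \sum_(c | c \notin ks) window d' (missing js :: js) (c :: ks)
  else eigenvec x_inj natL_neq0 esym_neq0 (word_perm js) (word_perm ks).

Lemma window0 js ks :
  window 0 js ks = eigenvec x_inj natL_neq0 esym_neq0 (word_perm js) (word_perm ks).
Proof. by []. Qed.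

Lemma windowS d js ks :
  window d.+1 js ks = \sum_(c | c \notin ks) window d (missing js :: js) (c :: ks).
Proof. by []. Qed.

Arguments window : simpl never.

Let mem_swap us a b js : us ++ [:: a, b & js] =i us ++ [:: b, a & js].
Proof. by move=> i; rewrite !mem_cat !inE [(i == a) || _]orbCA. Qed.

(** The seminormal rule survives summing out: forgotten letters stand in front of the exchanged
    ones, and both column words miss the same column. *)
Lemma window_swap d us a b js vs c e ks :
    uniq (us ++ [:: a, b & js]) -> uniq (vs ++ [:: c, e & ks]) ->
    size us = size vs -> size js = size ks -> (size us + (size js + d).+2 = n)%N ->
  window d (us ++ [:: a, b & js]) (vs ++ [:: e, c & ks])
  = (b%:R - a%:R)^-1 * window d (us ++ [:: a, b & js]) (vs ++ [:: c, e & ks])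
    + (1 - (b%:R - a%:R)^-1) * window d (us ++ [:: b, a & js]) (vs ++ [:: c, e & ks]).
Proof.
elim: d us vs => [|d IHd] us vs u_js u_ks sz_us sz_js szn.
  have lt_p : (size us < n)%N by lia.
  have lt_q : ((size us).+1 < n)%N by lia.
  pose p := Ordinal lt_p; pose q := Ordinal lt_q.
  have sz1 : size (us ++ [:: a, b & js]) = n by rewrite size_cat /=; lia.
  have sz2 : size (vs ++ [:: c, e & ks]) = n by rewrite size_cat /=; lia.
  rewrite !window0 (word_perm_swap (p := p) (q := q) u_ks sz2) //.
  rewrite eigenvec_swap // -(word_perm_swap (p := p) (q := q) u_js sz1) //.
  rewrite !word_permE // !nth_cat /= ltnn subnn ltnNge leqnSn /=.
  by rewrite subSn // subnn.
rewrite !windowS; under eq_bigl do rewrite mem_swap.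
rewrite !mulr_sumr -big_split; apply: eq_bigr => z zks /=.
rewrite -(eq_missing (mem_swap us a b js)).
apply: (IHd (missing _ :: us) (z :: vs)); rewrite /= ?u_js ?u_ks ?zks ?sz_us //.
  by rewrite missingP // size_cat /=; clear -szn; lia.
by clear -szn sz_us; lia.
Qed.

Lemma sum_pair_swap ks (f : 'I_n -> 'I_n -> L) :
  \sum_(c | c \notin ks) \sum_(e | e \notin c :: ks) f c e
  = \sum_(c | c \notin ks) \sum_(e | e \notin c :: ks) f e c.
Proof.
rewrite (exchange_big_dep (fun e => e \notin ks)) /=; last first.
  by move=> c e _; rewrite inE negb_or => /andP[].
apply: eq_bigr => e e_ks; apply: eq_bigl => c.
by rewrite !inE !negb_or e_ks eq_sym andbT andbC.
Qed.

(** Two forgotten colours are summed symmetrically, so the exchange rule relates the sums A and B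
    for the two orders of their columns: (1 - t)(A - B) = 0 and (1 + t)(A - B) = 0. Adding gives 2
    (A - B) = 0, whatever t is. *)
Lemma window_forget d i js ks : uniq (i :: js) -> uniq ks ->
    size js = size ks -> (size js + d.+1 = n)%N ->
  window d.+1 js ks = \sum_(c | c \notin ks) window d (i :: js) (c :: ks).
Proof.
elim: d i js ks => [|d IHd] i js ks /andP[i_js u_js] u_ks sz szn.
  suff <- : missing js = i by [].
  apply/eqP; apply: contraT => neq.
  have /uniq_ord_size : uniq [:: missing js, i & js].
    by rewrite /= inE negb_or neq missingP ?i_js //; clear -szn; lia.
  by rewrite /=; clear -szn; lia.
rewrite [LHS]windowS; have [<-//|neq] := eqVneq (missing js) i.
have miss_js : missing js \notin js by apply: missingP; clear -szn; lia.
move: (missing js) miss_js neq => i' i'_js neq.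
pose G a b := \sum_(c | c \notin ks) \sum_(e | e \notin c :: ks)
                window d [:: b, a & js] [:: e, c & ks].
have G_swap a b : a \notin js -> b \notin js -> a != b ->
    G a b = (a%:R - b%:R)^-1 * G a b + (1 - (a%:R - b%:R)^-1) * G b a.
  move=> a_js b_js ab.
  rewrite {2}/G [in X in _ = X + _]sum_pair_swap {2}/G [in X in _ = _ + X]sum_pair_swap.
  rewrite !mulr_sumr -big_split /=; apply: eq_bigr => c c_ks.
  rewrite !mulr_sumr -big_split /=; apply: eq_bigr => e e_cks.
  apply: (window_swap (us := [::]) (vs := [::])) => //=.
  - by rewrite inE negb_or eq_sym ab b_js a_js.
  - by move: e_cks; rewrite !inE !negb_or eq_sym => /andP[-> ->]; rewrite c_ks.
  - by clear -szn; lia.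
have G_sym : G i' i = G i i'.
  have E1 := G_swap _ _ i'_js i_js neq.
  have E2 := G_swap _ _ i_js i'_js; rewrite eq_sym in E2; move/(_ neq) in E2.
  move: E1 E2; rewrite -[i%:R - i'%:R]opprB invrN.
  move: (G i' i) (G i i') (_^-1) => A B t E1 E2.
  have : 2%:R * (A - B) = 0.
    transitivity ((A - (t * A + (1 - t) * B)) - (B - (- t * B + (1 - - t) * A))).
      by ring.
    by rewrite -E1 -E2 !subrr.
  by move/eqP; rewrite mulf_eq0 (negPf (natL_neq0 1)) /= subr_eq0 => /eqP.
transitivity (G i' i).
  apply: eq_bigr => c c_ks; apply: (IHd i (i' :: js) (c :: ks)) => /=.
  - by rewrite inE negb_or eq_sym neq i_js i'_js.
  - by rewrite c_ks.
  - by rewrite sz.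
  - by clear -szn; lia.
rewrite G_sym; apply: eq_bigr => c c_ks.
apply/esym; apply: (IHd i' (i :: js) (c :: ks)) => /=.
- by rewrite inE negb_or neq i_js i'_js.
- by rewrite c_ks.
- by rewrite sz.
- by clear -szn; lia.
Qed.

Definition colw (y : 'I_n) js : L := col_weight L y (map val js).
Definition growth (y : nat) : L := esy y.+1 / esy y.

Lemma window_rot0 i js c ks : uniq (i :: js) -> uniq (c :: ks) ->
    size js = m -> size ks = m ->
  x c * window 0 (i :: js) (c :: ks)
  = colw i js * growth i * window 0 (rcons js i) (rcons ks c).
Proof.
move=> u_js u_ks sz_js sz_ks; rewrite !window0 !word_perm_rot //.
have := eigenvec_rot x_inj natL_neq0 esym_neq0 (word_perm (i :: js))
  ((rot_perm m)^-1 * word_perm (c :: ks))%g.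
rewrite mulKVg permM rot_permV.
have -> : ordS ord_max = ord0 :> 'I_n by apply: val_inj; rewrite /= modnn.
rewrite !word_permE //= ?sz_js ?sz_ks // => ->; congr (_ * _).
rewrite /colw (col_weight_full natL_neq0 (n := n)); last first.
  apply: uniq_perm; rewrite ?iota_uniq //.
    by rewrite -[_ :: _]/(map val (i :: js)) map_inj_uniq //; apply: val_inj.
  have u_val : uniq (map val (i :: js)) by rewrite map_inj_uniq //; apply: val_inj.
  have sub : {subset map val (i :: js) <= iota 0 n}.
    by move=> r /mapP[l _ ->]; rewrite mem_iota ltn_ord.
  by have [] := uniq_min_size u_val sub; rewrite // size_iota size_map /= sz_js.
rewrite /growth invfM; ring.
Qed.

(** At full length only y = i survives. Otherwise a forgotten column i' is recalled, the colour c is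
    exchanged to the front, both resulting terms are rotated with one forgotten letter less, and the
    extra letter is forgotten again. *)
Lemma window_rot d i js c ks : uniq (i :: js) -> uniq (c :: ks) ->
    size js = size ks -> (size js + d.+1 = n)%N ->
  x c * window d (i :: js) (c :: ks)
  = \sum_(y | y \notin js) (colw y js - colw y (i :: js)) * growth y
                           * window d (rcons js y) (rcons ks c).
Proof.
have colw_mem y s : y \in s -> colw y s = 0.
  by move=> ys; rewrite /colw col_weight_mem //; apply/mapP; exists y.
elim: d i js c ks => [|d IHd] i js c ks u_js u_ks sz szn.
  have sz_js : size js = m by clear -szn; lia.
  rewrite window_rot0 -?sz // (bigD1 i) /=; last by case/andP: u_js.
  rewrite big1 ?addr0 => [|y /andP[y_js yi]].
    by rewrite [colw i (i :: js)]colw_mem ?mem_head // subr0.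
  have /uniq_ord_size : uniq [:: y, i & js] by rewrite /= inE negb_or yi y_js.
  by rewrite /= sz_js ltnn.
have [i_js u_js'] : i \notin js /\ uniq js by apply/andP.
have [c_ks u_ks'] : c \notin ks /\ uniq ks by apply/andP.
pose i' := missing (i :: js).
have i'_js : i' \notin i :: js by apply: missingP => /=; clear -szn; lia.
have u_i' : uniq [:: i', i & js] by rewrite /= i'_js.
have ii' : i != i' by move: i'_js; rewrite inE negb_or eq_sym => /andP[].
rewrite (window_forget (i := i') u_i' u_ks) /=; [|by rewrite sz|by clear -szn; lia].
pose t : L := (i%:R - i'%:R)^-1.
rewrite mulr_sumr.
transitivity (\sum_(e | e \notin c :: ks) (
    t * (x c * window d [:: i', i & js] [:: c, e & ks])
  + (1 - t) * (x c * window d [:: i, i' & js] [:: c, e & ks]))).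
  apply: eq_bigr => e e_ks.
  have u_ce : uniq [:: c, e & ks].
    by move: e_ks; rewrite /= !inE !negb_or u_ks' eq_sym => /andP[-> ->]; rewrite c_ks.
  have szn' : (0 + (size js + d).+2 = n)%N by clear -szn; lia.
  have /= -> := window_swap (us := [::]) (vs := [::]) (a := i') (b := i)
    u_i' u_ce erefl sz szn'.
  rewrite -/t; ring.
have step a b : uniq [:: a, b & js] ->
    \sum_(e | e \notin c :: ks) x c * window d [:: a, b & js] [:: c, e & ks]
  = \sum_(y | y \notin js) (colw y (b :: js) - colw y [:: a, b & js]) * growth y
                           * window d.+1 (rcons js y) (rcons ks c).
  move=> u_ab.
  transitivity (\sum_(e | e \notin c :: ks) \sum_(y | y \notin b :: js)
     (colw y (b :: js) - colw y [:: a, b & js]) * growth y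
      * window d (b :: rcons js y) (e :: rcons ks c)).
    apply: eq_bigr => e e_ks; apply: (IHd a (b :: js) c (e :: ks)) => //=.
    - by move: e_ks; rewrite !inE !negb_or eq_sym => /andP[-> ->]; rewrite c_ks.
    - by rewrite sz.
    - by clear -szn; lia.
  (* The column b can be forgotten again only for y != b; the missing term y = b has both weights
     equal to 0. *)
  rewrite exchange_big [RHS](bigID (fun y => y == b)) /= [X in _ = X + _]big1 ?add0r.
    apply: eq_big => [y|y y_js]; first by rewrite inE negb_or andbC.
    rewrite -mulr_sumr; congr (_ * _).
    rewrite (window_forget (i := b)) ?size_rcons ?sz //; first last.
    - by clear -szn sz; lia.
    - by rewrite rcons_uniq u_ks' c_ks.
    - have /and3P[_ b_js _] := u_ab; move: y_js; rewrite inE negb_or => /andP[yb y_js].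
      by rewrite /= mem_rcons inE negb_or eq_sym yb b_js rcons_uniq y_js.
    by apply: eq_bigl => e; rewrite !inE mem_rcons inE.
  by move=> y /andP[_ /eqP ->]; rewrite !colw_mem ?inE ?eqxx ?orbT // subrr !mul0r.
have u_i : uniq [:: i, i' & js].
  move: i'_js; rewrite inE negb_or => /andP[_ i'_js'].
  by rewrite /= inE negb_or ii' i_js i'_js'.
rewrite big_split /= -[X in X + _]mulr_sumr -[X in _ + X]mulr_sumr !step //.
rewrite !mulr_sumr -big_split /=.
apply: eq_bigr => y y_js /=.
have mem_val l : l \notin js -> nat_of_ord l \notin map val js.
  by apply: contra => /mapP[l' l'_js /val_inj ->].
have i'_js' : i' \notin js by move: i'_js; rewrite inE negb_or => /andP[].
have := col_weight_exchange natL_neq0 y ii' (mem_val _ i_js) (mem_val _ i'_js').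
by rewrite /colw /= => ->; rewrite /t; ring.
Qed.

(** Recall one forgotten column i, with colour e. The term e = c is a rotation and contributes A(y |
    js) - A(y | i, js); the terms with e != c contribute A(y | i, js) by induction, and the total is
    A(y | js). *)
Lemma window_extend d js c ks : uniq js -> uniq (c :: ks) ->
    size js = size ks -> (size js + d.+1 = n)%N ->
  x c * window d.+1 js ks
  = \sum_(y | y \notin js) colw y js * growth y * window d (rcons js y) (rcons ks c).
Proof.
elim: d js c ks => [|d IHd] js c ks u_js u_cks sz szn.
all: have [c_ks u_ks] : c \notin ks /\ uniq ks by apply/andP.
all: pose i := missing js; have i_js : i \notin js by apply: missingP; clear -szn; lia.
all: have u_i : uniq (i :: js) by rewrite /= i_js.
all: have colw_i : colw i (i :: js) = 0.
1,3: by rewrite /colw col_weight_mem //= mem_head.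
all: rewrite (window_forget u_i u_ks sz szn) (bigD1 c) //= mulrDr.
all: rewrite (window_rot u_i u_cks sz) //.
  (* Only one letter is missing: c is the only free colour and i the only free column. *)
  rewrite [X in _ + _ * X]big1 ?mulr0 ?addr0; last first.
    move=> e /andP[e_ks ec].
    have /uniq_ord_size : uniq [:: e, c & ks] by rewrite /= inE negb_or ec e_ks.
    by rewrite /= -sz; clear -szn; lia.
  apply: eq_bigr => y y_js; congr (_ * _ * _).
  suff -> : y = i by rewrite colw_i subr0.
  apply/eqP; apply: contraT => yi.
  have /uniq_ord_size : uniq [:: y, i & js] by rewrite /= inE negb_or yi y_js.
  by rewrite /=; clear -szn; lia.
rewrite (_ : x c * _ = \sum_(y | y \notin js) colw y (i :: js) * growth y
            * window d.+1 (rcons js y) (rcons ks c)).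
  rewrite -big_split; apply: eq_bigr => y _ /=.
  by rewrite -!mulrDl subrK.
transitivity (\sum_(e | e \notin c :: ks) \sum_(y | y \notin i :: js)
     colw y (i :: js) * growth y * window d (i :: rcons js y) (e :: rcons ks c)).
  rewrite mulr_sumr; apply: eq_big => [e|e /andP[e_ks ec]].
    by rewrite inE negb_or andbC.
  apply: IHd => //=.
  - by rewrite inE negb_or eq_sym ec c_ks e_ks.
  - by rewrite sz.
  - by clear -szn; lia.
rewrite exchange_big [RHS](bigID (fun y => y == i)) /= [X in _ = X + _]big1 ?add0r.
  apply: eq_big => [y|y]; first by rewrite inE negb_or andbC.
  rewrite inE negb_or => /andP[yi y_js]; rewrite -mulr_sumr; congr (_ * _).
  rewrite (window_forget (i := i)) ?size_rcons ?sz //; first last.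
  - by clear -szn sz; lia.
  - by rewrite rcons_uniq u_ks c_ks.
  - by rewrite /= mem_rcons inE negb_or eq_sym yi i_js rcons_uniq y_js.
  by apply: eq_bigl => e; rewrite !inE mem_rcons inE.
by move=> y /andP[_ /eqP ->]; rewrite colw_i !mul0r.
Qed.
End Windows.
Arguments window : simpl never.

(** * Kernels indexed by words of columns and words of colours *)

Section TupleSums.
Variables (V : nmodType) (T : finType).

Lemma sum_tuple_cons k (f : seq T -> V) :
  \sum_(t : k.+1.-tuple T) f t = \sum_c \sum_(t : k.-tuple T) f (c :: t).
Proof.
rewrite pair_big (reindex (fun p : T * k.-tuple T => cons_tuple p.1 p.2)) //=.
exists (fun t => (thead t, behead_tuple t)) => [[c t] _|t _] /=.
  by congr (_, _); apply: val_inj.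
by apply: val_inj; case/tupleP: t.
Qed.

Lemma sum_tuple_rcons k (f : seq T -> V) :
  \sum_(t : k.+1.-tuple T) f t = \sum_(t : k.-tuple T) \sum_c f (rcons t c).
Proof.
elim: k f => [|k IHk] f.
  rewrite sum_tuple_cons exchange_big; apply: eq_bigr => t _.
  by rewrite tuple0.
rewrite sum_tuple_cons (sum_tuple_cons _ (fun t => \sum_c f (rcons t c))).
by apply: eq_bigr => c _; apply: (IHk (fun s => f (c :: s))).
Qed.

Lemma sum_tuple0 (f : seq T -> V) : \sum_(t : 0.-tuple T) f t = f [::].
Proof.
rewrite (eq_bigr (fun=> f [::])) => [|t _]; last by rewrite tuple0.
by rewrite sumr_const card_tuple.
Qed.
End TupleSums.

Section Kernel.
Variables (L : fieldType) (m : nat).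
Local Notation n := m.+1.
Variable x : 'I_n -> L.
Hypothesis x_inj : injective x.
Hypothesis natL_neq0 : forall r, r.+1%:R != 0 :> L.
Local Notation esy r := ((elem_poly x [set: 'I_n])`_r).
Hypothesis esym_neq0 : forall r, (r <= n)%N -> esy r != 0.
Implicit Types (js ks : seq 'I_n) (i y c : 'I_n).

(* From here on words list the most recent vertex first. *)
Definition kernel js ks : L :=
  if [&& uniq js, uniq ks & size js == size ks]
  then window x_inj natL_neq0 esym_neq0 (n - size js) (rev js) (rev ks) else 0.

Lemma kernel_uniql js ks : ~~ uniq js -> kernel js ks = 0.
Proof. by rewrite /kernel => /negPf ->. Qed.

Lemma kernel_uniqr js ks : ~~ uniq ks -> kernel js ks = 0.
Proof. by rewrite /kernel => /negPf ->; rewrite andbF. Qed.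

Lemma kernel_forget js ks i : uniq (rcons js i) -> uniq ks -> size js = size ks ->
  kernel js ks = \sum_c kernel (rcons js i) (rcons ks c).
Proof.
move=> u_i u_ks sz; have lt_n := uniq_ord_size u_i; rewrite size_rcons in lt_n.
rewrite (bigID (fun c => c \in ks)) /= big1 ?add0r => [|c c_ks]; last first.
  by rewrite kernel_uniqr // rcons_uniq c_ks.
have u_js : uniq js by move: u_i; rewrite rcons_uniq => /andP[].
have := @window_forget _ _ x x_inj natL_neq0 esym_neq0 (n - size js).-1 i (rev js) (rev ks).
have nE : (n - size js = (n - size js).-1.+1)%N by clear -lt_n; lia.
rewrite -rev_rcons !rev_uniq !size_rev -nE => /(_ u_i u_ks sz) E.
rewrite {1}/kernel u_js u_ks sz eqxx /= -sz E; last by clear -lt_n; lia.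
apply: eq_big => [c|c]; rewrite mem_rev // => c_ks.
by rewrite /kernel u_i rcons_uniq c_ks u_ks !size_rcons sz eqxx !rev_rcons subnS -sz.
Qed.

Lemma kernel_extend js ks c :
  (c \notin ks)%:R * x c * kernel js ks
  = \sum_y colw L y js * growth x y * kernel (y :: js) (c :: ks).
Proof.
have [u_js|N] := boolP (uniq js); last first.
  by rewrite kernel_uniql // mulr0 big1 // => y _; rewrite kernel_uniql ?mulr0 //= negb_and N orbT.
have [u_cks|N] := boolP (uniq (c :: ks)); last first.
  rewrite [RHS]big1 => [|y _]; last by rewrite kernel_uniqr ?mulr0.
  move: N; rewrite negb_and => /orP[/negPf->|N]; first by rewrite !mul0r.
  by rewrite kernel_uniqr ?mulr0.
have [c_ks u_ks] : c \notin ks /\ uniq ks by apply/andP.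
have [sz|N] := eqVneq (size js) (size ks); last first.
  rewrite /kernel (negPf N) !andbF mulr0 big1 // => y _.
  by rewrite /= eqSS (negPf N) !andbF mulr0.
have lt_n := uniq_ord_size u_cks; rewrite /= -sz in lt_n.
rewrite c_ks mul1r (bigID (fun y => y \in js)) /= big1 ?add0r => [|y y_js]; last first.
  by rewrite kernel_uniql ?mulr0 //= y_js.
have := @window_extend _ _ x x_inj natL_neq0 esym_neq0 (n - size js).-1 (rev js) c (rev ks).
have nE : (n - size js = (n - size js).-1.+1)%N by clear -lt_n; lia.
rewrite /= mem_rev !rev_uniq !size_rev -nE => /(_ u_js u_cks sz) E.
rewrite /kernel u_js u_ks sz eqxx /= -sz E; last by clear -lt_n; lia.
apply: eq_big => [y|y]; rewrite mem_rev // => y_js.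
rewrite y_js u_js c_ks u_ks sz eqxx /= !rev_cons subnS -sz; congr (_ * _ * _).
by apply: perm_col_weight; rewrite map_rev perm_rev.
Qed.

(** A left inverse of the kernel. At full length the eigenvectors span; below, the indicator of ks
    at ks' is the sum over c' of the indicator of [rcons ks c] at [rcons ks' c'], and
    [kernel_forget] shortens the kernels. *)
Lemma kernel_span k ks : (k <= n)%N -> uniq ks -> size ks = k ->
  exists q : seq 'I_n -> L, forall ks', size ks' = k ->
    \sum_(js : k.-tuple 'I_n) q js * kernel js ks' = (ks' == ks)%:R.
Proof.
move=> kn; have : (n - k + k = n)%N by rewrite subnK.
move: (n - k)%N => d; elim: d k ks {kn} => [|d IHd] k ks kn u_ks sz_ks.
  rewrite add0n in kn; rewrite kn in sz_ks *.
  have [q qE] := eigenvec_span x_inj natL_neq0 esym_neq0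
    (fun kappa => (kappa == word_perm (rev ks))%:R).
  exists (fun js => q (word_perm (rev js))) => ks' sz_ks'.
  have [u_ks'|N] := boolP (uniq ks'); last first.
    rewrite big1 => [|js _]; last by rewrite kernel_uniqr ?mulr0.
    by case: eqP N => // ->; rewrite u_ks.
  rewrite (bigID (fun js : n.-tuple 'I_n => uniq js)) /= [X in _ + X]big1 ?addr0; last first.
    by move=> js N; rewrite kernel_uniql ?mulr0.
  have sz_rev (j : 'S_n) : size (rev (perm_word j)) == n by rewrite size_rev size_perm_word.
  rewrite (reindex_onto (fun j : 'S_n => Tuple (sz_rev j))
             (fun js : n.-tuple 'I_n => word_perm (rev js))) /=; last first.
    by move=> js u_js; apply: val_inj; rewrite /= word_permK ?revK ?rev_uniq // size_rev size_tuple.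
  transitivity (\sum_j q j * eigenvec x_inj natL_neq0 esym_neq0 j (word_perm (rev ks'))).
    apply: eq_big => [j|j _]; first by rewrite revK perm_wordK eqxx rev_uniq perm_word_uniq.
    rewrite revK perm_wordK /kernel rev_uniq perm_word_uniq u_ks' size_rev.
    by rewrite size_perm_word sz_ks' eqxx /= subnn revK window0 perm_wordK.
  rewrite -qE; congr _%:R; congr nat_of_bool.
  apply/eqP/eqP => [E|-> //]; rewrite -[ks']revK -[ks]revK.
  by rewrite -(word_permK (s := rev ks)) ?rev_uniq ?size_rev // -E word_permK ?rev_uniq ?size_rev.
have lt_kn : (k < n)%N by clear -kn; lia.
pose c := missing ks; have c_ks : c \notin ks by apply: missingP; rewrite sz_ks.
have kn' : (d + k.+1 = n)%N by clear -kn; lia.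
have u_c : uniq (rcons ks c) by rewrite rcons_uniq c_ks.
have [|q qE] := IHd _ _ kn' u_c; first by rewrite size_rcons sz_ks.
exists (fun js => \sum_i q (rcons js i) * (uniq (rcons js i))%:R) => ks' sz_ks'.
transitivity (\sum_c' (rcons ks' c' == rcons ks c)%:R : L); last first.
  rewrite (bigD1 c) //= eqseq_rcons eqxx andbT big1 ?addr0 // => c' c'c.
  by rewrite eqseq_rcons (negPf c'c) andbF.
rewrite (eq_bigr _ (fun c' _ => esym (qE (rcons ks' c') _))).
rewrite exchange_big [RHS](sum_tuple_rcons _ (fun t => \sum_c' q t * kernel t (rcons ks' c'))).
apply: eq_bigr => js _; rewrite mulr_suml; apply: eq_bigr => i _; rewrite -mulr_sumr -mulrA.
congr (_ * _).
have [u_i|N] := boolP (uniq (rcons js i)); last first.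
  by rewrite mul0r big1 // => c' _; rewrite kernel_uniql.
have [u_ks'|N] := boolP (uniq ks'); last first.
  rewrite kernel_uniqr // mulr0 big1 // => c' _.
  by rewrite kernel_uniqr // rcons_uniq negb_and N orbT.
by rewrite mul1r -kernel_forget // size_tuple.
by move=> c' _; rewrite size_rcons sz_ks'.
Qed.
End Kernel.

(** * Transfer matrices and equality of their traces *)

Lemma trace_intertwine (L : fieldType) (T : finType) (P Q B C : T -> T -> L) :
    (forall a c, \sum_b Q a b * P b c = (c == a)%:R) ->
    (forall a c, \sum_b P a b * B b c = \sum_b C a b * P b c) ->
  \sum_a B a a = \sum_a C a a.
Proof.
move=> QP1 PB_CP.
pose M (F : T -> T -> L) := \matrix_(i < #|T|, j < #|T|) F (enum_val i) (enum_val j).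
have reidx (F : T -> L) : \sum_a F a = \sum_(i < #|T|) F (enum_val i).
  by rewrite (reindex (@enum_val T T)) //=; apply/onW_bij/enum_val_bij.
have tr F : \sum_a F a a = \tr (M F).
  by rewrite reidx; apply: eq_bigr => i _; rewrite mxE.
have MQP : M Q *m M P = 1%:M.
  apply/matrixP => i j; rewrite !mxE.
  transitivity (\sum_b Q (enum_val i) b * P b (enum_val j)).
    by rewrite reidx; apply: eq_bigr => b _; rewrite !mxE.
  by rewrite QP1 (inj_eq enum_val_inj) eq_sym.
have MPB : M P *m M B = M C *m M P.
  apply/matrixP => i j; rewrite !mxE.
  have := PB_CP (enum_val i) (enum_val j); rewrite !reidx => E.
  by under eq_bigr do rewrite !mxE; under [RHS]eq_bigr do rewrite !mxE.
rewrite !tr -[M B]mul1mx -MQP -mulmxA MPB mxtrace_mulC -mulmxA.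
by rewrite (mulmx1C MQP) mulmx1.
Qed.

Lemma sum_tuple_cat (V : nmodType) (T : finType) a b c (f : seq T -> V) :
  (a + b = c)%N ->
  \sum_(t : c.-tuple T) f t = \sum_(u : a.-tuple T) \sum_(w : b.-tuple T) f (u ++ w).
Proof.
move=> <-; elim: a f => [|a IHa] f.
  by rewrite (sum_tuple0 (fun u => \sum_(w : b.-tuple T) f (u ++ w))).
rewrite (sum_tuple_cons (a + b) f).
rewrite (sum_tuple_cons _ (fun u => \sum_(w : b.-tuple T) f (u ++ w))).
by apply: eq_bigr => y _; apply: (IHa (fun s => f (y :: s))).
Qed.

Section Transfer.
Variables (L : fieldType) (m : nat).
Local Notation n := m.+1.
Variable x : 'I_n -> L.
Hypothesis x_inj : injective x.
Hypothesis natL_neq0 : forall r, r.+1%:R != 0 :> L.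
Local Notation esy r := ((elem_poly x [set: 'I_n])`_r).
Hypothesis esym_neq0 : forall r, (r <= n)%N -> esy r != 0.
Implicit Types (j js ks : seq 'I_n) (i y c : 'I_n).

Local Notation P := (kernel x_inj natL_neq0 esym_neq0).

Variables (k : nat) (d : nat -> nat).
Hypothesis d_le : forall v, (d v <= v)%N.
Hypothesis d_step : forall v, (d v.+1 <= (d v).+1)%N.
Hypothesis d_start : forall v, (v < k)%N -> d v = v.

(* The smaller neighbours of vertex [v] are the [d v] vertices before it. *)
Definition colour_factor c ks : L :=
  (c \notin take (d (size ks)) ks)%:R * (if (k <= size ks)%N then x c else 1).

(** Vertices before k only have to take distinct columns: their weight is counted at the last k
    vertices, with which they are merged. *)
Definition column_factor y js : L :=
  if (k <= size js)%N then
    (uniq (take (d (size js)) js))%:R * colw L y (take (d (size js)) js) * growth x y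
  else (y \notin js)%:R.

Fixpoint word_weight (phi : 'I_n -> seq 'I_n -> L) (s : seq 'I_n) : L :=
  if s is c :: s' then phi c s' * word_weight phi s' else 1.

Local Notation cw := (word_weight colour_factor).
Local Notation tw := (word_weight column_factor).

(** The newest vertex together with its smaller neighbours. By [column_weight_uniq] a word of
    nonzero weight has distinct columns there, so a kernel on such a window loses nothing. *)
Definition max_window v := if v is v'.+1 then (d v').+1 else 0%N.

Lemma d_max_window v : (d v <= max_window v)%N.
Proof. by case: v => [|v] /=; rewrite ?d_step // d_le. Qed.

Lemma max_window_start v : (v <= k)%N -> max_window v = v.
Proof. by case: v => //= v vk; rewrite d_start. Qed.

Lemma max_window_le v : (max_window v <= v)%N.
Proof. by case: v => //= v; rewrite ltnS. Qed.

Lemma column_weight_start js : (size js <= k)%N -> tw js = (uniq js)%:R.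
Proof.
elim: js => //= y js IHjs sz; rewrite (IHjs (ltnW sz)) /column_factor leqNgt sz /=.
by case: (y \notin js); rewrite ?mul1r ?mul0r.
Qed.

Lemma colour_weight_start ks : (size ks <= k)%N -> cw ks = (uniq ks)%:R.
Proof.
elim: ks => //= y ks IHks sz; rewrite (IHks (ltnW sz)) /colour_factor leqNgt sz /=.
by rewrite (d_start sz) take_size mulr1; case: (y \notin ks); rewrite ?mul1r ?mul0r.
Qed.

Lemma column_weight_uniq js : ~~ uniq (take (max_window (size js)) js) -> tw js = 0.
Proof.
case: js => // y js N; have [sz|sz] := leqP (size (y :: js)) k.
  by rewrite column_weight_start //; move: N; rewrite max_window_start // take_size => /negPf ->.
move: N; rewrite /= /column_factor -ltnS sz negb_and => /orP[|/negPf ->]; last by rewrite !mul0r.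
rewrite negbK => y_js; rewrite /colw col_weight_mem ?mulr0 ?mul0r //.
by apply/mapP; exists y.
Qed.

Lemma kernel_forget_cat f e j ks : uniq j -> size j = (f + e)%N -> size ks = f ->
  \sum_(s : e.-tuple 'I_n) P j (ks ++ s) = P (take f j) ks.
Proof.
move=> u_j; elim: e f ks => [|e IHe] f ks sz_j sz_ks.
  by rewrite (sum_tuple0 (fun s => P j (ks ++ s))) cats0 take_oversize // sz_j addn0.
rewrite (sum_tuple_cons _ (fun s => P j (ks ++ s))).
under eq_bigr => c _ do under eq_bigr => s _ do rewrite -cat_rcons.
under eq_bigr => c _ do rewrite (IHe f.+1) ?size_rcons ?sz_ks ?addSnnS //.
have lt_f : (f < size j)%N by rewrite sz_j; lia.
have [u_ks|N] := boolP (uniq ks); last first.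
  rewrite kernel_uniqr // big1 // => c _.
  by rewrite kernel_uniqr // rcons_uniq negb_and N orbT.
have u_f : uniq (rcons (take f j) (nth ord0 j f)) by rewrite -take_nth // take_uniq.
rewrite (kernel_forget _ _ _ u_f u_ks) ?size_take ?lt_f //.
by apply: eq_bigr => c _; rewrite -take_nth.
Qed.

(** For each t the window length f decreases from its maximum. There, ks without its first letter c
    carries exactly the smaller neighbours of the newest vertex, so that vertex is removed with
    [kernel_extend]; shorter windows follow by summing out one more colour. *)
Lemma transfer t : forall f e j ks, (f + e = t + k)%N -> (f <= max_window (t + k))%N ->
    size j = k -> size ks = f ->
  \sum_(s : e.-tuple 'I_n) P j (drop t (ks ++ s)) * cw (ks ++ s)
  = \sum_(js : t.-tuple 'I_n) tw (js ++ j) * P (take f (js ++ j)) ks.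
Proof.
elim: t => [|t IHt] f e j ks fe f_max sz_j sz_ks.
  rewrite (sum_tuple0 (fun js => tw (js ++ j) * P (take f (js ++ j)) ks)) /=.
  rewrite column_weight_start ?sz_j //.
  have [u_j|N] := boolP (uniq j); last first.
    by rewrite mul0r big1 // => s _; rewrite kernel_uniql ?mul0r.
  rewrite mul1r -(kernel_forget_cat (e := e) u_j) // ?sz_j //.
  apply: eq_bigr => s _; rewrite drop0 colour_weight_start.
    by case: (boolP (uniq _)) => [|N]; rewrite ?mulr1 // kernel_uniqr ?mul0r.
  by rewrite size_cat sz_ks size_tuple fe.
have [r fr] : exists r, (f + r = max_window (t.+1 + k))%N.
  by exists (max_window (t.+1 + k) - f)%N; rewrite subnKC.
elim: r f e ks fe fr {f_max} sz_ks => [|r IHr] f e ks fe fr sz_ks.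
  rewrite addn0 /= in fr; case: ks sz_ks => [|c ks] sz_ks; first by rewrite -sz_ks in fr.
  have szE : size ks = d (t + k) by rewrite -sz_ks in fr; case: fr.
  have step := IHt (d (t + k)) e j ks _ (d_max_window _) sz_j szE.
  transitivity ((c \notin ks)%:R * x c *
     \sum_(s : e.-tuple 'I_n) P j (drop t (ks ++ s)) * cw (ks ++ s)).
    rewrite mulr_sumr; apply: eq_bigr => s _ /=; rewrite /colour_factor.
    have -> : size (ks ++ s) = (t + k)%N.
      by rewrite size_cat size_tuple szE; move: fe; rewrite fr; clear; lia.
    by rewrite leq_addl -szE take_size_cat //; ring.
  rewrite step; last by move: fe; rewrite fr; clear; lia.
  rewrite (sum_tuple_cons _ (fun js => tw (js ++ j) * P (take f (js ++ j)) (c :: ks))).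
  rewrite exchange_big mulr_sumr; apply: eq_bigr => js _ /=.
  rewrite mulrCA kernel_extend mulr_sumr; apply: eq_bigr => y _.
  have sz_js : size (js ++ j) = (t + k)%N by rewrite size_cat size_tuple sz_j.
  rewrite /column_factor sz_js leq_addl fr /=.
  have [u|N] := boolP (uniq (take (d (t + k)) (js ++ j))); first by rewrite mul1r; ring.
  by rewrite kernel_uniql ?mulr0 //= negb_and N orbT.
case: e fe => [|e] fe.
  have := max_window_le (t.+1 + k); rewrite -fr; move: fe; clear; lia.
rewrite (sum_tuple_cons _ (fun s => P j (drop t.+1 (ks ++ s)) * cw (ks ++ s))).
transitivity (\sum_c \sum_(js : t.+1.-tuple 'I_n)
     tw (js ++ j) * P (take f.+1 (js ++ j)) (rcons ks c)).
  apply: eq_bigr => c _; rewrite -(IHr _ e) ?size_rcons ?sz_ks //.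
  - by apply: eq_bigr => s _; rewrite cat_rcons.
  - by move: fe; clear; lia.
  - by move: fr; clear; lia.
rewrite exchange_big; apply: eq_bigr => js _; rewrite -mulr_sumr.
have sz_js : size (js ++ j) = (t.+1 + k)%N by rewrite size_cat size_tuple sz_j.
(* [kernel_forget] needs distinct columns; words violating this have weight 0. *)
have [u|N] := boolP (uniq (take f.+1 (js ++ j))); last first.
  rewrite column_weight_uniq ?mul0r // sz_js; apply: contra N.
  have -> : take f.+1 (js ++ j) = take f.+1 (take (max_window (t.+1 + k)) (js ++ j)).
    by rewrite take_takel // -fr; clear; lia.
  exact: take_uniq.
congr (_ * _).
have [u_ks|N] := boolP (uniq ks); last first.
  rewrite kernel_uniqr // big1 // => c _.
  by rewrite kernel_uniqr // rcons_uniq negb_and N orbT.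
have lt_f : (f < size (js ++ j))%N by rewrite sz_js; move: fe; clear; lia.
move: u; rewrite (take_nth ord0) // => u; rewrite -kernel_forget //.
by rewrite size_take lt_f.
Qed.

Lemma colour_weight_uniq_drop n0 ks : (size ks = n0 + k)%N ->
  ~~ uniq (drop n0 ks) -> cw ks = 0.
Proof.
elim: n0 ks => [|n0 IHn] ks sz.
  by rewrite drop0 => N; rewrite colour_weight_start ?sz // (negPf N).
case: ks sz => //= c ks [sz] N; rewrite IHn ?mulr0 //.
Qed.

Lemma column_weight_uniq_drop n0 js : (size js = n0 + k)%N ->
  ~~ uniq (drop n0 js) -> tw js = 0.
Proof.
elim: n0 js => [|n0 IHn] js sz.
  by rewrite drop0 => N; rewrite column_weight_start ?sz // (negPf N).
case: js sz => //= c js [sz] N; rewrite IHn ?mulr0 //.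
Qed.

(** Both sides are traces of matrices B and C indexed by words of length k, and [transfer] with f =
    k says that the kernel intertwines them. *)
Lemma cyclic_identity n0 : (k <= n)%N -> (k <= max_window (n0 + k))%N ->
  \sum_(ks : (n0 + k).-tuple 'I_n | take k ks == drop n0 ks) cw ks
  = \sum_(js : (n0 + k).-tuple 'I_n | take k js == drop n0 js) tw js.
Proof.
move=> kn k_max.
pose B (ka kb : k.-tuple 'I_n) :=
  \sum_(s : n0.-tuple 'I_n) (drop n0 (kb ++ s) == ka)%:R * cw (kb ++ s).
pose C (ja jb : k.-tuple 'I_n) :=
  \sum_(s : n0.-tuple 'I_n) (take k (s ++ ja) == jb)%:R * tw (s ++ ja).
(* Words with repeated letters give zero rows and columns of the kernel; an identity block on them
   makes P' invertible. *)
pose P' (a b : k.-tuple 'I_n) := P a b + (~~ uniq a && (a == b))%:R.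
have [q qE] : exists q : k.-tuple 'I_n -> k.-tuple 'I_n -> L,
    forall a b : k.-tuple 'I_n, uniq a -> \sum_(j : k.-tuple 'I_n) q a j * P j b = (b == a)%:R.
  have ex (a : k.-tuple 'I_n) : exists q : k.-tuple 'I_n -> L, forall b : k.-tuple 'I_n, uniq a ->
      \sum_(j : k.-tuple 'I_n) q j * P j b = (b == a)%:R.
    have [u_a|N] := boolP (uniq a); last by exists (fun=> 0).
    have [q qE] := kernel_span x_inj natL_neq0 esym_neq0 kn u_a (size_tuple a).
    by exists q => b _; rewrite qE ?size_tuple.
  by exists (fun a => projT1 (cid (ex a))) => a; case: cid.
pose Q' (a b : k.-tuple 'I_n) := if uniq a then (uniq b)%:R * q a b else (a == b)%:R.
have size_ck (s : n0.-tuple 'I_n) (a : k.-tuple 'I_n) : size (s ++ a) = (n0 + k)%N.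
  by rewrite size_cat !size_tuple.
have size_kc (s : n0.-tuple 'I_n) (a : k.-tuple 'I_n) : size (a ++ s) = (n0 + k)%N.
  by rewrite size_cat !size_tuple addnC.
have B0 (a b : k.-tuple 'I_n) : ~~ uniq a -> B a b = 0.
  move=> N; apply: big1 => s _; case: eqP => [E|_]; last by rewrite mul0r.
  by rewrite (colour_weight_uniq_drop (n0 := n0)) ?mulr0 // E.
have C0l (a b : k.-tuple 'I_n) : ~~ uniq a -> C a b = 0.
  move=> N; apply: big1 => s _; rewrite (column_weight_uniq_drop (n0 := n0)) ?mulr0 //.
  by rewrite drop_size_cat ?size_tuple.
have C0r (a b : k.-tuple 'I_n) : ~~ uniq b -> C a b = 0.
  move=> N; apply: big1 => s _; case: eqP => [E|_]; last by rewrite mul0r.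
  rewrite column_weight_uniq ?mulr0 // size_ck; apply: contra N; rewrite -E.
  by rewrite -(take_takel (s ++ a) k_max) => u; apply: take_uniq.
have tr_B : \sum_(ks : (n0 + k).-tuple 'I_n | take k ks == drop n0 ks) cw ks = \sum_a B a a.
  rewrite big_mkcond /= (sum_tuple_cat (a := k) (b := n0)
    (fun ks => if take k ks == drop n0 ks then cw ks else 0)) 1?addnC //.
  apply: eq_bigr => a _; apply: eq_bigr => s _.
  rewrite take_size_cat ?size_tuple // eq_sym.
  by case: eqP; rewrite ?mul1r ?mul0r.
have tr_C : \sum_(js : (n0 + k).-tuple 'I_n | take k js == drop n0 js) tw js = \sum_a C a a.
  rewrite big_mkcond /= (sum_tuple_cat (a := n0) (b := k)
    (fun js => if take k js == drop n0 js then tw js else 0)) //.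
  rewrite exchange_big; apply: eq_bigr => a _; apply: eq_bigr => s _.
  rewrite drop_size_cat ?size_tuple //.
  by case: eqP; rewrite ?mul1r ?mul0r.
rewrite tr_B tr_C; apply: (@trace_intertwine L _ P' Q') => [a c|a c].
  rewrite /Q' /P'; have [u_a|N] := boolP (uniq a).
    rewrite -(qE a c u_a); apply: eq_bigr => b _.
    have [u_b|N] := boolP (uniq b); first by rewrite mul1r addr0.
    by rewrite kernel_uniql // mul0r mulr0 mul0r.
  rewrite (bigD1 a) //= eqxx mul1r N big1 ?addr0 => [|b /negPf ba]; last first.
    by rewrite eq_sym ba mul0r.
  by rewrite kernel_uniql // add0r eq_sym.
have [u_a|N] := boolP (uniq a); last first.
  rewrite [RHS]big1 => [|b _]; last by rewrite C0l ?mul0r.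
  rewrite big1 // => b _; rewrite /P' N kernel_uniql // add0r.
  by case: eqP => [<-|_]; rewrite ?mul0r // B0 ?mulr0.
transitivity (\sum_(s : n0.-tuple 'I_n) P a (drop n0 (c ++ s)) * cw (c ++ s)).
  transitivity (\sum_(b : k.-tuple 'I_n) \sum_(s : n0.-tuple 'I_n)
      P a b * ((drop n0 (c ++ s) == b)%:R * cw (c ++ s))).
    by apply: eq_bigr => b _; rewrite /P' u_a addr0 -mulr_sumr.
  rewrite exchange_big; apply: eq_bigr => s _.
  have sz : size (drop n0 (c ++ s)) == k by rewrite size_drop size_kc addKn.
  rewrite (bigD1 (Tuple sz)) //= eqxx mul1r big1 ?addr0 // => b bN.
  by case: eqP => [E|_]; [case/eqP: bN; apply: val_inj|rewrite mul0r mulr0].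
rewrite (transfer (f := k)) ?size_tuple // 1?addnC //.
transitivity (\sum_(b : k.-tuple 'I_n) \sum_(s : n0.-tuple 'I_n)
    (take k (s ++ a) == b)%:R * tw (s ++ a) * P b c).
  rewrite exchange_big; apply: eq_bigr => s _.
  have sz : size (take k (s ++ a)) == k by rewrite size_takel // size_ck leq_addl.
  rewrite (bigD1 (Tuple sz)) //= eqxx mul1r big1 ?addr0 // => b bN.
  by case: eqP => [E|_]; [case/eqP: bN; apply: val_inj|rewrite !mul0r].
apply: eq_bigr => b _; rewrite -mulr_suml -/(C a b) /P' mulrDr.
have [u_b|N] := boolP (uniq b); first by rewrite mulr0 addr0.
by rewrite C0r // !mul0r addr0.
Qed.
End Transfer.

(** * From words back to the graph and its quotient *)

Lemma word_weight_rev (L : fieldType) m (phi : 'I_m.+1 -> seq 'I_m.+1 -> L) w :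
  word_weight phi (rev w) = \prod_(i < size w) phi (nth ord0 w i) (rev (take i w)).
Proof.
elim/last_ind: w => [|w c IHw]; first by rewrite big_ord0.
rewrite rev_rcons /= IHw size_rcons big_ord_recr /= mulrC; congr (_ * _).
  apply: eq_bigr => i _; rewrite nth_rcons ltn_ord; congr (phi _ (rev _)).
  by rewrite -cats1 takel_cat // ltnW.
by rewrite nth_rcons ltnn eqxx -cats1 take_size_cat.
Qed.

Lemma filter_enum_ord V b v : (v <= V)%N ->
  [seq u : 'I_V <- enum 'I_V | (b <= u)%N && (u < v)%N] = drop b (take v (enum 'I_V)).
Proof.
move=> vV; apply: (inj_map val_inj).
rewrite map_drop map_take val_enum_ord take_iota (minn_idPl vV) drop_iota.
rewrite -[LHS](filter_map val (fun u => (b <= u)%N && (u < v)%N)) val_enum_ord.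
apply: (irr_sorted_eq ltn_trans ltnn).
- by apply: sorted_filter; [exact: ltn_trans|exact: iota_ltn_sorted].
- exact: iota_ltn_sorted.
- by move=> u; rewrite mem_filter !mem_iota; lia.
Qed.

Section Graph.
Variables (n k : nat) (G : rel 'I_(n + k)).
Hypothesis nui : natural_unit_interval G.
Hypothesis clique_first : clique_on G [set v : 'I_(n + k) | (v < k)%N].
Hypothesis clique_last : clique_on G [set v : 'I_(n + k) | (n <= v)%N].

(** The interval property makes the smaller neighbours of v a stretch of d v vertices ending just
    before v. The first clique gives d v = v for v < k, and the last clique makes the final window
    at least k long. *)
Lemma backward_degree : exists d : nat -> nat,
  [/\ forall v, (d v <= v)%N, forall v, (d v.+1 <= (d v).+1)%N,
      forall v, (v < k)%N -> d v = v,
      (k <= max_window d (n + k))%N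
    & forall u v : 'I_(n + k), (u < v)%N -> G u v = (v - d v <= u)%N].
Proof.
have [[G_sym G_irr] G_nui] := nui.
pose E (u v : nat) := [exists p : 'I_(n + k), exists q : 'I_(n + k),
  [&& p == u :> nat, q == v :> nat & G p q]].
have EP (p q : 'I_(n + k)) : E p q = G p q.
  apply/existsP/idP => [[p' /existsP[q' /and3P[/eqP/val_inj-> /eqP/val_inj->]]]//|Gpq].
  by exists p; apply/existsP; exists q; rewrite !eqxx.
have E_lt u v : E u v -> (u < n + k)%N /\ (v < n + k)%N.
  by case/existsP=> p /existsP[q /and3P[/eqP<- /eqP<- _]].
have E_nui u w v : (u < w)%N -> (w < v)%N -> E u v -> E u w /\ E w v.
  move=> uw wv Euv; have [u_lt v_lt] := E_lt _ _ Euv.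
  have w_lt : (w < n + k)%N by apply: ltn_trans wv v_lt.
  move: Euv; rewrite (EP (Ordinal u_lt) (Ordinal v_lt)) => Guv.
  have [] := G_nui (Ordinal u_lt) (Ordinal v_lt) (Ordinal w_lt) _ Guv.
    by rewrite /= uw wv.
  by rewrite -!EP.
(* This is the smallest neighbour of v below v, or v itself if there is none. *)
pose b v := find (E^~ v) (iota 0 v).
have b_le v : (b v <= v)%N by rewrite -[X in (_ <= X)%N](size_iota 0) find_size.
have bE u v : (u < v)%N -> E u v = (b v <= u)%N.
  move=> uv; apply/idP/idP => [Euv|le_bu].
    rewrite leqNgt; apply/negP => /(before_find 0%N).
    by rewrite nth_iota // Euv.
  have lt_bv : (b v < v)%N by apply: leq_ltn_trans uv.
  have : E (b v) v.
    have := @nth_find _ 0%N (E^~ v) (iota 0 v); rewrite has_find size_iota => /(_ lt_bv).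
    by rewrite nth_iota.
  have [->//|ub] := eqVneq u (b v); move=> Ebv.
  by have [] := E_nui (b v) u v _ uv Ebv; first by lia.
have dK v : (v - (v - b v) = b v)%N by rewrite subKn.
exists (fun v => v - b v)%N; split.
- by move=> v; apply: leq_subr.
- move=> v; have := b_le v.+1; have := b_le v; move=> h1 h2.
  have [lt_b|] := ltnP (b v.+1) v; last by lia.
  have : E (b v.+1) v.+1 by rewrite bE //; lia.
  move=> /(E_nui _ v _ lt_b (ltnSn v))[]; rewrite bE //; lia.
- move=> v vk; suff -> : b v = 0%N by rewrite subn0.
  case: v vk => // v vk; apply/eqP; rewrite -leqn0 -bE //.
  have v_lt : (v.+1 < n + k)%N by lia.
  have z_lt : (0 < n + k)%N by lia.
  rewrite (EP (Ordinal z_lt) (Ordinal v_lt)); apply: clique_first; rewrite ?inE //=.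
  by lia.
- rewrite /max_window; case E' : (n + k)%N => [|v]; first by lia.
  have [k2|] := ltnP 1 k; last by lia.
  have v_lt : (v < n + k)%N by lia.
  have n_lt : (n < n + k)%N by lia.
  have : E n v.
    rewrite (EP (Ordinal n_lt) (Ordinal v_lt)); apply: clique_last; rewrite ?inE //=; first by lia.
    by rewrite -val_eqE /=; lia.
  by rewrite bE; lia.
by move=> u v uv; rewrite dK -bE // EP.
Qed.
End Graph.

Lemma prod_boolr (R : comNzRingType) (I : finType) (p b : pred I) :
  \prod_(i | p i) (b i)%:R = [forall i, p i ==> b i]%:R :> R.
Proof.
case: (boolP [forall i, p i ==> b i]) => [/forall_inP pb|].
  by rewrite big1 // => i /pb ->.
rewrite negb_forall_in => /exists_inP[i pi /negPf bi].
by rewrite (bigD1 i) //= bi mul0r.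
Qed.

Section Unrolled.
Variables (n k : nat) (G : rel 'I_(n + k)).
Hypothesis le_kn : (k <= n)%N.
Hypothesis nui : natural_unit_interval G.
Hypothesis clique_first : clique_on G [set v : 'I_(n + k) | (v < k)%N].
Hypothesis clique_last : clique_on G [set v : 'I_(n + k) | (n <= v)%N].
Variable T : eqType.
Local Notation V := (n + k)%N.
Local Notation word kappa := [seq kappa v | v <- enum 'I_V].

Definition cyclic_seq (c : 'I_V -> T) : bool :=
  [forall u : 'I_V, forall v : 'I_V, (v == (n + u)%N :> nat) ==> (c v == c u)].

Definition injective_start (c : 'I_V -> T) : bool :=
  [forall u : 'I_V, forall v : 'I_V, [&& (u < k)%N, (v < k)%N & c u == c v] ==> (u == v)].

Lemma size_word (c : 'I_V -> T) : size (word c) = V.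
Proof. by rewrite size_map size_enum_ord. Qed.

Lemma nth_word (c : 'I_V -> T) x0 (v : 'I_V) : nth x0 (word c) v = c v.
Proof. by rewrite (nth_map v) ?size_enum_ord // nth_ord_enum. Qed.

Lemma cyclic_word (c : 'I_V -> T) :
  (take k (rev (word c)) == drop n (rev (word c))) = cyclic_seq c.
Proof.
rewrite take_rev drop_rev size_word addnK [X in _ == rev (take X _)]addKn.
rewrite (inj_eq (can_inj revK)).
have sz1 : size (drop n (word c)) = k by rewrite size_drop size_word addKn.
have sz2 : size (take k (word c)) = k by rewrite size_takel // size_word leq_addl.
apply/eqP/'forall_forallP => /= [E u v|H].
  apply/implyP => /eqP vE; have uk : (u < k)%N by have := ltn_ord v; rewrite vE ltn_add2l.
  have := congr1 (fun s => nth (c u) s u) E.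
  by rewrite nth_drop -vE nth_take // !nth_word => ->.
have [k0|k_gt0] := posnP k.
  by rewrite (size0nil (etrans sz1 k0)) (size0nil (etrans sz2 k0)).
have z_lt : (0 < V)%N by rewrite addn_gt0 k_gt0 orbT.
apply: (@eq_from_nth _ (c (Ordinal z_lt))); rewrite sz1 // => r rk.
have u_lt : (r < V)%N by apply: leq_trans rk (leq_addl _ _).
have v_lt : (n + r < V)%N by rewrite ltn_add2l.
have := H (Ordinal u_lt) (Ordinal v_lt); rewrite /= eqxx => /eqP E.
rewrite nth_drop nth_take // -[r in RHS]/(val (Ordinal u_lt)) -[(n + r)%N]/(val (Ordinal v_lt)).
by rewrite !nth_word.
Qed.

Lemma take_word (c : 'I_V -> T) (v : 'I_V) :
  take v (word c) = [seq c u | u : 'I_V <- enum 'I_V & (u < v)%N].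
Proof.
by rewrite -map_take -[take v _](drop0) -filter_enum_ord //; exact: ltnW.
Qed.

Lemma injective_start_word (c : 'I_V -> T) :
  [forall v : 'I_V, (v < k)%N ==> (c v \notin rev (take v (word c)))] = injective_start c.
Proof.
apply/'forall_implyP/'forall_forallP => /= [H u v|H v vk].
  apply/implyP => /and3P[uk vk /eqP cuv].
  wlog lt_uv : u v uk vk cuv / (u < v)%N => [hw|].
    case: (ltngtP u v) => [/hw->//|/hw E|/val_inj-> //].
    by rewrite eq_sym E.
  have := H v vk; rewrite mem_rev take_word => /mapP[]; exists u => //.
  by rewrite mem_filter lt_uv mem_enum.
rewrite mem_rev take_word; apply/mapP => -[u]; rewrite mem_filter => /andP[uv _] cuv.
have := H u v; rewrite vk cuv eqxx (ltn_trans uv vk) /= => /eqP uv'.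
by rewrite uv' ltnn in uv.
Qed.

Lemma neighbours_word (d : nat -> nat) (c : 'I_V -> T) (v : 'I_V) :
    (forall v, (d v <= v)%N) ->
    (forall u v : 'I_V, (u < v)%N -> G u v = (v - d v <= u)%N) ->
  take (d v) (rev (take v (word c))) = rev [seq c u | u <- smaller_neighbors G v].
Proof.
move=> d_le dG; have sz : size (take v (word c)) = v.
  by rewrite size_takel // size_word ltnW.
rewrite take_rev sz -map_take -map_drop; congr (rev (map _ _)).
rewrite -filter_enum_ord; last exact: ltnW.
rewrite /smaller_neighbors; apply: eq_filter => u.
by case: ltnP => uv; rewrite ?andbT ?andbF //= dG.
Qed.

(** The quotient map that identifies the last k vertices with the first k. *)
Definition fold_vertex (v : 'I_V) : 'I_n :=
  match split v with inl u => u | inr r => widen_ord le_kn r end.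

Lemma fold_vertexE (v : 'I_V) (u : 'I_n) : (fold_vertex v == u) = (v \in merged k u).
Proof.
rewrite /fold_vertex inE -val_eqE; case: (splitP v) => [w ->|r ->] /=.
  rewrite [X in _ || X](_ : _ = false) ?orbF //.
  by apply/negbTE; rewrite neq_ltn (leq_trans (ltn_ord w)) // leq_addr.
rewrite eqn_add2l [X in X || _](_ : _ = false) //.
by apply/negbTE; rewrite neq_ltn (leq_trans (ltn_ord u)) ?orbT // leq_addr.
Qed.
End Unrolled.

Section SequenceWeight.
Variables (L : fieldType) (e : nat -> L) (n k : nat) (G : rel 'I_(n + k)).
Local Notation V := (n + k)%N.

(** Columns are 0-based, and e is arbitrary: it will be [elementary], its truncation, and e_r of
    finitely many variables. *)
Definition seq_weight (c : 'I_V -> nat) : L :=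
  \prod_(v : 'I_V | (k <= v)%N)
     ((uniq [seq c u | u <- smaller_neighbors G v])%:R
      * col_weight L (c v) [seq c u | u <- smaller_neighbors G v]
      * (e (c v).+1 / e (c v))).

Lemma seq_weight_valid (c : 'I_V -> nat) : seq_weight c != 0 ->
  forall v : 'I_V, (k <= v)%N ->
  (c v = 0%N \/ exists2 u, u \in smaller_neighbors G v & c v = (c u).+1) /\
  c v \notin [seq c u | u <- smaller_neighbors G v].
Proof.
move=> /prodf_neq0 W v kv; have := W v kv.
rewrite !mulf_eq0 !negb_or => /andP[/andP[_ cw] _]; split; last first.
  by apply: contra cw => cv; rewrite col_weight_mem.
move: cw; rewrite /col_weight; case: ifP => [/orP[/eqP->|]|]; last by rewrite eqxx.
  by left.
case E : (c v) => [|y]; first by left.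
by case/mapP => u uv /= -> _; right; exists u.
Qed.
End SequenceWeight.

Section FiniteIdentity.
Variables (n k : nat) (G : rel 'I_(n + k)).
Hypothesis le_kn : (k <= n)%N.
Hypothesis nui : natural_unit_interval G.
Hypothesis clique_first : clique_on G [set v : 'I_(n + k) | (v < k)%N].
Hypothesis clique_last : clique_on G [set v : 'I_(n + k) | (n <= v)%N].
Local Notation V := (n + k)%N.
Variables (L : fieldType) (m : nat).
Variable x : 'I_m.+1 -> L.
Hypothesis x_inj : injective x.
Hypothesis natL_neq0 : forall r, r.+1%:R != 0 :> L.
Local Notation esy r := ((elem_poly x [set: 'I_m.+1])`_r).
Hypothesis esym_neq0 : forall r, (r <= m.+1)%N -> esy r != 0.
Hypothesis le_nm : (n <= m.+1)%N.
Local Notation word kappa := [seq kappa v | v <- enum 'I_V].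

Lemma sum_tuple_ffun (f : seq 'I_m.+1 -> L) (p : pred (seq 'I_m.+1)) :
  \sum_(t : V.-tuple 'I_m.+1 | p t) f t
  = \sum_(c : {ffun 'I_V -> 'I_m.+1} | p (rev (word c))) f (rev (word c)).
Proof.
have sz (c : {ffun 'I_V -> 'I_m.+1}) : size (rev (word c)) == V.
  by rewrite size_rev size_word.
rewrite (reindex (fun c => Tuple (sz c))) //=.
exists (fun t : V.-tuple 'I_m.+1 => [ffun v : 'I_V => nth ord0 (rev t) v]) => [c _|t _].
  by apply/ffunP => v; rewrite ffunE /= revK nth_word.
apply: val_inj; rewrite /= -[RHS]revK; congr rev.
apply: (@eq_from_nth _ ord0); rewrite size_word ?size_rev ?size_tuple // => i iV.
by rewrite -[i]/(val (Ordinal iV)) nth_word ffunE.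
Qed.

Lemma unrolled_identity :
  \sum_(kappa : {ffun 'I_V -> 'I_m.+1} | cyclic_seq kappa)
     \prod_(v : 'I_V) ((kappa v \notin [seq kappa u | u <- smaller_neighbors G v])%:R
                       * (if (k <= v)%N then x (kappa v) else 1))
  = \sum_(c : {ffun 'I_V -> 'I_m.+1} | cyclic_seq c && injective_start c)
      seq_weight (fun r => esy r) G (fun v => c v).
Proof.
have [d [d_le d_step d_start d_max dG]] := backward_degree nui clique_first clique_last.
have le_km : (k <= m.+1)%N by apply: leq_trans le_nm.
have := cyclic_identity x_inj natL_neq0 esym_neq0 d_le d_step d_start le_km d_max.
rewrite !(sum_tuple_ffun _ (fun t => take k t == drop n t)).
have sz_take (c : {ffun 'I_V -> 'I_m.+1}) (v : 'I_V) : size (rev (take v (word c))) = v.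
  by rewrite size_rev size_takel // size_word ltnW.
have nthE (c : {ffun 'I_V -> 'I_m.+1}) (v : 'I_V) : nth ord0 (word c) v = c v.
  exact: nth_word.
set S1 := \sum_(_ | _) _; set S2 := \sum_(_ | _) _ => S12.
transitivity S1.
  apply: eq_big => [kappa|kappa _]; first by rewrite cyclic_word.
  rewrite word_weight_rev size_word; apply: eq_bigr => v _.
  rewrite nthE /colour_factor sz_take (neighbours_word _ _ d_le dG).
  by rewrite mem_rev.
rewrite S12 /S2 [RHS]big_mkcondr; apply: eq_big => [c|c _]; first by rewrite cyclic_word.
rewrite word_weight_rev size_word (bigID (fun v : 'I_V => (k <= v)%N)) /=.
rewrite [X in _ * X](eq_bigr (fun v : 'I_V => (c v \notin rev (take v (word c)))%:R)); last first.
  by move=> v /negPf kv; rewrite /column_factor sz_take nthE kv.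
rewrite (prod_boolr _ (fun v : 'I_V => ~~ (k <= v)%N)) /=.
rewrite [X in _ * X%:R](_ : _ = nat_of_bool (injective_start c)); last first.
  rewrite -injective_start_word; congr nat_of_bool; apply: eq_forallb => v.
  by rewrite ltnNge.
case: injective_start; last by rewrite mulr0.
rewrite mulr1; apply: eq_bigr => v kv.
rewrite nthE /column_factor sz_take kv (neighbours_word _ _ d_le dG) /colw rev_uniq.
have -> : [seq nat_of_ord (c u) | u <- smaller_neighbors G v]
          = map val [seq c u | u <- smaller_neighbors G v] by rewrite -map_comp.
rewrite (map_inj_uniq val_inj); congr (_ * _ * _).
by apply: perm_col_weight; rewrite map_rev perm_rev.
Qed.

(** Colourings of Gamma are the cyclic colour sequences on G, by composition with [fold_vertex]. The
    vertices from k on represent every vertex of Gamma exactly once, so they alone carry the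
    variables. *)
Theorem finite_identity (Gamma : rel 'I_n) : Gamma =2 identify_ends G ->
  \sum_(kappa : {ffun 'I_n -> 'I_m.+1}
        | [forall u, forall v, Gamma u v ==> (kappa u != kappa v)])
     \prod_u x (kappa u)
  = \sum_(c : {ffun 'I_V -> 'I_m.+1} | cyclic_seq c && injective_start c)
      seq_weight (fun r => esy r) G (fun v => c v).
Proof.
move=> GammaE; rewrite -unrolled_identity.
pose h (lam : {ffun 'I_n -> 'I_m.+1}) := [ffun v : 'I_V => lam (fold_vertex le_kn v)].
rewrite [RHS](reindex h) /=; last first.
  exists (fun kap : {ffun 'I_V -> 'I_m.+1} => [ffun u : 'I_n => kap (lshift k u)]) => [lam _|kap].
    apply/ffunP => u; rewrite !ffunE; congr (lam _); apply/eqP.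
    by rewrite fold_vertexE inE eqxx.
  rewrite inE => /'forall_forallP kap_cyc; apply/ffunP => v; rewrite !ffunE.
  rewrite /fold_vertex; case: (splitP v) => [u vu|r vr].
    by congr (kap _); apply: val_inj.
  apply/esym/eqP; have := kap_cyc (lshift k (widen_ord le_kn r)) v.
  by rewrite /= vr eqxx.
have h_cyc lam : cyclic_seq (h lam).
  apply/'forall_forallP => u v; apply/implyP => /eqP vu; rewrite !ffunE.
  apply/eqP; congr (lam _); apply/eqP; rewrite fold_vertexE inE.
  have uk : (u < k)%N by have := ltn_ord v; rewrite vu ltn_add2l.
  rewrite /fold_vertex; case: (splitP u) => [w uw|r ur] /=; first by rewrite vu uw eqxx orbT.
  by move: uk; rewrite ur ltnNge (leq_trans le_kn) ?leq_addr.
rewrite [RHS](eq_bigl xpredT); last exact: h_cyc.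
rewrite big_mkcond; apply: eq_bigr => lam _.
rewrite big_split /= (prod_boolr _ xpredT) /=.
have -> : [forall v : 'I_V, h lam v \notin [seq h lam u | u <- smaller_neighbors G v]]
        = [forall u, forall v, Gamma u v ==> (lam u != lam v)].
  have [[G_sym G_irr] _] := nui.
  apply/forallP/'forall_forallP => [H u v|H v].
    rewrite GammaE; apply/implyP => /exists_inP[p pu /exists_inP[q qv Gpq]].
    move: pu qv; rewrite -!(fold_vertexE le_kn) => /eqP<- /eqP<-.
    have E r : lam (fold_vertex le_kn r) = h lam r by rewrite ffunE.
    rewrite !E; wlog lt_pq : p q Gpq / (p < q)%N => [hw|].
      case: (ltngtP p q) => [lt|lt|/val_inj pq]; first exact: hw.
        by rewrite eq_sym hw // G_sym.
      by move: Gpq; rewrite pq G_irr.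
    apply: contra (H q) => /eqP <-; apply: map_f.
    by rewrite mem_filter lt_pq Gpq mem_enum.
  apply/mapP => -[u]; rewrite mem_filter => /andP[/andP[uv Guv] _]; rewrite !ffunE => E.
  have := H (fold_vertex le_kn u) (fold_vertex le_kn v); rewrite E eqxx implybF GammaE.
  move/negP; apply; apply/exists_inP; exists u; first by rewrite -(fold_vertexE le_kn).
  by apply/exists_inP; exists v; rewrite // -(fold_vertexE le_kn).
case: ifP => _; last by rewrite mul0r.
rewrite mul1r big_split_ord /= (bigID (fun u : 'I_n => (k <= u)%N)) /= big_mkcond /=.
congr (_ * _).
  apply: eq_bigr => u _; case: ifP => // _; rewrite ffunE; congr (x (lam _)).
  by apply/esym/eqP; rewrite fold_vertexE inE eqxx.
rewrite (eq_bigl (fun u : 'I_n => u < k)%N) => [|u]; last by rewrite ltnNge.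
rewrite (big_ord_narrow le_kn); apply: eq_bigr => r _.
rewrite (leq_trans le_kn) ?leq_addr // ffunE; congr (x (lam _)).
by apply/esym/eqP; rewrite fold_vertexE inE /= eqxx orbT.
Qed.
End FiniteIdentity.

(** * Tableaux and column sequences *)

Section Tableaux.
Implicit Types (S T : tableau) (s t u : seq int) (x : int) (y : nat).

(** Comparing entries along [zip] is not transitive, as a short middle row hides cells; with the
    length condition it is, and sorted rows become pairwise comparable. *)
Definition above s t := (size t <= size s)%N && all (fun p : int * int => p.1 < p.2) (zip s t).

Lemma aboveP s t : reflect
  ((size t <= size s)%N /\ forall i, (i < size t)%N -> nth 0 s i < nth 0 t i) (above s t).
Proof.
rewrite /above; elim: t s => [|b t IHt] [|a s] /=; try by constructor; split.
  by constructor; case.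
rewrite ltnS andbCA; apply: (iffP andP) => [[ab /IHt[le_ts lt_st]]|[le_ts lt_st]].
  by split=> // -[|i] //=; rewrite ltnS; apply: lt_st.
split; first exact: (lt_st 0%N).
by apply/IHt; split=> // i; apply: (lt_st i.+1).
Qed.

Lemma above_trans : transitive above.
Proof.
move=> t s u /aboveP[ts st] /aboveP[ut tu]; apply/aboveP.
split=> [|i iu]; first exact: leq_trans ts.
by apply: lt_trans (tu i iu); apply: st; apply: leq_trans ut.
Qed.

Lemma is_tableauE T :
  is_tableau T = [&& [::] \notin T, pairwise above T,
                     all (pairwise <%R) T & uniq (flatten T)].
Proof.
rewrite /is_tableau -(sorted_pairwise above_trans) sorted_map.
have -> : sorted above T = sorted (relpre size geq) T
    && sorted (fun s t => all (fun p : int * int => p.1 < p.2) (zip s t)) T.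
  by rewrite -sorted_relI; apply: eq_sorted => s t.
rewrite (eq_all (a2 := pairwise <%R)) => [|s]; last by rewrite lt_sorted_pairwise.
by rewrite -!andbA; do !bool_congr.
Qed.

Definition height T y := count (fun s => y <= size s)%N T.
Definition column_word T y := [seq nth 0 s y.-1 | s <- T & (y <= size s)%N].

Lemma size_column_word T y : size (column_word T y) = height T y.
Proof. by rewrite size_map size_filter. Qed.

Lemma uniq_flatten_row T s t x : uniq (flatten T) ->
  s \in T -> t \in T -> x \in s -> x \in t -> s = t.
Proof.
elim: T => //= r T IHT; rewrite cat_uniq => /and3P[_ /hasPn disj u_T].
have notin q : q \in T -> x \in q -> x \notin r.
  by move=> qT xq; apply: disj; apply/flattenP; exists q.
rewrite !inE => /predU1P[->|sT] /predU1P[->|tT] xs xt //.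
- by have := notin t tT xt; rewrite xs.
- by have := notin s sT xs; rewrite xt.
exact: IHT.
Qed.

Lemma columnE T s i : is_tableau T -> s \in T -> (i < size s)%N ->
  column T (nth 0 s i) = i.+1.
Proof.
rewrite is_tableauE => /and4P[_ _ rows u_T] sT lt_is.
have xs : nth 0 s i \in s by rewrite mem_nth.
rewrite /column; set f := find _ _.
have hasx : has (fun t => nth 0 s i \in t) T by apply/hasP; exists s.
have -> : nth [::] T f = s.
  apply: (uniq_flatten_row (T := T) (x := nth 0 s i)) => //.
    by rewrite mem_nth // -has_find.
  exact: (nth_find [::] hasx).
rewrite index_uniq //; apply: (pairwise_uniq ltxx).
exact: (allP rows).
Qed.

Lemma mem_column_word T y x : is_tableau T -> (0 < y)%N ->
  (x \in column_word T y) = (x \in flatten T) && (column T x == y).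
Proof.
move=> tabT y_gt0; apply/mapP/andP => [[s]|[/flattenP[s sT xs] /eqP cx]].
  rewrite mem_filter => /andP[ys sT] ->.
  have lt_y : (y.-1 < size s)%N by rewrite prednK.
  rewrite columnE // prednK // eqxx; split=> //.
  by apply/flattenP; exists s; rewrite ?mem_nth.
have cE : column T x = (index x s).+1.
  by rewrite -{1}(nth_index 0 xs) columnE ?index_mem.
exists s; last by rewrite -cx cE nth_index.
by rewrite mem_filter sT andbT -cx cE index_mem.
Qed.

Lemma column_word_sorted T y : is_tableau T -> (0 < y)%N -> sorted <%R (column_word T y).
Proof.
rewrite is_tableauE => /and4P[_ abT _ _] y_gt0.
apply: pairwise_sorted; rewrite pairwise_map.
elim: T abT => //= s T IHT /andP[sT /IHT abT]; case: ifP => //= ys.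
rewrite abT andbT; apply/allP => t; rewrite mem_filter => /andP[yt tT].
have /aboveP[_ ] := allP sT t tT; apply; by rewrite prednK.
Qed.

Lemma above_height0 s T y : all (above s) T -> (size s < y)%N -> height T y = 0%N.
Proof.
move=> sT sy; apply/eqP; rewrite -leqn0 leqNgt -has_count; apply/hasPn => t tT.
have /aboveP[ts _] := allP sT t tT.
by rewrite -ltnNge; apply: leq_ltn_trans sy.
Qed.

Lemma height_le_size T y r : is_tableau T -> (0 < y)%N ->
  (r < height T y)%N = (y <= size (nth [::] T r))%N.
Proof.
rewrite is_tableauE => /and4P[_ abT _ _] y_gt0.
elim: T r abT => [|s T IHT] r /=; first by rewrite nth_nil ltn0; case: (y) y_gt0.
move=> /andP[sT abT]; have [ys|sy] /= := leqP y (size s).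
  by case: r => [|r] /=; rewrite ?ys // add1n ltnS IHT.
rewrite -/(height T y) (above_height0 sT sy).
case: r => [|r]; first by rewrite /= [RHS]leqNgt sy.
rewrite /= ltn0; apply/esym/negbTE; rewrite -ltnNge.
have [rT|rT] := ltnP r (size T); last by rewrite nth_default.
have /aboveP[ts _] := allP sT _ (mem_nth [::] rT).
by apply: leq_ltn_trans sy.
Qed.

Lemma nth_column_word T y r : is_tableau T -> (0 < y)%N -> (r < height T y)%N ->
  nth 0 (column_word T y) r = nth 0 (nth [::] T r) y.-1.
Proof.
move=> tabT y_gt0 lt_r.
have rT : (r < size T)%N.
  rewrite ltnNge; apply/negP => leTr; move: lt_r.
  by rewrite height_le_size // nth_default //= leqNgt y_gt0.
have prefixE : [seq s <- T | (y <= size s)%N] = take (height T y) T.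
  move: tabT; rewrite is_tableauE => /and4P[_ + _ _].
  rewrite /height; elim: (T) => //= s U IHU /andP[sU abU].
  have [ys|sy] := leqP y (size s); first by rewrite /= IHU.
  by rewrite IHU // -/(height U y) (above_height0 sU sy) take0.
rewrite /column_word prefixE (nth_map [::]) ?nth_take //.
by rewrite size_takel // count_size.
Qed.

(** Each column is the increasing list of its entries, so it is determined by which entries lie in
    it; the column heights then give the row lengths. *)
Lemma tableau_eq T T' : is_tableau T -> is_tableau T' ->
    flatten T =i flatten T' -> (forall x, x \in flatten T -> column T x = column T' x) ->
  T = T'.
Proof.
move=> tabT tabT' memT colT.
have wordE y : (0 < y)%N -> column_word T y = column_word T' y.
  move=> y_gt0; apply: (irr_sorted_eq lt_trans ltxx); rewrite ?column_word_sorted //.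
  move=> x; rewrite !mem_column_word // -memT; case: (boolP (x \in flatten T)) => //= xT.
  by rewrite colT.
have heightE y : (0 < y)%N -> height T y = height T' y.
  by move=> y_gt0; rewrite -!size_column_word wordE.
have sizeE U : is_tableau U -> size U = height U 1.
  rewrite is_tableauE /height => /andP[nilU _]; rewrite -[LHS]count_predT.
  by apply: eq_in_count => s sU; rewrite lt0n size_eq0; apply/esym; apply: contraNneq nilU => <-.
have rowE r y : (0 < y)%N -> (y <= size (nth [::] T r))%N = (y <= size (nth [::] T' r))%N.
  by move=> y_gt0; rewrite -!height_le_size // heightE.
have row_size r : size (nth [::] T r) = size (nth [::] T' r).
  apply/eqP; rewrite eqn_leq; apply/andP; split.
    by case E : (size (nth [::] T r)) => [|z] //; rewrite -rowE // E.
  by case E : (size (nth [::] T' r)) => [|z] //; rewrite rowE // E.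
apply: (@eq_from_nth _ [::]) => [|r rT]; first by rewrite !sizeE // heightE.
apply: (@eq_from_nth _ 0) => // i lt_i.
have lt_r : (r < height T i.+1)%N by rewrite height_le_size.
by rewrite -(nth_column_word (y := i.+1)) // wordE // nth_column_word // -heightE.
Qed.

Lemma mem_subtableau S T s : subtableau S T -> s \in S ->
  exists2 t, t \in T & prefix s t.
Proof.
case/andP=> le_ST /(all_nthP ([::], [::])) allp /(nthP [::])[i lt_i <-].
have := allp i; rewrite size_zip (minn_idPl le_ST) nth_zip_cond.
rewrite size_zip (minn_idPl le_ST) lt_i => /(_ isT) /= p.
by exists (nth [::] T i); rewrite ?mem_nth // (leq_trans lt_i).
Qed.

Lemma column_subtableau S T x : is_tableau S -> is_tableau T -> subtableau S T ->
  x \in flatten S -> x \in flatten T /\ column T x = column S x.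
Proof.
move=> tabS tabT subST /flattenP[s sS xs].
have [t tT /prefixP[w tE]] := mem_subtableau subST sS.
have lt_i : (index x s < size s)%N by rewrite index_mem.
have xE : nth 0 t (index x s) = x by rewrite tE nth_cat lt_i nth_index.
have lt_it : (index x s < size t)%N by rewrite tE size_cat ltn_addr.
split; first by apply/flattenP; exists t => //; rewrite -xE mem_nth.
by rewrite -{1}xE columnE // -[in RHS](nth_index 0 xs) columnE.
Qed.

Lemma subtableau_refl T : subtableau T T.
Proof.
rewrite /subtableau leqnn /=; apply/(all_nthP ([::], [::])) => i; rewrite size_zip minnn => lt_i.
by rewrite nth_zip //= prefix_refl.
Qed.

Lemma subtableau_trans S T U : subtableau S T -> subtableau T U -> subtableau S U.
Proof.
case/andP=> le_ST /(all_nthP ([::], [::])) pST /andP[le_TU /(all_nthP ([::], [::])) pTU].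
rewrite /subtableau (leq_trans le_ST) //=; apply/(all_nthP ([::], [::])) => i.
have nthz A B : (size A <= size B)%N -> (i < size A)%N ->
    nth ([::], [::]) (zip A B) i = (nth [::] A i, nth [::] B i) :> seq int * seq int.
  by move=> le_AB lt_i; rewrite nth_zip_cond size_zip (minn_idPl le_AB) lt_i.
rewrite size_zip (minn_idPl (leq_trans le_ST le_TU)) => lt_i.
rewrite nthz // ?(leq_trans le_ST) //=.
have := pST i; rewrite size_zip (minn_idPl le_ST) nthz // => /(_ lt_i)/= p1.
have := pTU i; rewrite size_zip (minn_idPl le_TU) nthz // ?(leq_trans lt_i) //.
by move=> /(_ isT)/= p2; apply: prefix_trans p1 p2.
Qed.
End Tableaux.

Section AddCell.
Implicit Types (S T : tableau) (s t u : seq int) (x : int) (y : nat).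

Lemma subtableau_extend_row T1 s x T2 :
  subtableau (T1 ++ s :: T2) (T1 ++ rcons s x :: T2).
Proof.
elim: T1 => [|t T1 IHT]; rewrite /subtableau /= ?ltnS ?leqnn ?prefix_refl /=.
  by rewrite prefix_rcons; have /andP[] := subtableau_refl T2.
by move: IHT; rewrite /subtableau.
Qed.

Lemma subtableau_add_row T s : subtableau T (T ++ [:: s]).
Proof.
elim: T => [|t T IHT] //; rewrite /subtableau /= ltnS prefix_refl /=.
by move: IHT; rewrite /subtableau.
Qed.

Lemma height_cat T1 T2 y : height (T1 ++ T2) y = (height T1 y + height T2 y)%N.
Proof. exact: count_cat. Qed.

(* The row to be extended, written between the rows [T1] below it and [T2]
   above it; it is empty when the new cell starts a row of its own. *)
Lemma split_row T y : is_tableau T -> (0 < y)%N ->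
    y = 1%N \/ (height T y < height T y.-1)%N ->
  exists T1 s T2, [/\ T = T1 ++ s :: T2 \/ [/\ T = T1, s = [::] & T2 = [::]],
     (size s).+1 = y & all (fun t => y <= size t)%N T1].
Proof.
move=> tabT y_gt0 hy; pose r := height T y.
have allr (U : tableau) : (size U <= r)%N -> prefix U T -> all (fun t => y <= size t)%N U.
  move=> Ur /prefixP[W TE]; apply/(all_nthP [::]) => i lt_i.
  have : (i < height T y)%N by apply: leq_trans Ur.
  by rewrite height_le_size // TE nth_cat lt_i.
have [rT|Tr] := ltnP r (size T).
  exists (take r T), (nth [::] T r), (drop r.+1 T); split.
  - by left; rewrite -drop_nth // cat_take_drop.
  - have s_lt : (size (nth [::] T r) < y)%N by rewrite ltnNge -height_le_size // ltnn.
    case: hy => [y1|hy].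
      have : [::] \notin T by case/and5P: tabT.
      move: s_lt; rewrite y1 ltnS leqn0 size_eq0 => /eqP sE.
      by rewrite -sE mem_nth.
    have [y1|y2] := leqP y 1.
      by apply/eqP; move: s_lt; rewrite eqn_leq; lia.
    have : (r < height T y.-1)%N by [].
    rewrite height_le_size //; lia.
  - by apply: allr; [rewrite size_takel // ltnW|exact: prefix_take].
exists T, [::], [::]; split; [by right| |exact: (allr T Tr (prefix_refl T))].
case: hy => [->//|hy]; have := leq_trans hy (count_size _ _).
by rewrite ltnNge Tr.
Qed.

(** As x exceeds every entry, only the shape matters: the new cell starts a row, or extends a row of
    length y - 1, which exists when column y is shorter than column y - 1. *)
Lemma add_cell T y x : is_tableau T -> all (fun z => z < x) (flatten T) -> (0 < y)%N ->
    y = 1%N \/ (height T y < height T y.-1)%N ->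
  exists T', [/\ is_tableau T', subtableau T T', perm_eq (flatten T') (x :: flatten T),
     column T' x = y &
     (forall y', (0 < y')%N -> height T' y' = height T y' + (y' == y))%N /\
     (forall N, all (fun s => size s <= N)%N T -> (y <= N)%N ->
        all (fun s => size s <= N)%N T')].
Proof.
move=> tabT Tx y_gt0 hy.
have [T1 [s [T2 [TE sy T1y]]]] := split_row tabT y_gt0 hy.
pose T' := T1 ++ rcons s x :: T2.
have flatE : perm_eq (flatten T') (x :: flatten T).
  have -> : flatten T = flatten T1 ++ s ++ flatten T2.
    by case: TE => [->|[-> -> ->]]; rewrite ?flatten_cat //= cats0.
  rewrite /T' flatten_cat /= -cats1; apply/seq.permP => p.
  by rewrite /= !count_cat /=; clear; lia.
have x_T : x \notin flatten T.
  by apply/negP => /(allP Tx); rewrite ltxx.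
have s_lt z : z \in s -> z < x.
  by move=> zs; apply: (allP Tx); case: TE => [->|[_ sE _]];
     [rewrite flatten_cat mem_cat /= mem_cat zs orbT|rewrite sE in zs].
have abT1s t : t \in T1 -> above t s.
  move=> tT1; case: TE => [TE|[_ -> _]]; last by rewrite /above; case: (t).
  move: tabT; rewrite is_tableauE TE pairwise_cat => /and4P[_ /and3P[/allrelP ab _ _] _ _].
  by apply: ab => //; rewrite mem_head.
have tabT' : is_tableau T'.
  move: tabT; rewrite !is_tableauE => /and4P[nilT abT rowsT uT].
  have [nilT1 abT1 rowsT1] : [/\ [::] \notin T1, pairwise above T1 & all (pairwise <%R) T1].
    case: TE => [TE|[TE _ _]]; rewrite ?TE // in nilT abT rowsT *.
    move: nilT abT rowsT; rewrite mem_cat negb_or pairwise_cat all_cat.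
    by move=> /andP[-> _] /and3P[_ -> _] /andP[-> _].
  have [nilT2 abT2 rowsT2] : [/\ [::] \notin T2, pairwise above T2 & all (pairwise <%R) T2].
    case: TE => [TE|[_ _ ->]] //; rewrite TE in nilT abT rowsT *.
    move: nilT abT rowsT; rewrite mem_cat negb_or pairwise_cat all_cat inE negb_or /=.
    by move=> /and3P[_ _ ->] /and4P[_ _ _ ->] /and3P[_ _ ->].
  have ab_s : all (above s) T2.
    case: TE => [TE|[_ _ ->]] //; move: abT; rewrite TE pairwise_cat /=.
    by case/and4P.
  have ab12 t u : t \in T1 -> u \in T2 -> above t u.
    by move=> tT1 uT2; apply: above_trans (abT1s t tT1) _; apply: (allP ab_s).
  have row_s : pairwise <%R s.
    case: TE => [TE|[_ -> _]] //; move: rowsT; rewrite TE all_cat /=.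
    by case/and3P.
  apply/and4P; split.
  - by rewrite mem_cat inE !negb_or nilT1 nilT2 andbT /=; case: (s).
  - rewrite pairwise_cat /= abT1 abT2 !andbT; apply/andP; split.
      apply/allrelP => t u tT1; rewrite inE => /predU1P[->|/ab12]; last exact.
      have /aboveP[st ts] := abT1s t tT1; apply/aboveP.
      have yt : (y <= size t)%N := allP T1y t tT1.
      rewrite size_rcons; split=> [|i]; first by rewrite sy.
      rewrite ltnS leq_eqVlt nth_rcons => /predU1P[->|lt_i]; last by rewrite lt_i ts.
      rewrite ltnn eqxx; apply: (allP Tx).
      have tT : t \in T by case: TE => [->|[-> _ _]]; rewrite ?mem_cat tT1.
      by apply/flattenP; exists t => //; rewrite mem_nth // sy.
    apply/allP => u /(allP ab_s) /aboveP[us su]; apply/aboveP.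
    split=> [|i lt_i]; first by rewrite size_rcons ltnW.
    by rewrite nth_rcons (leq_trans lt_i us) su.
  - by rewrite all_cat rowsT1 /= rowsT2 andbT pairwise_rcons row_s andbT; apply/allP.
  by rewrite (perm_uniq flatE) /= x_T.
exists T'; split=> //.
- rewrite /T'; case: TE => [->|[-> -> ->]]; first exact: subtableau_extend_row.
  exact: subtableau_add_row.
- have E : nth 0 (rcons s x) (size s) = x by rewrite nth_rcons ltnn eqxx.
  rewrite -{1}E columnE ?size_rcons //.
  by rewrite mem_cat mem_head orbT.
split=> [y' y'_gt0|N TN yN].
  have -> : height T y' = (height T1 y' + ((y' <= size s)%N + height T2 y'))%N.
    case: TE => [->|[-> -> ->]]; first by rewrite height_cat.
    by rewrite leqNgt y'_gt0 /height /= !addn0.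
  rewrite height_cat /= size_rcons -!addnA; congr (_ + _)%N.
  rewrite [(height T2 _ + _)%N]addnC addnA; congr (_ + _)%N.
  by rewrite -sy; lia.
rewrite all_cat /= size_rcons sy yN.
by move: TN; case: TE => [->|[-> _ ->]]; rewrite ?all_cat ?andbT //= => /and3P[-> _ ->].
Qed.
End AddCell.

Lemma height_ltS (T : tableau) s : s \in T ->
  (height T (size s).+1 < height T (size s))%N.
Proof.
move=> sT; rewrite /height.
have/seq.permP E := perm_to_rem sT; rewrite !E /= leqnn ltnn add0n add1n ltnS.
by apply: sub_count => t /=; apply: ltnW.
Qed.

Lemma height_leS (T : tableau) y : (height T y.+1 <= height T y)%N.
Proof. by apply: sub_count => t /=; apply: ltnW. Qed.

Section TableauxOver.
Variables (n k N : nat) (G : rel 'I_(n + k)).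
Hypothesis le_kn : (k <= n)%N.
Hypothesis nui : natural_unit_interval G.
Local Notation V := (n + k)%N.
Variables (j : 'I_k -> nat) (S : tableau).
Hypothesis j_inj : injective j.
Hypothesis j_lt : forall r, (j r < N)%N.
Hypothesis start_S : is_start (fun r => (j r).+1) S.

Definition first_vertex (r : 'I_k) : 'I_V := lshift k (widen_ord le_kn r).

Lemma start_tableau : is_tableau S.
Proof. by case: start_S. Qed.

Lemma start_row (r : 'I_k) : exists s : seq int,
  [/\ size s = j r, all (fun x => x <= 0) s & rcons s (r.+1)%:Z \in S].
Proof. by case: start_S => _ _ /(_ r) [s [[sz] s0 sS]]; exists s. Qed.

Lemma start_label (r : 'I_k) :
  (r.+1%:Z \in flatten S) /\ column S r.+1%:Z = (j r).+1.
Proof.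
have [s [sz _ sS]] := start_row r; split.
  by apply/flattenP; exists (rcons s (r.+1)%:Z); rewrite // mem_rcons mem_head.
have E : nth 0 (rcons s (r.+1)%:Z) (size s) = r.+1%:Z by rewrite nth_rcons ltnn eqxx.
by rewrite -{1}E (columnE start_tableau sS) ?size_rcons // sz.
Qed.

(** The lengths j r are distinct, so every row of S is one of those described by [is_start]. *)
Lemma start_row_inv t : t \in S -> exists r : 'I_k,
  size t = (j r).+1 /\ exists2 s, all (fun x => x <= 0) s & t = rcons s (r.+1)%:Z.
Proof.
have [_ perm_S _] := start_S; move=> tS.
have : size t \in [seq (j r).+1 | r <- enum 'I_k].
  by rewrite -(perm_mem perm_S) map_f.
case/mapP => r _ sz_t; exists r; split=> //.
have [s [sz s0 sS]] := start_row r; exists s => //.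
have u_sizes : uniq [seq size s | s <- S].
  rewrite (perm_uniq perm_S) map_inj_uniq ?enum_uniq // => r1 r2 [].
  exact: j_inj.
apply/eqP; apply: contraT => neq.
have := perm_to_rem tS => /(perm_map size)/perm_uniq; rewrite u_sizes /= => /esym/andP[+ _].
case/negP; rewrite (_ : size t = size (rcons s (r.+1)%:Z)); last by rewrite size_rcons sz.
apply: map_f; move: sS; rewrite (perm_mem (perm_to_rem tS)) inE => /predU1P[E|//].
by rewrite E eqxx in neq.
Qed.

Lemma start_le (x : int) : x \in flatten S -> x <= k%:Z.
Proof.
case/flattenP => t /start_row_inv[r [_ [s s0 ->]]].
rewrite mem_rcons inE => /predU1P[->|/(allP s0) xs]; first by rewrite lez_nat.
exact: le_trans xs _.
Qed.

Lemma start_size : all (fun s => size s <= N)%N S.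
Proof. by apply/allP => t /start_row_inv[r [-> _]]. Qed.

Lemma vcolumn_first (T : tableau) r : is_tableau T -> subtableau S T ->
  vcolumn T (first_vertex r) = (j r).+1.
Proof.
move=> tabT ST; have [rS col_r] := start_label r.
by have [_] := column_subtableau start_tableau tabT ST rS; rewrite col_r.
Qed.

Lemma mem_over (T : tableau) (x : int) : T \in tableaux_over n N (fun r => (j r).+1) S ->
  (x \in flatten T) = (x \in flatten S) || (k%:Z < x <= (n + k)%:Z).
Proof.
rewrite inE => -[tabT _ ST memT _]; rewrite -memT.
case: (boolP (x \in flatten S)) => [xS|_]; last by rewrite andbT.
by have [->] := column_subtableau start_tableau tabT ST xS.
Qed.

Lemma label_over (T : tableau) (v : 'I_V) : T \in tableaux_over n N (fun r => (j r).+1) S ->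
  label v \in flatten T.
Proof.
move=> TA; rewrite mem_over // /label; have [vk|kv] := ltnP v k.
  by have [-> _] := start_label (Ordinal vk).
by rewrite ltz_nat ltnS kv lez_nat ltn_ord orbT.
Qed.

Lemma vcolumn_le (T : tableau) (v : 'I_V) : T \in tableaux_over n N (fun r => (j r).+1) S ->
  (0 < vcolumn T v <= N)%N.
Proof.
move=> TA; have /flattenP[t tT vt] := label_over v TA.
move: TA; rewrite inE => -[tabT /allP/(_ t tT) szN _ _ _].
rewrite /vcolumn -(nth_index 0 vt) columnE // ?index_mem //=.
by apply: leq_trans szN; rewrite index_mem.
Qed.

Lemma tableaux_over_inj (T T' : tableau) :
    T \in tableaux_over n N (fun r => (j r).+1) S ->
    T' \in tableaux_over n N (fun r => (j r).+1) S ->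
  (forall v : 'I_V, vcolumn T v = vcolumn T' v) -> T = T'.
Proof.
move=> TA T'A eq_col; have memE x := mem_over x TA; have memE' x := mem_over x T'A.
move: (TA) (T'A); rewrite !inE => -[tabT _ ST _ _] [tabT' _ ST' _ _].
apply: tableau_eq => // [x|x]; first by rewrite memE memE'.
rewrite memE => /orP[xS|].
  have [_ ->] := column_subtableau start_tableau tabT ST xS.
  by have [_ ->] := column_subtableau start_tableau tabT' ST' xS.
case: x => [[|x]|x] // /andP[_]; rewrite lez_nat => lt_x.
exact: (eq_col (Ordinal lt_x)).
Qed.

Variable c : 'I_V -> nat.
Hypothesis c_first : forall r, c (first_vertex r) = j r.
Hypothesis c_lt : forall v, (c v < N)%N.
Hypothesis c_valid : forall v : 'I_V, (k <= v)%N ->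
  (c v = 0%N \/ exists2 u, u \in smaller_neighbors G v & c v = (c u).+1) /\
  c v \notin [seq c u | u <- smaller_neighbors G v].

(* The last clause says that a cell can be added to the right of the cell of [u]
   as long as no later vertex went to the next column. *)
Lemma partial_tableau t : (t <= n)%N -> exists T,
  [/\ is_tableau T, all (fun s => size s <= N)%N T, subtableau S T,
      forall x, ((x \in flatten T) && (x \notin flatten S)) = (k%:Z < x <= (k + t)%:Z) &
      (forall u : 'I_V, (u < k + t)%N -> vcolumn T u = (c u).+1) /\
      (forall u : 'I_V, (u < k + t)%N ->
        (forall w : 'I_V, (k <= w)%N -> (u < w)%N -> (w < k + t)%N -> c w != (c u).+1) ->
        (height T (c u).+2 < height T (c u).+1)%N)].
Proof.
elim: t => [|t IHt] tn.
  have first_of (u : 'I_V) : (u < k + 0)%N -> exists r, u = first_vertex r.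
    by rewrite addn0 => uk; exists (Ordinal uk); apply: val_inj.
  exists S; split; [exact: start_tableau|exact: start_size|exact: subtableau_refl| |split].
  - move=> x; rewrite andbN addn0; apply/esym/negbTE.
    by apply/negP => /andP[h1 h2]; have := lt_le_trans h1 h2; rewrite ltxx.
  - move=> u /first_of[r ->]; rewrite c_first.
    by apply: vcolumn_first; [exact: start_tableau|exact: subtableau_refl].
  move=> u /first_of[r ->] _; rewrite c_first.
  have [s [sz _ sS]] := start_row r.
  by have := height_ltS sS; rewrite size_rcons sz.
have [T [tabT sizeT ST memT [colT heightT]]] := IHt (ltnW tn).
have v_lt : (k + t < V)%N by rewrite addnC ltn_add2r.
pose v := Ordinal v_lt.
have [valid_v fresh_v] := c_valid (v := v) (leq_addr _ _).
have T_le (x : int) : x \in flatten T -> x <= (k + t)%:Z.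
  move=> xT; case: (boolP (x \in flatten S)) => [/start_le xk|xS].
    by apply: le_trans xk _; rewrite lez_nat leq_addr.
  by have := memT x; rewrite xT xS => /esym/andP[].
have T_lt : all (fun z => z < label v) (flatten T).
  by apply/allP => z /T_le zle; apply: le_lt_trans zle _; rewrite ltz_nat.
have [|T' [tabT' TT' permT' colT' [heightT' sizeT']]] :=
    add_cell tabT T_lt (ltn0Sn (c v)).
  case: valid_v => [->|[u u_v cvu]]; [by left|right].
  rewrite cvu; move: u_v; rewrite mem_filter => /andP[/andP[uv Guv] _].
  (* By the interval property a vertex w between u and v is a neighbour of v, so its column differs
     from that of v. *)
  apply: heightT => // w kw uw wv; rewrite -cvu; apply: contraNneq fresh_v => <-.
  apply: map_f; rewrite mem_filter wv mem_enum andbT.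
  by case: nui => _ /(_ u v w) []; rewrite ?uw.
have v_S : label v \notin flatten S.
  by apply/negP => /start_le; rewrite /label lez_nat /= => h; move: (leq_trans h (leq_addr t k)); rewrite ltnn.
exists T'; split=> //.
- exact: sizeT'.
- exact: subtableau_trans ST TT'.
- move=> x; rewrite (perm_mem permT') inE.
  have [->|xv] := eqVneq x (label v).
    by rewrite v_S /label ltz_nat /= ltnS leq_addr lez_nat addnS leqnn.
  rewrite memT; apply: andb_id2l => kx.
  rewrite addnS; move: xv; rewrite /label /=; lia.
split=> [u|u].
  rewrite addnS ltnS leq_eqVlt => /predU1P[uv|lt_u].
    have -> : u = v by apply: val_inj.
    exact: colT'.
  rewrite -colT // /vcolumn; have [|_ ->//] := column_subtableau (x := label u) tabT tabT' TT'.
  have [uk|ku] := ltnP u k.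
    have [uS _] := start_label (Ordinal uk).
    by have [] := column_subtableau start_tableau tabT ST uS.
  have := memT (label u); rewrite /label ltz_nat ltnS ku lez_nat lt_u.
  by move=> /andP[].
rewrite addnS ltnS leq_eqVlt => /predU1P[uv|lt_u] nw.
  have -> : u = v by apply: val_inj.
  rewrite !heightT' // eqxx addn1 ltnS.
  by rewrite (gtn_eqF (ltnSn _)) addn0 height_leS.
rewrite !heightT' //.
have -> : ((c u).+2 == (c v).+1) = false.
  by apply/negbTE; rewrite eqSS eq_sym; apply: nw; rewrite ?leq_addr.
rewrite addn0; apply: leq_trans (leq_addr _ _).
by apply: heightT => // w kw uw wt; apply: nw => //; apply: leq_trans wt _.
Qed.

Lemma tableau_of_columns : (forall r, c (rshift n r) = j r) ->
  exists2 T, T \in tableaux_over n N (fun r => (j r).+1) S &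
             forall v : 'I_V, vcolumn T v = (c v).+1.
Proof.
move=> c_last; have [T [tabT sizeT ST memT [colT _]]] := partial_tableau (leqnn n).
have colE v : vcolumn T v = (c v).+1 by apply: colT; rewrite (leq_trans (ltn_ord v)) // addnC.
exists T => //; rewrite inE; split=> // [x|r]; first by rewrite memT addnC.
by rewrite colE c_last.
Qed.
End TableauxOver.

(** * The sum over tableaux as a sum over column sequences *)

Lemma fsbig_reindex (V : nmodType) (T : choiceType) (I : finType) (A : set T)
    (f : T -> V) (p : pred I) (g : I -> V) (h : T -> I) :
    (forall t, t \in A -> p (h t) /\ f t = g (h t)) ->
    {in A &, injective h} ->
    (forall i, p i -> g i != 0 -> exists2 t, t \in A & h t = i) ->
  \sum_(t \in A) f t = \sum_(i | p i) g i.
Proof.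
move=> Ah h_inj h_surj.
have [[t0 t0A]|A0] := pselect (exists t, t \in A); last first.
  rewrite fsbig1 => [|t tA]; last by case: A0; exists t; rewrite inE.
  rewrite big1 // => i pi; apply/eqP; apply: contrapT => /negP gi.
  by have [t tA _] := h_surj i pi gi; case: A0; exists t.
have ex i : exists t, p i && (g i != 0) -> t \in A /\ h t = i.
  case: (boolP (p i && (g i != 0))) => [/andP[pi gi]|_]; last by exists t0.
  by have [t tA ht] := h_surj i pi gi; exists t.
pose tau i := projT1 (cid (ex i)).
have tauP i : p i && (g i != 0) -> tau i \in A /\ h (tau i) = i by rewrite /tau; case: cid.
pose r := [seq tau i | i <- index_enum I & p i && (g i != 0)].
rewrite (fsbigE r); first last.
- move=> t tA t_r; have tA' : t \in A by rewrite inE.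
  have [pt ->] := Ah t tA'; apply/eqP; apply: contraNT t_r => gt.
  have pgt : p (h t) && (g (h t) != 0) by rewrite pt gt.
  have [tauA htau] := tauP _ pgt.
  have <- : tau (h t) = t by apply: h_inj.
  by apply: map_f; rewrite mem_filter pgt mem_index_enum.
- by move=> t /= /mapP[i]; rewrite mem_filter => /andP[/tauP[tA _] _] ->; rewrite inE in tA.
- rewrite map_inj_in_uniq ?filter_uniq ?index_enum_uniq // => i i'; rewrite !mem_filter.
  by move=> /andP[/tauP[_ hi] _] /andP[/tauP[_ hi'] _] E; rewrite -hi E hi'.
rewrite big_map big_filter_cond /= [RHS](bigID (fun i => g i != 0)) /=.
rewrite [X in _ = _ + X]big1 ?addr0 => [|i /andP[_ /negPn/eqP]//].
apply: eq_big => [i|i /andP[/tauP[/Ah[_ ->] ->]//]].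
case E : (p i && (g i != 0)); last by rewrite ?andbF.
by have [-> _] := tauP i E.
Qed.

Lemma Aweight_col_weight y sigma :
  Aweight y.+1 [seq s.+1 | s <- sigma] = col_weight rat y sigma.
Proof.
rewrite /Aweight /col_weight /=; case: y => [|y] /=.
  rewrite maxnE divr1 mul1r big_map; apply: eq_bigr => s _.
  by rewrite /col_ratio /= -natr1 addrK !sub0r invrN mulrNN natr1.
rewrite (mem_map succn_inj) maxnE addn0 natr1; case: ifP => // _.
rewrite big_map; congr (_ * _); rewrite big_mkcond; apply: eq_bigr => s _.
rewrite /col_ratio !eqSS [y == s]eq_sym; case: eqVneq => [//|sy] /=.
by rewrite -!natr1; congr (_ / _); ring.
Qed.

Lemma rmorph_col_weight (L : fieldType) (f : {rmorphism rat -> L}) y sigma :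
  f (col_weight rat y sigma) = col_weight L y sigma.
Proof.
rewrite /col_weight; case: ifP => _; last exact: rmorph0.
rewrite rmorphM fmorph_div !rmorph_nat rmorph_prod; congr (_ * _).
apply: eq_bigr => s _; rewrite /col_ratio; case: eqP => _; first exact: rmorph1.
by rewrite fmorph_div !rmorphB !rmorph_nat.
Qed.

Lemma ps_const_is_zmod_morphism : zmod_morphism ps_const.
Proof.
by move=> a b; apply: powserP => m /=; case: eqP => _; rewrite ?subrr ?subr0.
Qed.

Lemma ps_const_is_monoid_morphism : monoid_morphism ps_const.
Proof.
split=> [|a b]; first by apply: powserP => m /=; case: eqP.
apply: powserP => m /=; have m0 : mset0 \in mdivisors m by rewrite mem_mdivisors msub0set.
rewrite (bigD1_seq mset0) ?mdivisors_uniq //= eqxx big1 => [|u /negPf ->]; last by rewrite mul0r.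
have -> : (m `\` mset0)%mset = m by apply/msetP => z; rewrite msetE2 fsfunE subn0.
by rewrite addr0; case: eqP; rewrite ?mulr0.
Qed.

HB.instance Definition _ := GRing.isZmodMorphism.Build rat powser ps_const ps_const_is_zmod_morphism.
HB.instance Definition _ := GRing.isMonoidMorphism.Build rat powser ps_const ps_const_is_monoid_morphism.

Definition scalar : {rmorphism rat -> psfield} := (@FracField.tofrac powser) \o ps_const.

Section TableauxSum.
Variables (n k N : nat) (G : rel 'I_(n + k)).
Local Notation V := (n + k)%N.
Hypothesis le_kn : (k <= n)%N.
Hypothesis le_nN : (n <= N)%N.
Hypothesis nui : natural_unit_interval G.
Local Notation E := (fun i => (elementary i)%:F).

Lemma tableau_weightE (T : tableau) (c : 'I_V -> nat) :
    (forall v : 'I_V, vcolumn T v = (c v).+1) ->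
  tableau_weight G T = seq_weight E G c.
Proof.
move=> colT.
have nbE v : neighbor_columns G T v = [seq s.+1 | s <- [seq c u | u <- smaller_neighbors G v]].
  by rewrite -map_comp; apply: eq_map => u; apply: colT.
rewrite /seq_weight big_split /= [X in X * _]big_split /= prod_boolr /tableau_weight.
have -> : [forall v : 'I_V, (k <= v)%N ==> uniq (neighbor_columns G T v)]
    = [forall v : 'I_V, (k <= v)%N ==> uniq [seq c u | u <- smaller_neighbors G v]].
  by apply: eq_forallb => v; rewrite nbE (map_inj_uniq succn_inj).
case: ifP => _; last by rewrite !mul0r.
rewrite mul1r -big_split.
 apply: eq_bigr => v _ /=.
rewrite /vertex_weight nbE colT Aweight_col_weight /=; congr (_ * _).
by rewrite -[LHS]/(scalar _) rmorph_col_weight.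
Qed.

Section FixedEnds.
Variables (j : {ffun 'I_k -> 'I_N}) (S : tableau).
Hypothesis j_inj : injective j.
Hypothesis start_S : is_start (fun r => (j r).+1) S.

Let j_inj' : injective (fun r => j r : nat).
Proof. by move=> r r' /val_inj/j_inj. Qed.

Let A := tableaux_over n N (fun r => (j r).+1) S.

Lemma sum_tableaux_over :
  \sum_(T \in A) tableau_weight G T
  = \sum_(c : {ffun 'I_V -> 'I_N} | [forall r, (c (first_vertex le_kn r) == j r)
                                              && (c (rshift n r) == j r)])
      seq_weight E G (fun v => c v).
Proof.
have N_gt0 (v : 'I_V) : (0 < N)%N.
  by have := ltn_ord v; lia.
(* The remainder only serves to produce an ordinal: on A all columns lie between 1 and N. *)
pose h T : {ffun 'I_V -> 'I_N} :=
  [ffun v : 'I_V => Ordinal (ltn_pmod (vcolumn T v).-1 (N_gt0 v))].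
have hE T (v : 'I_V) : T \in A -> vcolumn T v = (h T v).+1.
  move=> TA; have /andP[col_gt0 colN] := vcolumn_le start_S v TA.
  rewrite ffunE; move: (vcolumn T v) col_gt0 colN => y y_gt0 yN.
  by rewrite /= modn_small prednK.
apply: (fsbig_reindex (h := h)) => [T TA|T T' TA T'A eq_h|c].
- split; last exact: tableau_weightE (fun v => hE T v TA).
  apply/forallP => r; move: (TA); rewrite inE => -[tabT _ ST _ last_T].
  apply/andP; split; apply/eqP/val_inj/succn_inj; rewrite -[LHS](hE T _ TA).
    exact: (vcolumn_first le_kn start_S).
  exact: last_T.
- apply: (tableaux_over_inj start_S TA T'A) => v.
  by rewrite !hE // eq_h.
move=> /forallP ends W.
have c_first r : c (first_vertex le_kn r) = j r :> nat.
  by have /andP[/eqP -> _] := ends r.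
have c_last r : c (rshift n r) = j r :> nat by have /andP[_ /eqP ->] := ends r.
have [T TA colT] := tableau_of_columns nui j_inj' (fun r => ltn_ord (j r)) start_S
  c_first (fun v => ltn_ord (c v)) (seq_weight_valid W) c_last.
exists T => //; apply/ffunP => v; apply: val_inj.
by have := colT v; rewrite hE // => -[].
Qed.
End FixedEnds.

Theorem sum_tableaux (start : {ffun 'I_k -> 'I_N} -> tableau) :
    (forall j : {ffun 'I_k -> 'I_N}, injective j ->
      is_start (fun r => (j r).+1) (start j)) ->
  \sum_(j : {ffun 'I_k -> 'I_N} | injectiveb j)
      \sum_(T \in tableaux_over n N (fun r => (j r).+1) (start j)) tableau_weight G T
  = \sum_(c : {ffun 'I_V -> 'I_N} | cyclic_seq c && injective_start c)
      seq_weight E G (fun v => c v).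
Proof.
move=> startP.
pose ends (c : {ffun 'I_V -> 'I_N}) := [ffun r => c (first_vertex le_kn r)].
have start_vertex (u : 'I_V) : (u < k)%N -> exists r, u = first_vertex le_kn r.
  by move=> uk; exists (Ordinal uk); apply: val_inj.
rewrite [RHS](partition_big ends (fun j => injectiveb j)) /=; last first.
  move=> c /andP[_ /'forall_forallP c_inj]; apply/injectiveP => r r'.
  rewrite !ffunE => E; have := c_inj (first_vertex le_kn r) (first_vertex le_kn r').
  by rewrite /= !ltn_ord E eqxx => /eqP/(congr1 val) rr'; apply: val_inj.
apply: eq_bigr => j /injectiveP j_inj.
rewrite (sum_tableaux_over j_inj (startP j j_inj)); apply: eq_bigl => c.
apply/forallP/andP => [cE|[/andP[/'forall_forallP c_cyc _] /eqP <-] r]; last first.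
  rewrite ffunE eqxx /=; have := c_cyc (first_vertex le_kn r) (rshift n r).
  by rewrite /= eqxx.
have ends_c : ends c = j by apply/ffunP => r; rewrite ffunE; have /andP[/eqP -> _] := cE r.
split; last exact/eqP.
apply/andP; split; apply/'forall_forallP => u v; apply/implyP.
  move/eqP => vE; have uk : (u < k)%N by have := ltn_ord v; rewrite vE ltn_add2l.
  have [r uE] := start_vertex u uk; have /andP[/eqP c1 /eqP c2] := cE r.
  have -> : v = rshift n r by apply: val_inj; rewrite /= vE uE.
  by rewrite uE c1 c2.
case/and3P => /start_vertex[r ->] /start_vertex[r' ->].
have /andP[/eqP -> _] := cE r; have /andP[/eqP -> _] := cE r'.
by move=> /eqP/j_inj ->.
Qed.
End TableauxSum.

Lemma elem_poly_coefE (R : comNzRingType) (T : finType) (x : T -> R) r :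
  (elem_poly x [set: T])`_r = \sum_(A : {set T} | #|A| == r) \prod_(i in A) x i.
Proof.
have -> : elem_poly x [set: T] = \sum_(A : {set T}) (\prod_(i in A) x i) *: 'X^#|A|.
  rewrite /elem_poly (eq_bigl xpredT) => [|i]; last by rewrite inE.
  under eq_bigr do rewrite addrC.
  rewrite bigA_distr; apply: eq_bigr => A _.
  rewrite -big_mkcond /= scaler_prod prodr_const //.
rewrite coef_sum [RHS]big_mkcond; apply: eq_bigr => A _.
by rewrite coefZ coefXn eq_sym; case: eqP => _; rewrite ?mulr1 ?mulr0.
Qed.

Lemma elem_poly_rmorph (R R' : comNzRingType) (f : {rmorphism R -> R'}) (T : finType)
    (x : T -> R) r :
  (elem_poly (fun i => f (x i)) [set: T])`_r = f ((elem_poly x [set: T])`_r).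
Proof.
rewrite !elem_poly_coefE rmorph_sum; apply: eq_bigr => A _.
by rewrite rmorph_prod.
Qed.

(** * Reduction to finitely many variables *)

Section Truncation.
Variable M : nat.

Definition small_monomial (m : monomial) := all (fun i => i < M)%N m.

Lemma small_monomialP (m : monomial) : reflect (forall i, i \in m -> (i < M)%N) (small_monomial m).
Proof. exact: allP. Qed.

(** The substitution x_i = 0 for all i >= M. *)
Definition truncate (f : powser) := PowSer (fun m => if small_monomial m then f m else 0).

Lemma truncate_is_zmod_morphism : zmod_morphism truncate.
Proof. by move=> f g; apply: powserP => m /=; case: ifP => _; rewrite ?subr0. Qed.

Lemma truncate_is_monoid_morphism : monoid_morphism truncate.
Proof.
split=> [|f g]; apply: powserP => m /=.
  case: eqP => [->|_]; last by case: ifP.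
  by rewrite (_ : small_monomial _) //; apply/small_monomialP => i; rewrite in_mset0.
case: ifP => sm.
  rewrite big_seq [RHS]big_seq; apply: eq_bigr => u; rewrite mem_mdivisors => /msubsetP um.
  have -> : small_monomial u.
    apply/small_monomialP => i; rewrite -mset_gt0 => ui.
    apply: (small_monomialP _ sm); rewrite -mset_gt0; exact: leq_trans (um i).
  suff -> : small_monomial (m `\` u)%mset by [].
  apply/small_monomialP => i; rewrite in_msetB => ui.
  by apply: (small_monomialP _ sm); rewrite -mset_gt0; apply: leq_ltn_trans ui.
rewrite big_seq big1 // => u; rewrite mem_mdivisors => /msubBK um.
case: ifP => su; last by rewrite mul0r.
case: ifP => smu; last by rewrite mulr0.
case/negP: (negbT sm); apply/small_monomialP => i; rewrite -um in_msetD.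
by case/orP => [/(small_monomialP _ su)|/(small_monomialP _ smu)].
Qed.

HB.instance Definition _ := GRing.isZmodMorphism.Build powser powser truncate
  truncate_is_zmod_morphism.
HB.instance Definition _ := GRing.isMonoidMorphism.Build powser powser truncate
  truncate_is_monoid_morphism.

Lemma truncate_const a : truncate (ps_const a) = ps_const a.
Proof.
apply: powserP => m /=; case: eqP => [->|_]; last by case: ifP.
by rewrite (_ : small_monomial _) //; apply/small_monomialP => i; rewrite in_mset0.
Qed.

Lemma coef_ps_sum (I : Type) (r : seq I) (p : pred I) (F : I -> powser) m :
  (\sum_(i <- r | p i) F i) m = \sum_(i <- r | p i) F i m.
Proof. by elim/big_rec2: _ => // i f y _ <-. Qed.

Lemma coef_prod_var (s : seq nat) (m : monomial) :
  (\prod_(c <- s) ps_var c) m = (m == seq_mset s)%:R.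
Proof.
elim: s m => [|c s IHs] m.
  rewrite big_nil /=; congr (_ == _)%:R; apply/msetP => i.
  by rewrite mset0E mset_seqE.
rewrite big_cons /=.
have seqE : seq_mset (c :: s) = (msetn 1 c `+` seq_mset s)%mset.
  by apply/msetP => i; rewrite mset1DE !mset_seqE /= eq_sym.
have [le_cm|N] := boolP (msetn 1 c `<=` m)%mset.
  rewrite (bigD1_seq (msetn 1 c)) ?mdivisors_uniq ?mem_mdivisors //= eqxx mul1r IHs.
  rewrite big1 ?addr0 => [|u /negPf ->]; last by rewrite mul0r.
  congr (_%:R); congr nat_of_bool; rewrite seqE -{2}(msubBK le_cm).
  by rewrite (inj_eq (can_inj (msetDKB _))).
rewrite big_seq big1 => [|u]; last first.
  rewrite mem_mdivisors => um; case: eqP => [uE|_]; last by rewrite mul0r.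
  by rewrite uE (negPf N) in um.
case: eqP => // mE; case/negP: N; rewrite mE seqE; apply/msubsetP => i.
by rewrite msetE2 leq_addr.
Qed.

(** Here s t lists the variables of the monomial of t. Only the members without large variables
    survive, and h matches them with a finite type. *)
Lemma truncate_ps_sum (T : choiceType) (D : set T) (I : finType) (p : pred I)
    (s : T -> seq nat) (s' : I -> seq nat) (h : T -> I) :
    (forall t, t \in D -> all (fun i => i < M)%N (s t) -> p (h t) /\ perm_eq (s t) (s' (h t))) ->
    (forall t t', t \in D -> t' \in D -> all (fun i => i < M)%N (s t) ->
       all (fun i => i < M)%N (s t') -> h t = h t' -> t = t') ->
    (forall i, p i -> all (fun i => i < M)%N (s' i) /\ exists2 t, t \in D & all (fun i => i < M)%N (s t) /\ h t = i) ->
  truncate (ps_sum D (fun t => \prod_(c <- s t) ps_var c))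
  = \sum_(i | p i) \prod_(c <- s' i) ps_var c.
Proof.
move=> Dh h_inj h_surj; apply: powserP => m /=; rewrite coef_ps_sum.
have coefE (r : seq nat) : (\prod_(c <- r) ps_var c) m != 0 ->
    m = seq_mset r.
  by rewrite coef_prod_var; case: (boolP (m == _)) => [/eqP//|_]; rewrite mulr0n eqxx.
have smallE (r : seq nat) : small_monomial (seq_mset r) = all (fun i => i < M)%N r.
  exact: perm_all (perm_eq_seq_mset r).
case: ifP => sm; last first.
  rewrite big1 // => i pi; apply/eqP; apply: contraFT sm => /coefE ->.
  by rewrite smallE; have [] := h_surj i pi.
rewrite fsbig_supp.
apply: (fsbig_reindex (h := h)) => [t|t t'|i pi gi].
- rewrite inE => -[Dt /eqP ft]; have st := coefE _ ft.
  have tD : t \in D by rewrite inE.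
  have [|pht pst] := Dh t tD; first by rewrite -smallE -st.
  split=> //; rewrite !coef_prod_var; congr (_ == _)%:R.
  exact/eq_seq_msetP.
- rewrite !inE => -[Dt /eqP/coefE st] [Dt' /eqP/coefE st'].
  by apply: h_inj; rewrite ?inE // -smallE -?st -?st'.
have [_ [t tD [st ht]]] := h_surj i pi.
exists t => //; rewrite inE; split; first by rewrite inE in tD.
have [_ pst] := Dh t tD st.
apply/eqP; apply: contraNneq gi; rewrite !coef_prod_var -ht => <-.
by apply/eqP; congr (_ == _)%:R; apply/esym/eq_seq_msetP.
Qed.

Lemma truncate_elementary r :
  truncate (elementary r) = (elem_poly (fun i : 'I_M => ps_var i) [set: 'I_M])`_r.
Proof.
rewrite elem_poly_coefE /elementary.
pose h (S : {fset nat}) : {set 'I_M} := [set i : 'I_M | (i : nat) \in S]%SET.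
rewrite (truncate_ps_sum (p := fun A : {set 'I_M} => #|A| == r) (s := fun S : {fset nat} => S)
  (s' := fun A : {set 'I_M} => [seq val i | i <- enum A]) (h := h)).
- by apply: eq_bigr => A _; rewrite big_map big_enum.
- move=> S; rewrite inE /= => cardS smallS.
  have permS : perm_eq S [seq val i | i <- enum (h S)].
    apply: uniq_perm; rewrite ?fset_uniq ?map_inj_uniq ?enum_uniq //; first exact: val_inj.
    move=> i; apply/idP/mapP => [iS|[i']]; last by rewrite mem_enum inE => ? ->.
    by exists (Ordinal (allP smallS i iS)) => //; rewrite mem_enum inE.
  by split=> //; rewrite cardE -(size_map val) -(perm_size permS) cardS.
- move=> S S' _ _ smallS smallS' /setP hSS'; apply/fsetP => i.
  apply/idP/idP => iS.
    by have := hSS' (Ordinal (allP smallS i iS)); rewrite !inE /= iS => <-.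
  by have := hSS' (Ordinal (allP smallS' i iS)); rewrite !inE /= iS => ->.
move=> A /eqP cardA; have smallA : all (fun i => i < M)%N [seq val i | i <- enum A].
  by apply/allP => i /mapP[i' _ ->]; apply: ltn_ord.
split=> //; exists [fset val i | i in A]%fset.
  by rewrite inE /= card_imfset //= ?cardE; [rewrite -cardE|exact: val_inj].
split; first by apply/allP => i /imfsetP[i' _ ->]; apply: ltn_ord.
apply/setP => i; rewrite inE; apply/imfsetP/idP => /= [[i' i'A /val_inj ->//]|iA].
by exists i.
Qed.

Lemma truncate_chromatic n (Gamma : rel 'I_n) (M' : nat) : M = M'.+1 ->
  truncate (chromatic Gamma)
  = \sum_(kappa : {ffun 'I_n -> 'I_M}
       | [forall u, forall v, Gamma u v ==> (kappa u != kappa v)])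
     \prod_u ps_var (kappa u).
Proof.
move=> ME; have M_gt0 : (0 < M)%N by rewrite ME.
pose h (kappa : {ffun 'I_n -> nat}) : {ffun 'I_n -> 'I_M} :=
  [ffun v => Ordinal (ltn_pmod (kappa v) M_gt0)].
pose s (kappa : {ffun 'I_n -> nat}) := [seq kappa v | v <- enum 'I_n].
pose s' (kappa : {ffun 'I_n -> 'I_M}) := [seq val (kappa v) | v <- enum 'I_n].
have -> : chromatic Gamma = ps_sum (proper_coloring Gamma) (fun t => \prod_(c <- s t) ps_var c).
  rewrite /chromatic; congr ps_sum; apply: funext => kappa.
  by rewrite big_map big_enum.
have hE kappa v : all (fun i => i < M)%N (s kappa) -> h kappa v = kappa v :> nat.
  by move=> /allP small; rewrite ffunE /= modn_small // small // map_f ?mem_enum.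
rewrite (truncate_ps_sum (s' := s') (h := h)
  (p := fun kappa : {ffun 'I_n -> 'I_M} =>
     [forall u, forall v, Gamma u v ==> (kappa u != kappa v)])).
- by apply: eq_bigr => kappa _; rewrite big_map big_enum.
- move=> kappa; rewrite inE => proper small; split.
    apply/'forall_'forall_implyP => u v Guv; rewrite -val_eqE /= !hE //.
    exact: proper.
  rewrite (_ : s' _ = s kappa) //; apply: eq_map => v; exact: hE.
- move=> kappa kappa' _ _ small small' hh; apply/ffunP => v.
  by rewrite -hE // hh hE.
move=> kappa /'forall_'forall_implyP proper.
have small : all (fun i => i < M)%N (s' kappa).
  by apply/allP => i /mapP[v _ ->]; apply: ltn_ord.
split=> //; exists [ffun v => val (kappa v)].
  by rewrite inE => u v Guv; rewrite !ffunE val_eqE proper.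
have sE : s [ffun v => val (kappa v)] = s' kappa by apply: eq_map => v; rewrite ffunE.
split; first by rewrite sE.
by apply/ffunP => v; apply: val_inj; rewrite /= hE ?sE // ffunE.
Qed.
End Truncation.

Section ColumnBound.
Variables (n k : nat) (G : rel 'I_(n + k)).
Local Notation V := (n + k)%N.
Hypothesis le_kn : (k <= n)%N.

(* Around the cycle the set of columns in use is closed under predecessor. *)
Lemma cyclic_columns_lt (L : fieldType) (e : nat -> L) (c : 'I_V -> nat) :
  cyclic_seq c -> seq_weight e G c != 0 -> forall v, (c v < n)%N.
Proof.
move=> /'forall_forallP c_cyc /seq_weight_valid valid.
pose c0 (u : 'I_n) := c (lshift k u).
have c_ends (r : 'I_k) : c (rshift n r) = c0 (widen_ord le_kn r).
  by have := c_cyc (lshift k (widen_ord le_kn r)) (rshift n r); rewrite /= eqxx => /eqP.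
have c_c0 v : exists u, c v = c0 u.
  case: (splitP v) => [u vu|r vr]; first by exists u; congr c; apply: val_inj.
  by exists (widen_ord le_kn r); rewrite -c_ends; congr c; apply: val_inj.
have c0_down u y : c0 u = y.+1 -> exists u', c0 u' = y.
  move=> uy; have [v kv cv] : exists2 v : 'I_V, (k <= v)%N & c v = y.+1.
    have [uk|ku] := ltnP u k; last by exists (lshift k u).
    exists (rshift n (Ordinal uk)); first by rewrite /= (leq_trans le_kn) ?leq_addr.
    by rewrite c_ends -uy; congr c0; apply: val_inj.
  have [[c0v|[w _ cw]] _] := valid v kv; first by rewrite cv in c0v.
  by have [u' wu'] := c_c0 w; exists u'; move: cw; rewrite cv -wu' => -[].
have c0_le u d : (d <= c0 u)%N -> exists u', c0 u' = (c0 u - d)%N.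
  elim: d => [_|d IHd du]; first by exists u; rewrite subn0.
  have [u' u'E] := IHd (ltnW du); apply: (c0_down u'); rewrite u'E; lia.
move=> v; have [u ->] := c_c0 v.
have sub : {subset iota 0 (c0 u).+1 <= [seq c0 u' | u' <- enum 'I_n]}.
  move=> y; rewrite mem_iota /= add0n ltnS => yu.
  have [|u' u'E] := c0_le u (c0 u - y)%N; first exact: leq_subr.
  by apply/mapP; exists u'; rewrite ?mem_enum // u'E subKn.
by have := uniq_leq_size (iota_uniq _ _) sub; rewrite size_iota size_map size_enum_ord.
Qed.

(** By [cyclic_columns_lt] sequences using a column >= N have weight 0. This links the N of the
    theorem to the number M of variables. *)
Lemma sum_seq_weight_widen (L : fieldType) (e : nat -> L) N M :
    (n <= N)%N -> (N <= M)%N ->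
  \sum_(c : {ffun 'I_V -> 'I_M} | cyclic_seq c && injective_start c)
     seq_weight e G (fun v => c v)
  = \sum_(c : {ffun 'I_V -> 'I_N} | cyclic_seq c && injective_start c)
     seq_weight e G (fun v => c v).
Proof.
move=> nN NM; have N_gt0 (v : 'I_V) : (0 < N)%N by have := ltn_ord v; lia.
pose up (c : {ffun 'I_V -> 'I_N}) := [ffun v : 'I_V => widen_ord NM (c v)].
pose down (c : {ffun 'I_V -> 'I_M}) :=
  [ffun v : 'I_V => Ordinal (ltn_pmod (c v) (N_gt0 v))].
rewrite (bigID (fun c : {ffun 'I_V -> 'I_M} => [forall v, c v < N]%N)) /=.
rewrite [X in _ + X]big1 ?addr0; last first.
  move=> c /andP[/andP[c_cyc _] /forallPn[v cvN]]; apply/eqP.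
  apply: contraNT cvN => W; apply: leq_trans nN.
  apply: (cyclic_columns_lt (c := fun v => c v) _ W).
  by apply/'forall_forallP => u w; have /'forall_forallP/(_ u w) := c_cyc; rewrite -val_eqE.
rewrite (reindex_onto up down) /=; last first.
  move=> c /andP[_ /forallP cN]; apply/ffunP => v; apply: val_inj.
  by rewrite !ffunE /= modn_small.
apply: eq_big => [c|c _]; last first.
  by congr seq_weight; apply: funext => v; rewrite ffunE.
have upE v : up c v = c v :> nat by rewrite ffunE.
have -> : down (up c) == c.
  by apply/eqP/ffunP => v; apply: val_inj; rewrite ffunE /= upE modn_small.
have -> : [forall v, up c v < N]%N by apply/forallP => v; rewrite upE.
rewrite !andbT; congr (_ && _); apply: eq_forallb => u; apply: eq_forallb => v.
  by rewrite -!val_eqE /= !upE.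
by rewrite -!val_eqE /= !upE.
Qed.
End ColumnBound.

(** * Clearing denominators and conclusion *)

Lemma tofrac_inj : injective (@FracField.tofrac powser).
Proof. by move=> f g /eqP; rewrite tofrac_eq => /eqP. Qed.

Lemma ps_var_inj : injective ps_var.
Proof.
move=> i i' /(congr1 (fun f : powser => f (msetn 1 i))) /=; rewrite eqxx.
case: eqP => [E _|_ /eqP]; last by rewrite oner_eq0.
have := congr1 (fun m : monomial => m i') E; rewrite msetnE msetnxx.
by case: eqP.
Qed.

(** The coefficient of the product of the first r variables is 1. *)
Lemma elem_poly_var_neq0 M r : (r <= M)%N ->
  (elem_poly (fun i : 'I_M => ps_var i) [set: 'I_M])`_r != 0.
Proof.
move=> rM; rewrite elem_poly_coefE.
pose A : {set 'I_M} := [set i : 'I_M | (i < r)%N]%SET.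
have cardA : #|A| = r.
  by rewrite -sum1_card (eq_bigl (fun i : 'I_M => i < r)%N) ?(big_ord_narrow rM) ?sum1_card ?card_ord // => i; rewrite inE.
have prodE (B : {set 'I_M}) : \prod_(i in B) ps_var i = \prod_(i <- [seq val i | i <- enum B]) ps_var i.
  by rewrite big_map big_enum.
pose mA := seq_mset [seq val i | i <- enum A].
apply/eqP => /(congr1 (fun f : powser => f mA)); rewrite coef_ps_sum /=.
rewrite (bigD1 A) ?cardA //= prodE coef_prod_var eqxx big1 ?addr0 => [/eqP|B /andP[_ BA]].
  by rewrite oner_eq0.
rewrite prodE coef_prod_var; case: eqP => // /eq_seq_msetP /perm_mem memAB.
case/eqP: BA; apply/setP => i; have := memAB (val i).
by rewrite !(mem_map val_inj) !mem_enum.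
Qed.

(** The multiplier is the same for all c: for each v it contains every e_i with i < N, whichever one
    the column of v puts in the denominator. *)
Lemma seq_weight_clear (L : fieldType) (e : nat -> L) n k (G : rel 'I_(n + k)) N
    (c : 'I_(n + k) -> 'I_N) : (forall i, (i < N)%N -> e i != 0) ->
  seq_weight e G (fun v => c v) * \prod_(v : 'I_(n + k) | (k <= v)%N) \prod_(i < N) e i
  = \prod_(v : 'I_(n + k) | (k <= v)%N)
     ((uniq [seq (c u : nat) | u <- smaller_neighbors G v])%:R
      * col_weight L (c v) [seq (c u : nat) | u <- smaller_neighbors G v]
      * (e (c v).+1 * \prod_(i < N | i != c v) e i)).
Proof.
move=> e_neq0; rewrite -big_split; apply: eq_bigr => v _ /=.
rewrite (bigD1 (c v)) //= -!mulrA; congr (_ * (_ * (_ * _))).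
by rewrite mulKf ?e_neq0.
Qed.

Theorem theorem1 (R : realType) (n k N : nat)
    (G : rel 'I_(n + k)) (Gamma : rel 'I_n)
    (start : {ffun 'I_k -> 'I_N} -> tableau) :
  (k <= n)%N -> (n <= N)%N ->
  natural_unit_interval G ->
  clique_on G [set v : 'I_(n + k) | (v < k)%N] ->
  clique_on G [set v : 'I_(n + k) | (n <= v)%N] ->
  Gamma =2 identify_ends G ->
  simple_graph Gamma ->
  proper_circular_arc R Gamma ->
  (forall j : {ffun 'I_k -> 'I_N}, injective j ->
      is_start (fun r => (j r).+1) (start j)) ->
  (chromatic Gamma)%:F =
    \sum_(j : {ffun 'I_k -> 'I_N} | injectiveb j)
      \sum_(T \in tableaux_over n N (fun r => (j r).+1) (start j))
        tableau_weight G T.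
Proof.
move=> kn nN nui cl1 cl2 GammaE _ _ startP; rewrite (sum_tableaux kn nN nui startP).
pose E i := (elementary i)%:F.
have trunc_neq0 M i : (i <= M)%N -> truncate M (elementary i) != 0.
  by move=> iM; rewrite truncate_elementary elem_poly_var_neq0.
have E_neq0 i : E i != 0.
  rewrite tofrac_eq0; apply: contraNneq (trunc_neq0 i i (leqnn i)) => ->.
  by rewrite rmorph0.
pose den : powser := \prod_(v : 'I_(n + k) | (k <= v)%N) \prod_(i < N) elementary i.
pose num (c : {ffun 'I_(n + k) -> 'I_N}) : powser := \prod_(v : 'I_(n + k) | (k <= v)%N)
     (ps_const ((uniq [seq (c u : nat) | u <- smaller_neighbors G v])%:R
        * col_weight rat (c v) [seq (c u : nat) | u <- smaller_neighbors G v])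
      * (elementary (c v).+1 * \prod_(i < N | i != c v) elementary i)).
(* Used twice: with the identity, to leave the fraction field, and with [truncate M], to return to
   quotients of truncated series. *)
have clear (phi : {rmorphism powser -> powser}) :
    (forall a, phi (ps_const a) = ps_const a) ->
    (forall i, (i < N)%N -> phi (elementary i) != 0) ->
    forall c : {ffun 'I_(n + k) -> 'I_N},
    seq_weight (fun i => (phi (elementary i))%:F) G (fun v => c v) * (phi den)%:F
    = (phi (num c))%:F.
  move=> phi_const phi_neq0 c.
  have -> : (phi den)%:F = \prod_(v : 'I_(n + k) | (k <= v)%N) \prod_(i < N) (phi (elementary i))%:F.
    by rewrite !rmorph_prod; apply: eq_bigr.
  have e_neq0 i : (i < N)%N -> (phi (elementary i))%:F != 0.
    by move=> iN; rewrite tofrac_eq0 phi_neq0.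
  apply: (etrans (seq_weight_clear G c e_neq0)).
  rewrite !rmorph_prod; apply: eq_bigr => v _.
  rewrite [phi (_ * _)]rmorphM [RHS]rmorphM phi_const; congr (_ * _).
    by rewrite -[RHS]/(scalar _) rmorphM rmorph_nat rmorph_col_weight.
  by rewrite [phi (_ * _)]rmorphM [RHS]rmorphM !rmorph_prod.
have den_neq0 : den%:F != 0.
  rewrite tofrac_eq0; apply/prodf_neq0 => v _; apply/prodf_neq0 => i _.
  by have := E_neq0 i; rewrite tofrac_eq0.
apply: (mulIf den_neq0); rewrite mulr_suml.
rewrite (eq_bigr (fun c => (num c)%:F)) => [|c _]; last first.
  by apply: (clear idfun) => // i _; have := E_neq0 i; rewrite tofrac_eq0.
rewrite -rmorphM -rmorph_sum; congr (_%:F); apply: powserP => m.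
(* M exceeds every index in m, so truncation keeps the coefficient at m, and it exceeds N, so no
   denominator is truncated to 0. *)
pose M' := (N + \max_(i <- m) i)%N; pose M := M'.+1.
have NM : (N <= M)%N by rewrite /M /M'; lia.
have small_m : small_monomial M m.
  apply/small_monomialP => i im; rewrite /M ltnS /M'.
  by rewrite (leq_trans (leq_bigmax_seq _ im isT)) ?leq_addl.
suff trunc_eq : truncate M (chromatic Gamma * den)
    = truncate M (\sum_(c : {ffun 'I_(n + k) -> 'I_N} | cyclic_seq c && injective_start c) num c).
  by have := congr1 (fun f : powser => f m) trunc_eq; rewrite /= small_m.
apply: tofrac_inj.
rewrite rmorphM [in RHS]rmorph_sum rmorphM [in RHS]rmorph_sum.
have clear_trunc c : (truncate M (num c))%:F
    = seq_weight (fun i => (truncate M (elementary i))%:F) G (fun v => c v) * (truncate M den)%:F.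
  apply/esym/(clear (truncate M)) => [a|i iN]; first exact: truncate_const.
  by apply: trunc_neq0; lia.
rewrite (eq_bigr _ (fun c _ => clear_trunc c)).
rewrite -mulr_suml; congr (_ * _).
pose x (i : 'I_M) : psfield := (ps_var i)%:F.
have x_inj : injective x.
  by move=> i i' /tofrac_inj/ps_var_inj/val_inj.
have natL_neq0 r : r.+1%:R != 0 :> psfield.
  by rewrite -(rmorph_nat scalar) fmorph_eq0 pnatr_eq0.
have esyE r : (elem_poly x [set: 'I_M])`_r = (truncate M (elementary r))%:F.
  by rewrite truncate_elementary (elem_poly_rmorph (@FracField.tofrac powser)).
have esy_neq0 r : (r <= M)%N -> (elem_poly x [set: 'I_M])`_r != 0.
  by move=> rM; rewrite esyE tofrac_eq0 trunc_neq0.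
have nM : (n <= M)%N by apply: leq_trans NM.
have finite := finite_identity kn nui cl1 cl2 x_inj natL_neq0 esy_neq0 nM GammaE.
(* The finite identity has as many columns as colours, namely M; those beyond N contribute
   nothing. *)
rewrite -(sum_seq_weight_widen G kn _ nN NM).
transitivity (\sum_(kappa : {ffun 'I_n -> 'I_M}
    | [forall u, forall v, Gamma u v ==> (kappa u != kappa v)]) \prod_u x (kappa u)).
  apply: (etrans (congr1 (@FracField.tofrac powser) (truncate_chromatic Gamma (erefl M)))).
  by rewrite rmorph_sum; apply: eq_bigr => kappa _; rewrite rmorph_prod.
by rewrite finite (funext esyE).
Qed.
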